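(* Assume the setting below and hypothesis $(H_b)$: for every $\alpha\in\overline V$ the solution $x(\cdot,z_\alpha,0)$ of the unperturbed system $x'=F_0(t,x)$ is defined on $[0,T]$ and satisfies $x(T,z_\alpha,0)=z_\alpha$ (so it is $T$-periodic). Assume moreover: (i) for each $\alpha\in\overline V$, $\det\Delta_\alpha\neq 0$, where $\Delta_\alpha$ is the lower right $(m-d)\times(m-d)$ block of the matrix $\mathrm{Id}-Y^{-1}(T,z_\alpha)$; (ii) $f_1=f_2=\dots=f_{k-1}=0$ on $\overline V$ and $f_k$ is not identically zero. If there exists $\alpha^*\in V$ with $f_k(\alpha^* )=0$ and $\det(Df_k(\alpha^* ))\neq0$, then for $|\varepsilon|\neq0$ sufficiently small the system $x'=F(t,x,\varepsilon)$ has a $T$-periodic solution $\varphi(t,\varepsilon)$ with $|\varphi(0,\varepsilon)-z_{\alpha^*}|=\mathcal O(\varepsilon)$.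
   Context: Setting. Let $k\ge1$, $m\ge2$, $1\le d<m$, $n>1$ be integers, $T>0$, and $0=t_0<t_1<\dots<t_{n-1}<t_n=T$. Let $D\subset\mathbb R^m$ be open and $\varepsilon_0>0$. For $i=0,\dots,k$ and $j=1,\dots,n$ let $F_i^j:\mathbb R\times D\to\mathbb R^m$ and $R^j:\mathbb R\times D\times(-\varepsilon_0,\varepsilon_0)\to\mathbb R^m$ be $C^{k+1}$ and $T$-periodic in $t$. Put $F_i(t,x)=F_i^j(t,x)$, $R(t,x,\varepsilon)=R^j(t,x,\varepsilon)$ for $t\in[t_{j-1},t_j)$ (extended $T$-periodically), and consider the piecewise smooth system $x'=F(t,x,\varepsilon)=\sum_{i=0}^k\varepsilon^iF_i(t,x)+\varepsilon^{k+1}R(t,x,\varepsilon)$, whose discontinuity set $\{t=t_j\}$ is crossed by all orbits. Its solution with $x(0)=z$ is $x(t,z,\varepsilon)=x_j(t,z,\varepsilon)$ for $t\in[t_{j-1},t_j]$, where $x_1$ solves $x'=\sum_i\varepsilon^iF_i^1+\varepsilon^{k+1}R^1$ with $x_1(0,z,\varepsilon)=z$ and $x_j$ solves $x'=\sum_i\varepsilon^iF_i^j+\varepsilon^{k+1}R^j$ with $x_j(t_{j-1},z,\varepsilon)=x_{j-1}(t_{j-1},z,\varepsilon)$. Fundamental matrix: $Y_1(t,z)=\frac{\partial x_1}{\partial z}(t,z,0)$, $Y_j(t,z)=\frac{\partial x_j}{\partial z}(t,z,0)\big(\frac{\partial x_j}{\partial z}(t_{j-1},z,0)\big)^{-1}Y_{j-1}(t_{j-1},z)$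 for $j\ge2$, and $Y(t,z)=Y_j(t,z)$ for $t\in[t_{j-1},t_j]$. Multilinear notation: for a sufficiently smooth $G$ and vectors $y_1,\dots,y_L\in\mathbb R^m$, $\partial^LG(t,x)\bigodot_{j=1}^Ly_j=\sum_{i_1,\dots,i_L=1}^m\frac{\partial^LG(t,x)}{\partial x_{i_1}\cdots\partial x_{i_L}}y_{1i_1}\cdots y_{Li_L}$; $\partial^0$ is the identity; $y^{c}$ means $y$ repeated $c$ times; for piecewise $F_i$, derivatives are taken piecewise ($\partial^LF_i=\partial^LF_i^j$ on $[t_{j-1},t_j)$). $S_l$ is the set of $l$-tuples $(c_1,\dots,c_l)$ of nonnegative integers with $c_1+2c_2+\dots+lc_l=l$, $L=c_1+\dots+c_l$; $S_0$ consists of the empty tuple with $L=0$. $S'_i$ is the set of $(i-1)$-tuples $(c_1,\dots,c_{i-1})$ of nonnegative integers with $c_1+2c_2+\dots+(i-1)c_{i-1}=i$, $I'=c_1+\dots+c_{i-1}$. Write $K(c)=c_1!\,1!^{c_1}c_2!\,2!^{c_2}\cdots c_l!\,l!^{c_l}$. Averaged functions: $y_i(t,z)$, $i=1,\dots,k$, are the (continuous) solutions on $[0,T]$ of $y_i(t,z)=\int_0^t\Big(i!F_i(s,x(s,z,0))+\sum_{l=1}^{i}\sum_{S_l}\frac{i!}{K(b)}\partial^LF_{i-l}(s,x(s,z,0))\bigodot_{j=1}^ly_j(s,z)^{b_j}\Big)ds$ (for $i=1$: $y_1=\int_0^t(F_1+\partial F_0\,y_1)ds$). Set $g_0(z)=Y^{-1}(T,z)(x(T,z,0)-z)$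 and $g_i(z)=Y^{-1}(T,z)\,y_i(T,z)/i!$. Manifold: $V\subset\mathbb R^d$ open bounded, $\beta:\overline V\to\mathbb R^{m-d}$ of class $C^{k+1}$, $\mathcal Z=\{z_\alpha=(\alpha,\beta(\alpha)):\alpha\in\overline V\}\subset D$. Write $z=(a,b)\in\mathbb R^d\times\mathbb R^{m-d}$, $\pi(a,b)=a$, $\pi^\perp(a,b)=b$; $\partial_b^L$ is the $L$-multilinear derivative with respect to $b$ only. Bifurcation functions: with $\Delta_\alpha$ as in (i), $\gamma_1(\alpha)=-\Delta_\alpha^{-1}\pi^\perp g_1(z_\alpha)$ and for $i\ge2$, $\gamma_i(\alpha)=-i!\,\Delta_\alpha^{-1}\Big(\sum_{S'_i}\frac{1}{K(c)}\partial_b^{I'}\pi^\perp g_0(z_\alpha)\bigodot_{j=1}^{i-1}\gamma_j(\alpha)^{c_j}+\sum_{l=0}^{i-1}\sum_{S_l}\frac1{K(c)}\partial_b^L\pi^\perp g_{i-l}(z_\alpha)\bigodot_{j=1}^l\gamma_j(\alpha)^{c_j}\Big)$ (the $l=0$ term is $\pi^\perp g_i(z_\alpha)$); and $f_i(\alpha)=\pi g_i(z_\alpha)+\sum_{l=1}^i\sum_{S_l}\frac1{K(c)}\partial_b^L\pi g_{i-l}(z_\alpha)\bigodot_{j=1}^l\gamma_j(\alpha)^{c_j}$. *)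

(* Defs.v *)
From HB Require Import structures.
From mathcomp Require Import all_boot all_order all_algebra.
From mathcomp Require Import all_classical all_reals all_analysis.
Set Implicit Arguments. Unset Strict Implicit. Unset Printing Implicit Defensive.
Import Order.TTheory GRing.Theory Num.Theory.
Import numFieldNormedType.Exports.
Local Open Scope classical_set_scope.
Local Open Scope ring_scope.

(* C^r regularity on an (open) set A: all iterated directional derivatives   *)
(* of order <= r exist on A and are continuous on A.  In finite dimension     *)
(* this is the usual notion of a C^r map.                                    *)
Fixpoint Cr {K : numFieldType} {U W : normedModType K} (r : nat) (A : set U)
  (g : U -> W) : Prop :=
  (forall x, A x -> {for x, continuous g}) /\
  match r with
  | 0 => True
  | r'.+1 => (forall x v, A x -> derivable g x v) /\
             (forall v, Cr r' A (fun x => 'D_v g x))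
  end.

(* Iterated directional derivative: the L-multilinear derivative
   d^L G(x) (v_1, ..., v_L) for vs = [:: v_1; ...; v_L]; iterD G [::] = G. *)
Definition iterD {K : numFieldType} {U W : normedModType K} (G : U -> W)
  (vs : seq U) : U -> W := foldr (fun v g x => 'D_v g x) G vs.

(* Tuples (c_1, ..., c_l) of nonnegative integers with sum_j j c_j = s.
   c : {ffun 'I_l -> 'I_s.+1}, c j stands for c_(j+1) (necessarily <= s).
   S_l = Sset l l,  S'_i = Sset (i-1) i. *)
Definition Sset (l s : nat) : pred {ffun 'I_l -> 'I_s.+1} :=
  fun c => (\sum_(j < l) (j.+1 * c j))%N == s.
Arguments Sset : clear implicits.

Definition Kc (l s : nat) (c : {ffun 'I_l -> 'I_s.+1}) : nat :=
  (\prod_(j < l) ((c j)`! * (j.+1)`! ^ (c j)))%N.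

Definition dirs (U : Type) (l s : nat) (c : {ffun 'I_l -> 'I_s.+1})
  (w : nat -> U) : seq U :=
  flatten [seq nseq (c j) (w j.+1) | j <- enum 'I_l].

Section PWS.
Variables (R : realType) (d e : nat).
Local Notation vec := 'cV[R]_(d + e).

Definition tmod (T t : R) : R := t - (Num.floor (t / T))%:~R * T.

Variables (n k : nat) (T : R) (ts : nat -> R).
Variables (Fi : nat -> nat -> R -> vec -> vec) (Rj : nat -> R -> vec -> R -> vec).
Variable (D : set vec).

Definition inpiece (j : nat) (t : R) : bool :=
  (ts j.-1 <= tmod T t) && (tmod T t < ts j).

Definition pw (G : nat -> R -> vec -> vec) (t : R) (x : vec) : vec :=
  \sum_(1 <= j < n.+1) (if inpiece j t then G j t x else 0).

Definition Ffull (eps : R) (t : R) (x : vec) : vec :=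
  \sum_(i < k.+1) (eps ^+ i) *: pw (Fi i) t x
  + (eps ^+ k.+1) *: pw (fun j s y => Rj j s y eps) t x.

Definition dPF (i : nat) (vs : seq vec) (t : R) (x : vec) : vec :=
  \sum_(1 <= j < n.+1) (if inpiece j t then iterD (Fi i j t) vs x else 0).

Definition sol_on (G : R -> vec -> vec) (z : vec) (phi : R -> vec) : Prop :=
  phi 0 = z /\
  (forall t, 0 <= t <= T -> D (phi t)) /\
  {within `[0, T], continuous phi} /\
  (forall t, 0 < t < T -> (forall j, (j <= n)%N -> t != ts j) ->
     is_derive t (1 : R) phi (G t (phi t))).

Definition flow (eps t : R) (z : vec) : vec :=
  [get phi : R -> vec | sol_on (Ffull eps) z phi] t.

Definition Jac (t : R) (z : vec) : 'M[R]_(d + e) :=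
  \matrix_(i, j) ('D_(delta_mx j 0 : vec) (fun w => flow 0 t w) z) i 0.

Fixpoint Yr (j : nat) (t : R) (z : vec) : 'M[R]_(d + e) :=
  match j with
  | 0 => 1%:M
  | j'.+1 => if j' is 0 then Jac t z
             else Jac t z *m invmx (Jac (ts j') z) *m Yr j' (ts j') z
  end.

Definition YT (z : vec) : 'M[R]_(d + e) := Yr n T z.

Definition vint (f : R -> vec) (a b : R) : vec :=
  \col_i Rintegral (@lebesgue_measure R) `[a, b] (fun s => f s i 0).

(* integrand defining y_i, given the family yy j = y_j(., z) *)
Definition integrand (i : nat) (z : vec) (yy : nat -> R -> vec) (s : R) : vec :=
  (i`!)%:R *: pw (Fi i) s (flow 0 s z)
  + \sum_(1 <= l < i.+1) \sum_(b : {ffun 'I_l -> 'I_l.+1} | Sset l l b)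
      ((i`!)%:R / (Kc b)%:R) *: dPF (i - l) (dirs b (fun j => yy j s)) s (flow 0 s z).

(* ys i j = y_j for j <= i (y_j defined as the continuous solution on [0,T]
   of its integral equation) *)
Fixpoint ys (i : nat) : nat -> R -> vec -> vec :=
  match i with
  | 0 => fun _ _ _ => 0
  | i'.+1 =>
    let prev := ys i' in
    let yi := fun (t : R) (z : vec) =>
      [get psi : R -> vec |
        {within `[0, T], continuous psi} /\
        (forall t, 0 <= t <= T ->
           psi t = vint (integrand i'.+1 z
                     (fun j => if j == i'.+1 then psi else (fun s => prev j s z))) 0 t)] t in
    fun j => if j == i'.+1 then yi else prev j
  end.

Definition yfun (i : nat) : R -> vec -> vec := ys i i.

Definition gfun (i : nat) (z : vec) : vec :=
  if i is 0 then invmx (YT z) *m (flow 0 T z - z)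
  else ((i`!)%:R)^-1 *: (invmx (YT z) *m yfun i T z).

Variable beta : 'cV[R]_d -> 'cV[R]_e.

Definition zof (a : 'cV[R]_d) : vec := col_mx a (beta a).
Definition liftb (g : 'cV[R]_e) : vec := col_mx 0 g.

Definition Delta (a : 'cV[R]_d) : 'M[R]_e :=
  drsubmx (1%:M - invmx (YT (zof a)) : 'M[R]_(d + e, d + e)).

(* gams a i j = gamma_j(a) for j <= i *)
Fixpoint gams (a : 'cV[R]_d) (i : nat) : nat -> 'cV[R]_e :=
  match i with
  | 0 => fun _ => 0
  | i'.+1 =>
    let prev := gams a i' in
    let gi :=
      if i' is 0 then - (invmx (Delta a) *m dsubmx (gfun 1 (zof a)))
      else - ((i'.+1)`!)%:R *: (invmx (Delta a) *m
        (\sum_(c : {ffun 'I_i' -> 'I_i'.+2} | Sset i' i'.+1 c)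
            ((Kc c)%:R)^-1 *: iterD (fun z => dsubmx (gfun 0 z))
                                  (dirs c (fun j => liftb (prev j))) (zof a)
         + \sum_(l < i'.+1) \sum_(c : {ffun 'I_l -> 'I_l.+1} | Sset l l c)
            ((Kc c)%:R)^-1 *: iterD (fun z => dsubmx (gfun (i'.+1 - l) z))
                                  (dirs c (fun j => liftb (prev j))) (zof a))) in
    fun j => if j == i'.+1 then gi else prev j
  end.

Definition gam (a : 'cV[R]_d) (i : nat) : 'cV[R]_e := gams a i i.

Definition fb (i : nat) (a : 'cV[R]_d) : 'cV[R]_d :=
  usubmx (gfun i (zof a))
  + \sum_(1 <= l < i.+1) \sum_(c : {ffun 'I_l -> 'I_l.+1} | Sset l l c)
      ((Kc c)%:R)^-1 *: iterD (fun z => usubmx (gfun (i - l) z))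
                            (dirs c (fun j => liftb (gam a j))) (zof a).

Definition Dfb (i : nat) (a : 'cV[R]_d) : 'M[R]_d :=
  \matrix_(p, q) ('D_(delta_mx q 0 : 'cV[R]_d) (fb i) a) p 0.

End PWS.

(* Main.v *)
(* With the parameter eps added to the state, the piecewise flow is as smooth in (z, eps) as the
   field, by the variational equation and induction on the order. Expanding the integral
   equation with Faa di Bruno's formula and Gronwall's inequality shows that the averaged
   function y_i(T, z) is the i-th eps-derivative at 0 of x(T, z, eps), so Y(T, z) sum_i eps^i
   g_i(z) is the Taylor expansion of the displacement map h(z, eps) = x(T, z, eps) - z. The
   blocks of Y(T, z0)^-1 h, where z0 is z at alpha*, are then treated by a Lyapunov-Schmidt
   reduction: the lower one is solved for b by the implicit function theorem, and the formulas
   for gamma_i and f_i say that along the solution the upper one is eps^k (f_k + o(f_k)) +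
   o(eps^k). Strict differentiability of its k-th eps-derivative makes the Newton map of the
   quotient by eps^k a contraction near alpha*, whose fixed point is the initial condition of
   the periodic solution. *)
Require Import Defs.
From HB Require Import structures.
From mathcomp Require Import all_boot all_order all_algebra.
From mathcomp Require Import all_classical all_reals all_analysis.
From mathcomp Require Import ring lra.
Import Order.TTheory GRing.Theory Num.Theory.
Import numFieldNormedType.Exports.
Local Open Scope classical_set_scope.
Local Open Scope ring_scope.
Set Implicit Arguments. Unset Strict Implicit. Unset Printing Implicit Defensive.

(* [ssrnat] also exports an [iterD]. *)
Local Notation iterD := Defs.iterD.

(** * Parametric differentiability classes *)

(** The preconditioner is frozen at alpha* because of a loss of derivatives. The flow is C^(k+1) in
    (z, eps), but Y(T, z) is one of its z-derivatives, hence only C^k; after multiplication by Y(T,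
    z)^-1 no derivative would be left for the k-th eps-coefficient, and f_k itself is assumed
    differentiable only at alpha*. With the constant matrix Y(T, z0)^-1 the k-th coefficient of the
    reduced map stays C^1, hence strictly differentiable. The price is the factor Y(T, z0)^-1 Y(T,
    z_alpha), which is not the identity away from alpha*. It tends to the identity there, so the
    error is o(|f_k|), and as f_k vanishes at alpha* this error does not change the derivative at
    alpha*. Coefficients are not computed by differentiating compositions: two truncated expansions
    are compared, and the coefficients are read off from a bound on the difference for small eps. In
    this way each function is used with the derivatives that it has. *)

Section ParametricCr.
Context {R : realType}.

(* The parameter [p] (usually time) enters only continuously: this is the regularity in [x]
   that survives along a solution, and it needs no smoothness in time. *)
Fixpoint PCr {P : topologicalType} {U W : normedModType R} (r : nat) (A : set U)
  (f : P -> U -> W) : Prop :=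
  (forall p x, A x -> {for (p, x), continuous (fun q : P * U => f q.1 q.2)}) /\
  match r with
  | 0 => True
  | r'.+1 => (forall p x v, A x -> derivable (f p) x v) /\
             (forall v, PCr r' A (fun p x => 'D_v (f p) x))
  end.

Lemma PCr_cont (P : topologicalType) (U W : normedModType R) r (A : set U)
    (f : P -> U -> W) p x :
  PCr r A f -> A x -> {for (p, x), continuous (fun q : P * U => f q.1 q.2)}.
Proof. by case: r => [|r] [+ _]; exact. Qed.

Lemma PCr_derivable (P : topologicalType) (U W : normedModType R) r (A : set U)
    (f : P -> U -> W) p x v : PCr r.+1 A f -> A x -> derivable (f p) x v.
Proof. by case=> _ [+ _]; exact. Qed.

Lemma PCr_derive (P : topologicalType) (U W : normedModType R) r (A : set U)
    (f : P -> U -> W) v : PCr r.+1 A f -> PCr r A (fun p x => 'D_v (f p) x).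
Proof. by case=> _ [_]; exact. Qed.

Lemma PCrSI (P : topologicalType) (U W : normedModType R) r (A : set U)
    (f : P -> U -> W) :
  (forall p x, A x -> {for (p, x), continuous (fun q : P * U => f q.1 q.2)}) ->
  (forall p x v, A x -> derivable (f p) x v) ->
  (forall v, PCr r A (fun p x => 'D_v (f p) x)) -> PCr r.+1 A f.
Proof. by []. Qed.

Lemma continuous_near_eq (X Y : topologicalType) (f g : X -> Y) x :
  (\forall y \near x, f y = g y) -> {for x, continuous f} -> {for x, continuous g}.
Proof.
move=> fg; rewrite /prop_for/continuous_at (nbhs_singleton fg).
by apply: cvg_trans; apply: near_eq_cvg; apply: filterS fg => y ->.
Qed.

Lemma near_snd (X Y : topologicalType) (A : set Y) (x : X) (y : Y) :
  open A -> A y -> \forall q \near (x, y), A q.2.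
Proof.
move=> oA Ay; exists (setT, A) => /=; last by move=> [? ?] [].
by split; [exact: filterT|exact: open_nbhs_nbhs].
Qed.

Lemma PCr_ext (P : topologicalType) (U W : normedModType R) r (A : set U)
    (f g : P -> U -> W) :
  open A -> (forall p x, A x -> f p x = g p x) -> PCr r A f -> PCr r A g.
Proof.
move=> oA; elim: r f g => [|r IH] f g fg [cf df].
  split=> // p x Ax; apply: continuous_near_eq (cf p x Ax).
  by apply: filterS (near_snd p oA Ax) => q Aq; exact: fg.
have nfg p x : A x -> \near x, f p x = g p x.
  by move=> Ax; apply: filterS (open_nbhs_nbhs (conj oA Ax)) => y Ay; exact: fg.
case: df => d1 d2; split; [|split].
- move=> p x Ax; apply: continuous_near_eq (cf p x Ax).
  by apply: filterS (near_snd p oA Ax) => q Aq; exact: fg.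
- by move=> p x v Ax; apply: near_eq_derivable (nfg p x Ax) _; exact: d1.
- move=> v; apply: IH (d2 v) => p x Ax.
  by apply: near_eq_derive; exact: nfg.
Qed.

Lemma PCrW (P : topologicalType) (U W : normedModType R) r (A B : set U)
    (f : P -> U -> W) : B `<=` A -> PCr r A f -> PCr r B f.
Proof.
move=> BA; elim: r f => [|r IH] f [cf df]; split=> //.
- by move=> p x /BA Ax; exact: cf.
- by move=> p x /BA Ax; exact: cf.
by case: df => d1 d2; split=> [p x v /BA Ax|v]; [exact: d1|apply: IH; exact: d2].
Qed.

Lemma PCrS (P : topologicalType) (U W : normedModType R) r (A : set U)
    (f : P -> U -> W) : PCr r.+1 A f -> PCr r A f.
Proof.
elim: r f => [|r IH] f [cf [d1 d2]]; split=> //.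
by split=> // v; apply: IH; exact: d2.
Qed.

Lemma PCr_le (P : topologicalType) (U W : normedModType R) r s (A : set U)
    (f : P -> U -> W) : (s <= r)%N -> PCr r A f -> PCr s A f.
Proof.
elim: r => [|r IH]; first by rewrite leqn0 => /eqP ->.
by rewrite leq_eqVlt => /predU1P[->//|]; rewrite ltnS => /IH h /PCrS.
Qed.

Lemma mx_norm_coord m n (M : 'M[R]_(m, n)) i j : `|M i j| <= `|M|.
Proof.
rewrite [leRHS]/Num.norm /= mx_normrE.
by apply: (@le_bigmax _ _ _ 0 (fun ij : 'I_m * 'I_n => `|M ij.1 ij.2|) (i, j)).
Qed.

Lemma mx_norm_le m n (M : 'M[R]_(m, n)) e :
  0 <= e -> (forall i j, `|M i j| <= e) -> `|M| <= e.
Proof.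
move=> e0 h; rewrite [leLHS]/Num.norm /= mx_normrE.
by apply: bigmax_le => // i _; exact: h.
Qed.

Lemma mx_norm_lt m n (M : 'M[R]_(m, n)) e :
  0 < e -> (forall i j, `|M i j| < e) -> `|M| < e.
Proof.
move=> e0 h; rewrite [ltLHS]/Num.norm /= mx_normrE.
by apply: bigmax_lt => // i _; exact: h.
Qed.

Lemma cvg_mx (T : Type) (F : set_system T) {FF : Filter F} m n (f : T -> 'M[R]_(m, n)) (l : 'M[R]_(m, n)) :
  (forall i j, (fun t => f t i j) @ F --> l i j) -> f @ F --> l.
Proof.
move=> h; apply/cvgrPdist_le => e e0; near=> t.
apply: mx_norm_le; first exact: ltW.
move=> i j; rewrite !mxE; move: i j; near: t.
apply: filter_forall => i; apply: filter_forall => j.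
by move/cvgrPdist_le : (h i j); exact.
Unshelve. all: by end_near. Qed.

Lemma cvg_mx_coord (T : Type) (F : set_system T) {FF : Filter F} m n (f : T -> 'M[R]_(m, n)) (l : 'M[R]_(m, n)) i j :
  f @ F --> l -> (fun t => f t i j) @ F --> l i j.
Proof.
move=> h; apply: (@cvg_comp _ _ _ f (fun M : 'M[R]_(m, n) => M i j) F (nbhs l) _ h).
exact: coord_continuous.
Qed.

Lemma is_derive_mx (V : normedModType R) m n (f : V -> 'M[R]_(m, n)) x v (df : 'M[R]_(m, n)) :
  (forall i j, is_derive x v (fun y => f y i j) (df i j)) -> is_derive x v f df.
Proof.
move=> h; have d : derivable f x v by apply/derivable_mxP => i j; case: (h i j).
apply: DeriveDef => //; rewrite derive_mx//; apply/matrixP => i j; rewrite mxE.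
by case: (h i j).
Qed.

Lemma is_derive_coord (V : normedModType R) m n (f : V -> 'M[R]_(m, n)) x v (df : 'M[R]_(m, n)) i j :
  is_derive x v f df -> is_derive x v (fun y => f y i j) (df i j).
Proof.
case=> d <-; apply: DeriveDef; first exact/(derivable_mxP f x v).1.
by rewrite derive_mx// mxE.
Qed.

(** Reduction to scalar entries: [PCrM] is a rule for scalar products, and products, determinants
    and inverses of matrices are polynomial or rational in the entries. *)
Lemma PCr_mxP (P : topologicalType) (U : normedModType R) m n r (A : set U)
    (f : P -> U -> 'M[R]_(m, n)) : open A ->
  PCr r A f <-> forall i j, PCr r A (fun p x => f p x i j).
Proof.
move=> oA; elim: r f => [|r IH] f; split.
- move=> [cf _] i j; split=> // p x /(cf p x); exact: cvg_mx_coord.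
- move=> h; split=> // p x Ax; apply: cvg_mx => i j; by have [+ _] := h i j; apply.
- move=> [cf [d1 d2]] i j; split; [|split].
  + move=> p x /(cf p x); exact: cvg_mx_coord.
  + by move=> p x v /(d1 p x v) /derivable_mxP.
  + move=> v; move/IH: (d2 v) => /(_ i j); apply: PCr_ext => // p x Ax.
    by rewrite derive_mx ?mxE//; exact: d1.
- move=> h; have df p x v : A x -> derivable (f p) x v.
    by move=> Ax; apply/derivable_mxP => i j; have [_ [+ _]] := h i j; apply.
  split; [|split=> //].
  + move=> p x Ax; apply: cvg_mx => i j; by have [+ _] := h i j; apply.
  + move=> v; apply/IH => i j; have [_ [_ /(_ v)]] := h i j.
    by apply: PCr_ext => // p x Ax; rewrite derive_mx ?mxE//; exact: df.
Qed.

Lemma PCr_cstx (P : topologicalType) (U W : normedModType R) r (A : set U) (c : P -> W) :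
  continuous c -> PCr r A (fun p _ => c p).
Proof.
elim: r c => [|r IH] c cc.
  split=> // p x _; apply: continuous_comp (cc p); exact: cvg_fst.
split; first by move=> p x _; apply: continuous_comp (cc p); exact: cvg_fst.
split=> [p x v _|v]; first exact: derivable_cst.
rewrite (_ : (fun p x => _) = (fun _ _ => 0)); first by apply: IH => p; exact: cvg_cst.
by apply/funext => p; apply/funext => x; exact: derive_cst.
Qed.

Lemma PCr_cst (P : topologicalType) (U W : normedModType R) r (A : set U) (c : W) :
  PCr r A (fun (_ : P) _ => c).
Proof. by apply: (@PCr_cstx P U W r A (fun=> c)) => p; exact: cvg_cst. Qed.

Lemma PCrD (P : topologicalType) (U W : normedModType R) r (A : set U)
    (f g : P -> U -> W) : open A ->
  PCr r A f -> PCr r A g -> PCr r A (fun p x => f p x + g p x).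
Proof.
move=> oA; elim: r f g => [|r IH] f g [cf df] [cg dg]; split=> //.
- by move=> p x Ax; apply: cvgD; [exact: cf|exact: cg].
- by move=> p x Ax; apply: cvgD; [exact: cf|exact: cg].
case: df dg => d1 d2 [e1 e2]; split.
  by move=> p x v Ax; apply: derivableD; [exact: d1|exact: e1].
move=> v; apply: PCr_ext (IH _ _ (d2 v) (e2 v)) => // p x Ax.
by rewrite (deriveD (d1 p x v Ax) (e1 p x v Ax)).
Qed.

Lemma PCrM (P : topologicalType) (U : normedModType R) r (A : set U)
    (f g : P -> U -> R) : open A ->
  PCr r A f -> PCr r A g -> PCr r A (fun p x => f p x * g p x).
Proof.
move=> oA; elim: r f g => [|r IH] f g Hf Hg; case: (Hf) (Hg) => cf df [cg dg]; split=> //.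
- by move=> p x Ax; apply: cvgM; [exact: cf|exact: cg].
- by move=> p x Ax; apply: cvgM; [exact: cf|exact: cg].
case: df dg => d1 d2 [e1 e2]; split.
  by move=> p x v Ax; apply: derivableM; [exact: d1|exact: e1].
move=> v; apply: PCr_ext (PCrD oA (IH _ _ (PCrS Hf) (e2 v)) (IH _ _ (PCrS Hg) (d2 v))) => // p x Ax.
by rewrite (deriveM (d1 p x v Ax) (e1 p x v Ax)).
Qed.

Lemma PCr_sum (P : topologicalType) (U W : normedModType R) r (A : set U)
    (I : Type) (s : seq I) (Q : pred I) (f : I -> P -> U -> W) : open A ->
  (forall i, Q i -> PCr r A (f i)) -> PCr r A (fun p x => \sum_(i <- s | Q i) f i p x).
Proof.
move=> oA h; elim: s => [|i s IH].
  apply: (PCr_ext oA _ (@PCr_cst P U _ r A 0)) => p x _; by rewrite big_nil.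
case: (boolP (Q i)) => Qi.
  by apply: PCr_ext (PCrD oA (h i Qi) IH) => // p x _; rewrite big_cons Qi.
by apply: PCr_ext IH => // p x _; rewrite big_cons (negbTE Qi).
Qed.

Lemma PCr_prod (P : topologicalType) (U : normedModType R) r (A : set U)
    (I : Type) (s : seq I) (Q : pred I) (f : I -> P -> U -> R) : open A ->
  (forall i, Q i -> PCr r A (f i)) -> PCr r A (fun p x => \prod_(i <- s | Q i) f i p x).
Proof.
move=> oA h; elim: s => [|i s IH].
  apply: (PCr_ext oA _ (@PCr_cst P U _ r A (1 : R))) => p x _; by rewrite big_nil.
case: (boolP (Q i)) => Qi.
  by apply: PCr_ext (PCrM oA (h i Qi) IH) => // p x _; rewrite big_cons Qi.
by apply: PCr_ext IH => // p x _; rewrite big_cons (negbTE Qi).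
Qed.

Lemma PCr_mulmx (P : topologicalType) (U : normedModType R) m n l r (A : set U)
    (f : P -> U -> 'M[R]_(m, n)) (g : P -> U -> 'M[R]_(n, l)) : open A ->
  PCr r A f -> PCr r A g -> PCr r A (fun p x => f p x *m g p x).
Proof.
move=> oA /PCr_mxP fA /PCr_mxP gA; apply/PCr_mxP => // i j.
apply: PCr_ext (PCr_sum (f := fun k p x => f p x i k * g p x k j) (index_enum _) oA
  (fun k _ => PCrM oA (fA oA i k) (gA oA k j))) => // p x _.
by rewrite mxE.
Qed.

Lemma PCrZ (P : topologicalType) (U : normedModType R) m n r (A : set U)
    (s : P -> U -> R) (f : P -> U -> 'M[R]_(m, n)) : open A ->
  PCr r A s -> PCr r A f -> PCr r A (fun p x => s p x *: f p x).
Proof.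
move=> oA sA /PCr_mxP fA; apply/PCr_mxP => // i j.
by apply: PCr_ext (PCrM oA sA (fA oA i j)) => // p x _; rewrite mxE.
Qed.

Lemma PCrZc (P : topologicalType) (U : normedModType R) m n r (A : set U)
    (s : R) (f : P -> U -> 'M[R]_(m, n)) : open A ->
  PCr r A f -> PCr r A (fun p x => s *: f p x).
Proof. move=> oA; apply: PCrZ => //; exact: PCr_cst. Qed.

Lemma PCrB (P : topologicalType) (U : normedModType R) m n r (A : set U)
    (f g : P -> U -> 'M[R]_(m, n)) : open A ->
  PCr r A f -> PCr r A g -> PCr r A (fun p x => f p x - g p x).
Proof.
move=> oA fA gA; apply: PCr_ext (PCrD oA fA (PCrZc (-1) oA gA)) => // p x _.
by rewrite scaleN1r.
Qed.

(** The form [h *: v + x] is that of the argument of a difference quotient, so the quotient is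
    constant. Stated for plain functions, the notion applies directly to [usubmx], to coordinates
    and to z -> [ext z 0]. *)
Definition lin_like (U W : normedModType R) (L : U -> W) :=
  continuous L /\ (forall (h : R) x v, L (h *: v + x) = h *: L v + L x).

Lemma is_derive_lin (U W : normedModType R) (L : U -> W) x v :
  lin_like L -> is_derive x v L (L v).
Proof.
move=> [_ LL]; have h : (fun h : R => h^-1 *: (L (h *: v + x) - L x)) @ 0^' --> L v.
  apply: cvg_trans (@cvg_cst _ (L v) _ (0^') _); apply: near_eq_cvg; near=> h.
  rewrite LL addrK scalerA mulVf ?scale1r//; near: h; exact: nbhs_dnbhs_neq.
apply: DeriveDef; first by apply/cvg_ex; exists (L v).
exact/cvg_lim.
Unshelve. all: by end_near. Qed.

Lemma PCr_lin (P : topologicalType) (U W : normedModType R) r (A : set U) (L : U -> W) :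
  lin_like L -> PCr r A (fun (_ : P) => L).
Proof.
move=> LL; have cL p x : A x -> {for (p, x), continuous (fun q : P * U => L q.2)}.
  by move=> _; apply: continuous_comp (LL.1 x); exact: cvg_snd.
case: r => [|r]; split=> //; split=> [p x v _|v].
  by case: (is_derive_lin x v LL).
rewrite (_ : (fun p x => _) = (fun _ _ => L v)); first exact: PCr_cst.
by apply/funext => p; apply/funext => x; case: (is_derive_lin x v LL).
Qed.

End ParametricCr.

(** * Strict differentiability and the chain rule *)

Section ChainRule.
Context {R : realType}.

Lemma continuous_pair (X Y Z : topologicalType) (f : X -> Y) (g : X -> Z) x :
  {for x, continuous f} -> {for x, continuous g} ->
  {for x, continuous (fun y => (f y, g y))}.
Proof. by move=> cf cg; exact: (cvg_pair (G := nbhs (f x)) (H := nbhs (g x)) cf cg). Qed.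

(** The scalar mean value theorem is applied entry by entry; since the norm is the maximum of the
    entries, the constant [C] survives without a dimension factor. *)
Lemma mean_value_le m n (g dg : R -> 'M[R]_(m, n)) (a b C : R) : a <= b ->
  (forall x, a < x < b -> is_derive x 1 g (dg x)) ->
  {within `[a, b], continuous g} ->
  (forall x, a < x < b -> `|dg x| <= C) -> `|g b - g a| <= C * (b - a).
Proof.
rewrite le_eqVlt => /predU1P[->|ab] dgx cg dgC.
  by rewrite !subrr normr0 mulr0.
have C0 : 0 <= C.
  by apply: le_trans (dgC ((a + b) / 2) _) => //; rewrite midf_lt//= midf_lt.
apply: mx_norm_le => [|i j]; first by rewrite mulr_ge0// subr_ge0 ltW.
have cgij : {within `[a, b], continuous (fun x => g x i j)}.
  by move=> x; apply: cvg_mx_coord; exact: cg.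
have dgij x : x \in `]a, b[ -> is_derive x 1 (fun x => g x i j) (dg x i j).
  by rewrite in_itv/= => xab; apply: is_derive_coord; exact: dgx.
have [c cab] := MVT ab dgij cgij; rewrite !mxE => ->.
rewrite normrM (@ger0_norm _ (b - a)) ?subr_ge0 ?(ltW ab)//.
rewrite ler_wpM2r ?subr_ge0 ?(ltW ab)//.
apply: le_trans (mx_norm_coord _ _ _) (dgC c _); by rewrite in_itv in cab.
Qed.

Lemma is_derive_continuous (V : normedModType R) (g : R -> V) (x : R) dg :
  is_derive x 1 g dg -> {for x, continuous g}.
Proof. by move=> [d _]; exact/differentiable_continuous/derivable1_diffP. Qed.

Lemma mean_value_abs m n (g dg : R -> 'M[R]_(m, n)) (a b C : R) :
  (forall x, Num.min a b <= x <= Num.max a b -> is_derive x 1 g (dg x)) ->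
  (forall x, Num.min a b <= x <= Num.max a b -> `|dg x| <= C) ->
  `|g b - g a| <= C * `|b - a|.
Proof.
wlog ab : a b / a <= b.
  move=> H; case: (leP a b) => ab; first by have := H a b ab; rewrite min_l// max_r//.
  have := H b a (ltW ab); rewrite (min_l (ltW ab)) (max_r (ltW ab)) => h h1 h2.
  by rewrite distrC (distrC b); exact: h.
rewrite min_l// max_r// => dgx dgC; rewrite (@ger0_norm _ (b - a)) ?subr_ge0//.
apply: (@mean_value_le _ _ g dg) => //.
- by move=> x /andP[/ltW ax /ltW xb]; apply: dgx; rewrite ax.
- apply: derivable_within_continuous => x; rewrite in_itv/= => xab.
  by case: (dgx x xab).
- by move=> x /andP[/ltW ax /ltW xb]; apply: dgC; rewrite ax.
Qed.

Lemma is_derive_line (V W : normedModType R) (f : V -> W) x w s :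
  derivable f (x + s *: w) w ->
  is_derive s 1 (fun u : R => f (x + u *: w)) ('D_w f (x + s *: w)).
Proof.
have E : (fun h : R => h^-1 *: (f (x + (h *: (1 : R) + s) *: w) - f (x + s *: w))) =
  (fun h : R => h^-1 *: (f (h *: w + (x + s *: w)) - f (x + s *: w))).
  apply/funext => h; congr (_ *: (f _ - _)).
  by rewrite [h *: (1 : R)]mulr1 scalerDl addrCA addrA.
move=> d; have d' : derivable (fun u : R => f (x + u *: w)) s 1.
  by move: d; rewrite /derivable -E.
by apply: DeriveDef => //; rewrite /derive -E.
Qed.

Definition ei N (i : 'I_N) : 'cV[R]_N := delta_mx i 0.

Lemma cV_sum N (v : 'cV[R]_N) : v = \sum_i v i 0 *: ei i.
Proof.
apply/matrixP => i j; rewrite ord1 summxE (bigD1 i)//= !mxE !eqxx mulr1 big1 ?addr0//.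
by move=> k ki; rewrite !mxE eq_sym (negbTE ki) mulr0.
Qed.

(* The increment is split along a path which changes one coordinate at a time; the
   sup norm keeps that path inside the ball. *)
Lemma strict_increment N m n (f : 'cV[R]_N -> 'M[R]_(m, n)) (a : 'I_N -> 'M[R]_(m, n))
    x rho eta :
  (forall y i, `|y - x| < rho -> derivable f y (ei i)) ->
  (forall y i, `|y - x| < rho -> `|'D_(ei i) f y - a i| <= eta) ->
  forall y y', `|y - x| < rho -> `|y' - x| < rho ->
  `|f y' - f y - \sum_i (y' i 0 - y i 0) *: a i| <= N%:R * eta * `|y' - y|.
Proof.
move=> df Df y y' yx y'x.
have rho0 : 0 < rho by exact: le_lt_trans yx.
pose h k : 'cV[R]_N := \col_i (if (i < k)%N then y' i 0 else y i 0).
have h0 : h 0%N = y by apply/matrixP => i j; rewrite mxE ltn0 ord1.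
have hN : h N = y' by apply/matrixP => i j; rewrite mxE ltn_ord ord1.
have hS (k : 'I_N) : h k.+1 = h k + (y' k 0 - y k 0) *: ei k.
  apply/matrixP => i j; rewrite !mxE ord1 eqxx andbT ltnS.
  case: (ltngtP i k) => [ik|ki|/val_inj ->].
  - by rewrite (negbTE (_ : i != k)) ?mulr0 ?addr0// neq_ltn ik.
  - by rewrite (negbTE (_ : i != k)) ?mulr0 ?addr0// neq_ltn ki orbT.
  - by rewrite eqxx mulr1 addrC subrK.
have -> : f y' - f y = \sum_(k < N) (f (h k.+1) - f (h k)).
  by rewrite -(big_mkord xpredT (fun k => f (h k.+1) - f (h k))) telescope_sumr// hN h0.
rewrite -sumrB; apply: le_trans (ler_norm_sum _ _ _) _.
have -> : N%:R * eta * `|y' - y| = \sum_(k < N) eta * `|y' - y|.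
  by rewrite sumr_const card_ord -mulrA mulr_natl.
apply: ler_sum => k _.
pose d := y' k 0 - y k 0.
have inb s : Num.min 0 d <= s <= Num.max 0 d -> `|h k + s *: ei k - x| < rho.
  move=> sd; apply: mx_norm_lt => // i j; rewrite !mxE ord1 eqxx andbT.
  have ci : `|y i 0 - x i 0| < rho.
    by apply: le_lt_trans yx; have := mx_norm_coord (y - x) i 0; rewrite !mxE.
  have ci' : `|y' i 0 - x i 0| < rho.
    by apply: le_lt_trans y'x; have := mx_norm_coord (y' - x) i 0; rewrite !mxE.
  case: (eqVneq i k) => [ik|nik]; last by rewrite mulr0 addr0; case: ifP.
  move: ci ci'; rewrite ik ltnn mulr1.
  move: sd; rewrite /d; case: (leP 0 (y' k 0 - y k 0)) => _ /andP[s1 s2];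
   rewrite !ltr_norml => /andP[c1 c2] /andP[c3 c4]; apply/andP; split; lra.
(* Subtracting the linear term [s *: a k] before applying the mean value theorem makes the remainder
   itself the increment, with derivative bounded by [eta]. *)
have dl s : Num.min 0 d <= s <= Num.max 0 d ->
    is_derive s 1 (fun s => f (h k + s *: ei k) - s *: a k) ('D_(ei k) f (h k + s *: ei k) - a k).
  move=> sd; apply: is_deriveB; first by apply: is_derive_line; apply: df; exact: inb.
  apply: is_derive_mx => i j.
  have -> : (fun y0 : R => (y0 *: a k) i j) = (fun y0 => y0 * a k i j).
    by apply/funext => u; rewrite mxE.
  have := is_derive_lin s (1 : R) (L := fun y0 : R => y0 * a k i j); rewrite mul1r; apply; split.
    by move=> y0; apply: cvgM; [exact: cvg_id|exact: cvg_cst].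
  by move=> c y0 v; rewrite mulrDl -scalerAl.
have := mean_value_abs dl (fun s sd => Df _ k (inb s sd)).
rewrite scale0r addr0 scale0r subr0 subr0 -hS.
rewrite /d => H; rewrite addrAC; apply: le_trans H _.
have eta0 : 0 <= eta by apply: le_trans (normr_ge0 _) (Df x k _); rewrite subrr normr0.
by rewrite ler_wpM2l//; have := mx_norm_coord (y' - y) k 0; rewrite !mxE.
Qed.

(** Strict differentiability: both points move. This turns a derivative at one point into Lipschitz
    and contraction estimates nearby. The derivative is given by its columns [a]. *)
Definition sdiff N m n (f : 'cV[R]_N -> 'M[R]_(m, n)) x (a : 'I_N -> 'M[R]_(m, n)) :=
  forall eta, 0 < eta -> exists2 rho, 0 < rho &
  forall y y', `|y - x| < rho -> `|y' - x| < rho ->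
  `|f y' - f y - \sum_i (y' i 0 - y i 0) *: a i| <= eta * `|y' - y|.

Lemma norm_lincomb_le N m n (u : 'cV[R]_N) (a : 'I_N -> 'M[R]_(m, n)) :
  `|\sum_i u i 0 *: a i| <= `|u| * \sum_i `|a i|.
Proof.
apply: le_trans (ler_norm_sum _ _ _) _; rewrite mulr_sumr; apply: ler_sum => i _.
by rewrite normrZ ler_wpM2r// mx_norm_coord.
Qed.

(** The strict remainder of [f] is evaluated at [g x] and [g (h *: v + x)], so [g] is asked for a
    derivative in the single direction [v]. *)
Lemma sdiff_comp (V : normedModType R) N m n (f : 'cV[R]_N -> 'M[R]_(m, n)) a
    (g : V -> 'cV[R]_N) x v dg :
  is_derive x v g dg -> sdiff f (g x) a ->
  is_derive x v (f \o g) (\sum_i dg i 0 *: a i).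
Proof.
move=> [dgx Dg] sf; pose q (h : R) := h^-1 *: (g (h *: v + x) - g x).
have qcvg : q h @[h --> 0^'] --> dg by rewrite -Dg; exact: dgx.
pose S := \sum_i `|a i|; have S0 : 0 <= S by exact: sumr_ge0.
(* [g] is continuous along the line because its increment is [h] times the convergent quotient
   [q h]. *)
have gcvg : g (h *: v + x) @[h --> 0^'] --> g x.
  have : (fun h : R => g x + h *: q h) @ 0^' --> g x + 0 *: dg.
    apply: cvgD; first exact: cvg_cst.
    apply: cvgZ qcvg; exact: nbhs_dnbhs.
  rewrite scale0r addr0; apply: cvg_trans; apply: near_eq_cvg; near=> h.
  rewrite /q scalerA mulfV ?scale1r ?[g x + _]addrC ?subrK//; near: h; exact: nbhs_dnbhs_neq.
have H : (fun h : R => h^-1 *: ((f \o g) (h *: v + x) - (f \o g) x)) @ 0^' -->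
    \sum_i dg i 0 *: a i.
  apply/cvgrPdist_le => e e0.
  have D0 : 0 < `|dg| + 1 + S by rewrite ltr_pwDl// ltr_wpDl.
  (* The error has two parts: the linear map at [dg - q h], with weight [S], and the strict
     remainder, with weight |q h| <= |dg| + 1. The denominator is the sum of the weights. *)
  have [rho rho0 srho] := sf (e / (`|dg| + 1 + S)) (divr_gt0 e0 D0).
  near=> h.
  have hn0 : h != 0 by near: h; exact: nbhs_dnbhs_neq.
  have gr : `|g (h *: v + x) - g x| < rho.
    by rewrite distrC; near: h; move/cvgrPdist_lt: gcvg; exact.
  have qd : `|dg - q h| <= e / (`|dg| + 1 + S).
    near: h; move/cvgrPdist_le: qcvg; apply; exact: divr_gt0.
  have qd1 : `|q h| <= `|dg| + 1.
    have : `|dg - q h| <= 1 by near: h; move/cvgrPdist_le: qcvg; exact.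
    by rewrite -lerBlDl; apply: le_trans; rewrite distrC lerB_dist.
  have := srho (g x) (g (h *: v + x)); rewrite subrr normr0 => /(_ rho0 gr) F.
  set w := \sum_i _ in F.
  have wE : h^-1 *: w = \sum_i q h i 0 *: a i.
    by rewrite /w scaler_sumr; apply: eq_bigr => i _; rewrite scalerA !mxE.
  have -> : \sum_i dg i 0 *: a i - h^-1 *: ((f \o g) (h *: v + x) - (f \o g) x) =
      \sum_i (dg - q h) i 0 *: a i - h^-1 *: (f (g (h *: v + x)) - f (g x) - w).
    have -> : \sum_i (dg - q h) i 0 *: a i = \sum_i dg i 0 *: a i - \sum_i q h i 0 *: a i.
      by rewrite -sumrB; apply: eq_bigr => i _; rewrite -scalerBl !mxE.
    by rewrite [h^-1 *: (_ - w)]scalerBr wE opprB addrA subrK.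
  apply: le_trans (ler_normB _ _) _.
  apply: (@le_trans _ _ (e / (`|dg| + 1 + S) * S + e / (`|dg| + 1 + S) * (`|dg| + 1))).
    apply: lerD.
      by apply: le_trans (norm_lincomb_le _ _) _; rewrite ler_wpM2r.
    rewrite normrZ; apply: le_trans (ler_wpM2l (normr_ge0 _) F) _.
    rewrite mulrCA ler_wpM2l ?divr_ge0 ?(ltW e0) ?(ltW D0)//.
    by rewrite -normrZ.
  rewrite -mulrDr [S + _]addrC -mulrA mulVf ?mulr1//; exact: lt0r_neq0.
by apply: DeriveDef; [apply/cvg_ex; eexists; exact: H|exact: cvg_lim H].
Unshelve. all: by end_near. Qed.

Lemma continuous_dist_le (X : topologicalType) m n (f : X -> 'M[R]_(m, n)) x eta :
  {for x, continuous f} -> 0 < eta -> \forall y \near x, `|f y - f x| <= eta.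
Proof.
move=> /cvgrPdist_le c e0; apply: filterS (c _ e0) => y; by rewrite distrC.
Qed.

Lemma PCr_near (P : topologicalType) N m n r (A : set 'cV[R]_N)
    (f : P -> 'cV[R]_N -> 'M[R]_(m, n)) p x eta : PCr r A f -> A x -> 0 < eta ->
  \forall q \near (p, x), `|f q.1 q.2 - f p x| <= eta.
Proof.
by move=> fA Ax; apply: (continuous_dist_le (PCr_cont fA Ax)).
Qed.

Lemma near_ballP N (x : 'cV[R]_N) (Q : set 'cV[R]_N) :
  (\forall y \near x, Q y) <-> exists2 rho, 0 < rho & forall y, `|y - x| < rho -> Q y.
Proof.
split=> [/nbhs_ballP[rho rho0 h]|[rho rho0 h]].
  by exists rho => // y yx; apply: h; rewrite -ball_normE /= distrC.
by apply/nbhs_ballP; exists rho => // y; rewrite -ball_normE /= distrC; exact: h.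
Qed.

(** Continuity of the partial derivatives makes [strict_increment] applicable with an arbitrarily
    small constant; the divisor N + 1 also covers N = 0. *)
Lemma PCr_sdiff (P : topologicalType) N m n r (A : set 'cV[R]_N)
    (f : P -> 'cV[R]_N -> 'M[R]_(m, n)) p x : open A -> PCr r.+1 A f -> A x ->
  sdiff (f p) x (fun i => 'D_(ei i) (f p) x).
Proof.
move=> oA fA Ax eta eta0.
have N1 : 0 < N%:R + 1 :> R by rewrite ltr_pwDr.
have : \forall y \near x, A y /\ forall i, `|'D_(ei i) (f p) y - 'D_(ei i) (f p) x| <= eta / (N%:R + 1).
  near=> y; split; first by near: y; exact: open_nbhs_nbhs.
  move=> i; move: i; near: y; apply: filter_forall => i.
  have c : {for x, continuous (fun y => 'D_(ei i) (f p) y)}.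
    apply: (@continuous_comp _ _ _ (fun y => (p, y)) (fun q => 'D_(ei i) (f q.1) q.2)).
      by apply: (continuous_pair (f := fun=> p) (g := id)); [exact: cst_continuous|exact: cvg_id].
    exact: (PCr_cont (PCr_derive (ei i) fA) Ax).
  exact: continuous_dist_le c (divr_gt0 eta0 N1).
move/near_ballP => [rho rho0 h]; exists rho => // y y' yx y'x.
have := @strict_increment _ _ _ (f p) (fun i => 'D_(ei i) (f p) x) x rho (eta / (N%:R + 1)).
move=> /(_ (fun z i zx => PCr_derivable fA (h z zx).1) (fun z i zx => (h z zx).2 i) y y' yx y'x).
move/le_trans; apply; rewrite ler_wpM2r//.
by rewrite mulrA ler_pdivrMr// mulrC ler_wpM2l ?(ltW eta0)// lerDl.
Unshelve. all: by end_near. Qed.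

(** Linearity in the direction is not part of the definition of [PCr], which treats one direction at
    a time; it follows from strict differentiability by composing with the identity. *)
Lemma PCr_derive_sum (P : topologicalType) N m n r (A : set 'cV[R]_N)
    (f : P -> 'cV[R]_N -> 'M[R]_(m, n)) p x v : open A -> PCr r.+1 A f -> A x ->
  'D_v (f p) x = \sum_i v i 0 *: 'D_(ei i) (f p) x.
Proof.
move=> oA fA Ax; have [_ <-] := sdiff_comp (is_derive_id x v) (PCr_sdiff p oA fA Ax).
by [].
Qed.

Lemma PCr_chain (P : topologicalType) (V : normedModType R) N m n r (A : set 'cV[R]_N)
    (f : P -> 'cV[R]_N -> 'M[R]_(m, n)) p (g : V -> 'cV[R]_N) x v dg :
  open A -> PCr r.+1 A f -> A (g x) -> is_derive x v g dg ->
  is_derive x v (f p \o g) ('D_dg (f p) (g x)).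
Proof.
move=> oA fA Agx dgx; rewrite (PCr_derive_sum p dg oA fA Agx).
exact: sdiff_comp (PCr_sdiff p oA fA Agx).
Qed.

Lemma PCr_comp (P : topologicalType) (U : normedModType R) N m n r (A : set U)
   (B : set 'cV[R]_N) (f : P -> 'cV[R]_N -> 'M[R]_(m, n)) (g : P -> U -> 'cV[R]_N) :
  open A -> open B -> (forall p x, A x -> B (g p x)) ->
  PCr r B f -> PCr r A g -> PCr r A (fun p x => f p (g p x)).
Proof.
move=> oA oB gB; elim: r f g gB => [|r IH] f g gB fB gA.
  split=> // p x Ax.
  apply: (@continuous_comp _ _ _ (fun q => (q.1, g q.1 q.2)) (fun q => f q.1 q.2)).
    by apply: (continuous_pair (f := fst) (g := fun q => g q.1 q.2)); [exact: cvg_fst|exact: (PCr_cont gA Ax)].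
  exact: (PCr_cont fB (gB p x Ax)).
have dfg p x v : A x -> is_derive x v (fun x => f p (g p x)) (\sum_i ('D_v (g p) x) i 0 *: 'D_(ei i) (f p) (g p x)).
  move=> Ax; apply: sdiff_comp (PCr_sdiff p oB fB (gB _ _ Ax)).
  by apply: derivableP; exact: PCr_derivable gA Ax.
apply: PCrSI.
- move=> p x Ax.
  apply: (@continuous_comp _ _ _ (fun q => (q.1, g q.1 q.2)) (fun q => f q.1 q.2)).
    by apply: (continuous_pair (f := fst) (g := fun q => g q.1 q.2)); [exact: cvg_fst|exact: (PCr_cont gA Ax)].
  exact: (PCr_cont fB (gB p x Ax)).
- by move=> p x v /(dfg p x v) [].
- move=> v.
  apply: (@PCr_ext _ _ _ _ _ _ (fun p x => \sum_i ('D_v (g p) x) i 0 *: 'D_(ei i) (f p) (g p x))) => //.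
    by move=> p x /(dfg p x v) [_ <-].
  apply: PCr_sum => // i _; apply: PCrZ => //.
    by have /PCr_mxP := PCr_derive v gA; exact.
  by apply: (IH (fun p => 'D_(ei i) (f p))) (PCrS gA) => //; exact: PCr_derive.
Qed.

(** The direction may depend on the parameter: in the averaged equations the derivatives are taken
    along the time-dependent vectors y_j(t). *)
Lemma PCr_dirs (P : topologicalType) N m n r (A : set 'cV[R]_N)
    (f : P -> 'cV[R]_N -> 'M[R]_(m, n)) (v : P -> 'cV[R]_N) : open A -> continuous v ->
  PCr r.+1 A f -> PCr r A (fun p x => 'D_(v p) (f p) x).
Proof.
move=> oA cv fA.
apply: (@PCr_ext _ _ _ _ _ _ (fun p x => \sum_i v p i 0 *: 'D_(ei i) (f p) x)) => //.
  by move=> p x Ax; rewrite [RHS](PCr_derive_sum p _ oA fA Ax).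
apply: PCr_sum => // i _; apply: PCrZ => //; last exact: PCr_derive.
by apply: PCr_cstx => p; apply: cvg_mx_coord; exact: cv.
Qed.

End ChainRule.

(** * Taylor and Faa di Bruno expansions *)

Section Taylor.
Context {R : realType}.

Lemma is_derive_scalel m n (a : 'M[R]_(m, n)) (u : R -> R) (x : R) du :
  is_derive x 1 u du -> is_derive x 1 (fun y => u y *: a) (du *: a).
Proof.
move=> h; apply: is_derive_mx => i j; rewrite mxE.
have -> : (fun y => (u y *: a) i j) = (u * cst (a i j)) by apply/funext => y; rewrite mxE.
by apply: is_derive_eq; rewrite scaler0 add0r [_ *: _]mulrC.
Qed.

(** The derivative of the remainder is the remainder of one order less for the shifted family, and
    the mean value theorem raises the power of [d] by one. The bound uses the oscillation of the
    last derivative, so that [q] derivatives give a remainder o(d^q). *)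
Lemma taylor1 m n (q : nat) (g : nat -> R -> 'M[R]_(m, n)) rho eta :
  (forall c (s : R), (c < q)%N -> `|s| <= rho -> is_derive s 1 (g c) (g c.+1 s)) ->
  (forall s : R, `|s| <= rho -> `|g q s - g q 0| <= eta) ->
  forall d : R, `|d| <= rho ->
  `|g 0%N d - \sum_(c < q.+1) (d ^+ c / c`!%:R) *: g c 0| <= eta * `|d| ^+ q.
Proof.
elim: q g => [|q IH] g dg gq d drho.
  by rewrite big_ord_recl big_ord0 addr0 expr0 divr1 scale1r mulr1; exact: gq.
have IH' := IH (fun c => g c.+1) (fun c s cq => dg c.+1 s cq) gq.
pose r s := g 0%N s - \sum_(c < q.+2) (s ^+ c / c`!%:R) *: g c 0.
pose r' s := g 1%N s - \sum_(c < q.+1) (s ^+ c / c`!%:R) *: g c.+1 0.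
have sd (s : R) : Num.min 0 d <= s <= Num.max 0 d -> `|s| <= `|d|.
  by case: (leP 0 d) => d0 /andP[s1 s2]; [rewrite !ger0_norm//; lra|rewrite !ler0_norm//; lra].
have dr s : Num.min 0 d <= s <= Num.max 0 d -> is_derive s 1 r (r' s).
  move=> /sd sd'; apply: is_deriveB; first by apply: dg => //; exact: le_trans drho.
  have -> : (fun y : R => \sum_(c < q.+2) (y ^+ c / c`!%:R) *: g c 0) =
    \sum_(c < q.+2) (fun y : R => (y ^+ c / c`!%:R) *: g c 0).
    by apply/funext => y; rewrite fct_sumE.
  rewrite (_ : \sum_(c < q.+1) _ =
    \sum_(c < q.+2) ((c%:R * s ^+ c.-1) / c`!%:R) *: g c 0); last first.
    rewrite [RHS]big_ord_recl /= !mul0r scale0r add0r; apply: eq_bigr => c _.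
    rewrite /bump /= add1n add0n factS natrM invfM mulrA; congr (_ *: _).
    by rewrite [_.+1%:R * _]mulrC -!mulrA; congr (_ * _); rewrite mulrA divff ?mul1r// pnatr_eq0.
  apply: is_derive_sum => c; apply: is_derive_scalel.
  have -> : (fun y : R => y ^+ c / c`!%:R) = ((id ^+ c) * cst (c`!%:R^-1)).
    by apply/funext => y; rewrite /= fctE exprfctE.
  apply: is_derive_eq; rewrite scaler0 add0r /= [c`!%:R^-1 *: _]mulrC.
  by rewrite [_ *: (1 : R)]mulr1.
have r0 : r 0 = 0.
  rewrite /r big_ord_recl /= expr0 divr1 scale1r big1 ?addr0 ?subrr// => c _.
  by rewrite /bump /= exprS !mul0r scale0r.
have := mean_value_abs (C := eta * `|d| ^+ q) dr; rewrite r0 !subr0 => H.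
rewrite exprSr mulrA; apply: H => s /sd sd'.
apply: le_trans (IH' s (le_trans sd' drho)) _.
have eta0 : 0 <= eta by apply: le_trans (normr_ge0 _) (gq d drho).
by rewrite ler_wpM2l// lerXn2r// nnegrE.
Qed.

Lemma PCr_iterD (P : topologicalType) N m n r (A : set 'cV[R]_N)
    (f : P -> 'cV[R]_N -> 'M[R]_(m, n)) (vs : seq (P -> 'cV[R]_N)) : open A ->
  (forall v, v \in vs -> continuous v) -> (size vs <= r)%N -> PCr r A f ->
  PCr (r - size vs) A (fun p x => iterD (f p) [seq v p | v <- vs] x).
Proof.
move=> oA; elim: vs => [|v vs IH] cvs sr fA; first by rewrite subn0.
rewrite /=; apply: PCr_dirs => //; first by apply: cvs; rewrite inE eqxx.
rewrite subnSK//; apply: IH => //; last exact: ltnW.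
by move=> w wvs; apply: cvs; rewrite inE wvs orbT.
Qed.

Lemma PCr_iterD_nseq (P : topologicalType) N m n r c (A : set 'cV[R]_N)
    (f : P -> 'cV[R]_N -> 'M[R]_(m, n)) (v : P -> 'cV[R]_N) : open A ->
  continuous v -> (c <= r)%N -> PCr r A f ->
  PCr (r - c) A (fun p x => iterD (f p) (nseq c (v p)) x).
Proof.
move=> oA cv cr fA.
have := @PCr_iterD P N m n r A f (nseq c v) oA.
rewrite size_nseq; move=> /(_ _ cr fA) H.
rewrite (_ : (fun p x => _) = (fun p x => iterD (f p) [seq v p | v <- nseq c v] x)).
  by apply: H => w; rewrite mem_nseq => /andP[_ /eqP ->].
by apply/funext => p; rewrite map_nseq.
Qed.

(* [lo F e M g] reads g = o(|e| ^ M) along the filter [F]. *)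
Definition lo (I : Type) (F : set_system I) (e : I -> R) (M : nat)
    (W : normedModType R) (g : I -> W) :=
  forall eta, 0 < eta -> \forall i \near F, `|g i| <= eta * `|e i| ^+ M.

Section lo.
Context (I : Type) (F : set_system I) {FF : Filter F} (e : I -> R).

Lemma lo_add M (W : normedModType R) (g h : I -> W) :
  lo F e M g -> lo F e M h -> lo F e M (fun i => g i + h i).
Proof.
move=> Hg Hh eta eta0; have e2 : 0 < eta / 2 by rewrite divr_gt0.
apply: filterS2 (Hg _ e2) (Hh _ e2) => i h1 h2.
by apply: le_trans (ler_normD _ _) _; rewrite [eta]splitr mulrDl lerD.
Qed.

Lemma lo_sum M (W : normedModType R) (J : Type) (s : seq J) (Q : pred J) (g : J -> I -> W) :
  (forall j, Q j -> lo F e M (g j)) -> lo F e M (fun i => \sum_(j <- s | Q j) g j i).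
Proof.
move=> H; elim: s => [|j s IH].
  move=> eta eta0; near=> i.
  by rewrite big_nil normr0 mulr_ge0 ?exprn_ge0// ltW.
case: (boolP (Q j)) => Qj.
  have := lo_add (H j Qj) IH; rewrite /lo => h eta /h; apply: filterS => i.
  by rewrite big_cons Qj.
by move=> eta /IH; apply: filterS => i; rewrite big_cons (negbTE Qj).
Unshelve. all: by end_near. Qed.

Lemma lo_eq M (W : normedModType R) (g h : I -> W) :
  (\forall i \near F, g i = h i) -> lo F e M g -> lo F e M h.
Proof.
by move=> gh Hg eta /Hg; apply: filterS2 gh => i ->.
Qed.

Lemma lo_scale M a C (W W' : normedModType R) (g : I -> W) (h : I -> W') :
  0 <= C -> lo F e M g ->
  (\forall i \near F, `|h i| <= C * `|e i| ^+ a * `|g i|) -> lo F e (M + a) h.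
Proof.
move=> C0 Hg hg eta eta0; have C1 : 0 < C + 1 by rewrite ltr_wpDl.
apply: filterS2 hg (Hg _ (divr_gt0 eta0 C1)) => i h1 h2.
apply: le_trans h1 _; apply: le_trans (ler_wpM2l _ h2) _.
  by rewrite mulr_ge0// exprn_ge0.
rewrite exprD mulrACA ler_pM ?mulr_ge0 ?exprn_ge0// ?invr_ge0 ?(ltW eta0) ?(ltW C1)//.
  rewrite mulrCA ger_pMr// ler_pdivrMr// mul1r; lra.
by rewrite mulrC.
Qed.

Lemma lo_bnd M C (W : normedModType R) (g : I -> W) :
  e @ F --> (0 : R) -> (\forall i \near F, `|g i| <= C * `|e i| ^+ M.+1) -> lo F e M g.
Proof.
move=> e0 h eta eta0.
have C1 : 0 < `|C| + 1 by rewrite ltr_wpDl.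
have : \forall i \near F, `|e i| <= eta / (`|C| + 1).
  by move/cvgrPdist_le: e0 => /(_ _ (divr_gt0 eta0 C1)); apply: filterS => i; rewrite sub0r normrN.
apply: filterS2 h => i h1 h2; apply: le_trans h1 _.
rewrite exprS mulrA ler_wpM2r ?exprn_ge0//.
apply: le_trans (ler_norm _) _; rewrite normrM normr_id.
apply: le_trans (ler_wpM2l (normr_ge0 _) h2) _.
by rewrite mulrA ler_pdivrMr// mulrC ler_wpM2l ?(ltW eta0)// lerDl.
Qed.

End lo.

Lemma lo_comp (I J : Type) (F : set_system I) (G : set_system J) (e : J -> R) (M : nat)
    (W : normedModType R) (g : J -> W) (u : I -> J) :
  u @ F --> G -> lo G e M g -> lo F (e \o u) M (g \o u).
Proof. by move=> uF H eta eta0; exact: (uF _ (H _ eta0)). Qed.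

(** The base point, the direction and the parameter all move along the filter. Uniformity comes from
    joint continuity of the M-th derivative at [(p0, y0)]: once [d i] is small, the whole segment
    from [y i] lies in the neighbourhood that it provides. *)
Lemma lo_taylor (P : topologicalType) (I : Type) (F : set_system I) {FF : Filter F}
    N m n M (A : set 'cV[R]_N) (f : P -> 'cV[R]_N -> 'M[R]_(m, n))
    (v : P -> 'cV[R]_N) (p : I -> P) (y : I -> 'cV[R]_N) (d : I -> R) (p0 : P) y0 :
  open A -> PCr M A f -> continuous v -> A y0 ->
  p @ F --> p0 -> y @ F --> y0 -> d @ F --> (0 : R) ->
  lo F d M (fun i => f (p i) (y i + d i *: v (p i)) -
     \sum_(c < M.+1) (d i ^+ c / c`!%:R) *: iterD (f (p i)) (nseq c (v (p i))) (y i)).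
Proof.
move=> oA fA cv Ay0 pF yF dF eta eta0.
have vF : v \o p @ F --> v p0 by apply: (cvg_comp _ _ pF); exact: cv.
have fM := PCr_iterD_nseq oA cv (leqnn M) fA; rewrite subnn in fM.
have [[B1 B2] /= [nB1 nB2] BB] := @PCr_near _ _ _ _ _ _ _ _ p0 y0 _ fM Ay0 (divr_gt0 eta0 (ltr0Sn R 1)).
have : nbhs y0 (A `&` B2) by apply: filterI nB2; exact: open_nbhs_nbhs.
move=> /near_ballP[rho rho0 hrho].
have V0 : 0 < `|v p0| + 1 by rewrite ltr_wpDl.
near=> i.
have pB1 : B1 (p i) by near: i; exact: (pF _ nB1).
have yrho : `|y i - y0| < rho / 2.
  by rewrite distrC; near: i; move/cvgrPdist_lt: yF; apply; rewrite divr_gt0.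
have vb : `|v (p i)| <= `|v p0| + 1.
  have : `|v p0 - v (p i)| <= 1 by near: i; move/cvgrPdist_le: vF; exact.
  by rewrite -lerBlDl; apply: le_trans; rewrite distrC lerB_dist.
have db : `|d i| < rho / 2 / (`|v p0| + 1).
  rewrite -[d i]opprK normrN -sub0r; near: i; move/cvgrPdist_lt: dF; apply.
  by rewrite !divr_gt0.
have inb s : `|s| <= `|d i| -> `|y i + s *: v (p i) - y0| < rho.
  move=> sd; rewrite addrAC; apply: le_lt_trans (ler_normD _ _) _.
  rewrite [rho]splitr ltr_leD// normrZ.
  apply: le_trans (ler_pM (normr_ge0 _) (normr_ge0 _) (le_trans sd (ltW db)) vb) _.
  by rewrite divfK ?lt0r_neq0.
pose g c s := iterD (f (p i)) (nseq c (v (p i))) (y i + s *: v (p i)).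
have <- : \sum_(c < M.+1) (d i ^+ c / c`!%:R) *: g c 0 = \sum_(c < M.+1)
   (d i ^+ c / c`!%:R) *: iterD (f (p i)) (nseq c (v (p i))) (y i).
  by apply: eq_bigr => c _; rewrite /g scale0r addr0.
rewrite -[f (p i) (y i + d i *: v (p i))]/(g 0%N (d i)).
have dg c (s : R) : (c < M)%N -> `|s| <= `|d i| -> is_derive s 1 (g c) (g c.+1 s).
  move=> cM /inb/hrho[As _]; apply: is_derive_line.
  apply: (@PCr_derivable _ _ _ _ (M - c.+1) A (fun p x => iterD (f p) (nseq c (v p)) x)) As.
  by rewrite subnSK//; apply: PCr_iterD_nseq => //; exact: ltnW.
have gM (s : R) : `|s| <= `|d i| -> `|g M s - g M 0| <= eta.
  move=> sd; have [_ Bs] := hrho _ (inb s sd).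
  have s0 : `|0 : R| <= `|d i| by rewrite normr0.
  have [_ B0] := hrho _ (inb 0 s0).
  have h1 := BB (_, _) (conj pB1 Bs); have h2 := BB (_, _) (conj pB1 B0).
  rewrite /= in h1 h2.
  rewrite (splitr eta) -(subrKA (iterD (f p0) (nseq M (v p0)) y0)).
  apply: le_trans (ler_normD _ _) (lerD h1 _); by rewrite distrC.
exact: (taylor1 dg gM (lexx _)).
Unshelve. all: by end_near. Qed.

End Taylor.

(** * Faa di Bruno's formula, one variable at a time *)

Section FaaDiBruno.
Context {R : realType}.

(* [Bn l s G w x] is the coefficient of [e ^ s] in the expansion of
   [G (x + \sum_(1 <= j <= l) e ^ j / j! * w j)], the variable [w l] being expanded first. *)
Fixpoint Bn {N m n} (l s : nat) (G : 'cV[R]_N -> 'M[R]_(m, n)) (w : nat -> 'cV[R]_N) x :=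
  if l is l'.+1 then
    \sum_(c < s.+1 | (l'.+1 * c <= s)%N)
      ((c`! * (l'.+1)`! ^ c)%:R)^-1 *: Bn l' (s - l'.+1 * c) (iterD G (nseq c (w l'.+1))) w x
  else if s == 0%N then G x else 0.

Lemma dirs_rcons (U : Type) l b (c : {ffun 'I_l -> 'I_b.+1}) (a : 'I_b.+1) (w : nat -> U)
    (c' : {ffun 'I_l.+1 -> 'I_b.+1}) :
  (forall j : 'I_l, c' (widen_ord (leqnSn l) j) = c j) -> c' ord_max = a ->
  dirs c' w = dirs c w ++ nseq a (w l.+1).
Proof.
move=> H1 H2; rewrite /dirs enum_ordSr map_rcons -cats1 flatten_cat /= cats0 H2 -map_comp.
by congr (flatten _ ++ _); apply: eq_map => j /=; rewrite H1.
Qed.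

Lemma Kc_rcons l b (c : {ffun 'I_l -> 'I_b.+1}) (a : 'I_b.+1)
    (c' : {ffun 'I_l.+1 -> 'I_b.+1}) :
  (forall j : 'I_l, c' (widen_ord (leqnSn l) j) = c j) -> c' ord_max = a ->
  Kc c' = (Kc c * (a`! * (l.+1)`! ^ a))%N.
Proof.
move=> H1 H2; rewrite /Kc big_ord_recr /= H2; congr (_ * _)%N.
by apply: eq_bigr => j _; rewrite H1.
Qed.

Lemma iterD_cat N m n (G : 'cV[R]_N -> 'M[R]_(m, n)) vs ws :
  iterD G (vs ++ ws) = iterD (iterD G ws) vs.
Proof. by rewrite /Defs.iterD foldr_cat. Qed.

Lemma sum_ord_narrow (W : nmodType) a b (Q : pred nat) (F : nat -> W) : (b <= a)%N ->
  (forall c, Q c -> (c < b)%N) -> \sum_(c < a | Q c) F c = \sum_(c < b | Q c) F c.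
Proof.
move=> ba H; rewrite (big_ord_widen_cond a Q F ba); apply: eq_bigl => c.
by case: (boolP (Q c)) => // /H ->.
Qed.

Lemma sum_ord_shift (W : nmodType) k M (F : nat -> W) :
  \sum_(s < M | (k <= s)%N) F s = \sum_(s < M - k) F (s + k)%N.
Proof.
rewrite -(big_mkord (fun s => (k <= s)%N) F) -(big_nat_widenl k 0 M xpredT F)//.
by rewrite -{1}[k]add0n big_addn big_mkord.
Qed.

(** The tuples are split according to their last entry. The bound [b] on the entries is kept apart
    from the weight [s], because the induction lowers the weight while the tuples keep their
    codomain. *)
Lemma sum_Sset_Bn N m n l s b (G : 'cV[R]_N -> 'M[R]_(m, n)) w x : (s <= b)%N ->
  \sum_(c : {ffun 'I_l -> 'I_b.+1} | (\sum_(j < l) (j.+1 * c j))%N == s)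
     ((Kc c)%:R)^-1 *: iterD G (dirs c w) x = Bn l s G w x.
Proof.
elim: l s G => [|l IH] s G sb.
  rewrite /=; have [->|s0] := eqVneq s 0%N.
    rewrite (big_pred1 [ffun _ => ord0]) => [|c /=].
      by rewrite /Kc big_ord0 /dirs enum_ord0 /= invr1 scale1r.
    rewrite big_ord0 eqxx; apply/esym/eqP/ffunP => -[] //.
  rewrite big_pred0 // => c; rewrite big_ord0 eq_sym; exact/negbTE.
rewrite [RHS]/=.
pose ext (p : {ffun 'I_l -> 'I_b.+1} * 'I_b.+1) : {ffun 'I_l.+1 -> 'I_b.+1} :=
  [ffun i => if unlift ord_max i is Some j then p.1 j else p.2].
pose res (c : {ffun 'I_l.+1 -> 'I_b.+1}) : {ffun 'I_l -> 'I_b.+1} * 'I_b.+1 :=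
  ([ffun j => c (widen_ord (leqnSn l) j)], c ord_max).
have liftE (j : 'I_l) : widen_ord (leqnSn l) j = lift ord_max j.
  by apply: val_inj; rewrite /= /bump leqNgt ltn_ord.
have ext1 p j : ext p (widen_ord (leqnSn l) j) = p.1 j by rewrite ffunE liftE liftK.
have ext2 p : ext p ord_max = p.2 by rewrite ffunE unlift_none.
rewrite (reindex ext) /=; last first.
  exists res => [p _|c _].
    rewrite /res ext2; case: p => p1 p2 /=; congr pair; apply/ffunP => j.
    by rewrite ffunE ext1.
  apply/ffunP => i; rewrite ffunE; case: unliftP => [j|] -> //=.
  by rewrite ffunE liftE.
rewrite (eq_bigl (fun p : {ffun 'I_l -> 'I_b.+1} * 'I_b.+1 => (\sum_(j < l) (j.+1 * p.1 j) + l.+1 * p.2)%N == s)); last first.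
  by move=> p; rewrite big_ord_recr /= ext2; under eq_bigr do rewrite ext1.
rewrite -(pair_big_dep xpredT (fun (c : {ffun 'I_l -> 'I_b.+1}) (a : 'I_b.+1) => (\sum_(j < l) (j.+1 * c j) + l.+1 * a)%N == s)
  (fun c a => ((Kc (ext (c, a)))%:R)^-1 *: iterD G (dirs (ext (c, a)) w) x)) /=.
rewrite (exchange_big_dep xpredT) //=.
rewrite (bigID (fun a : 'I_b.+1 => (l.+1 * a <= s)%N)) /= addrC big1 ?add0r; last first.
  move=> a; rewrite -ltnNge => sa; rewrite big_pred0 // => c.
  by apply/negbTE; rewrite neq_ltn; apply/orP; right; apply: leq_trans sa _; exact: leq_addl.
transitivity (\sum_(a < b.+1 | (l.+1 * a <= s)%N)
   ((a`! * (l.+1)`! ^ a)%:R)^-1 *: Bn l (s - l.+1 * a) (iterD G (nseq a (w l.+1))) w x).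
  apply: eq_bigr => a sa.
  rewrite -IH ?(leq_trans (leq_subr _ _))// scaler_sumr; apply: eq_big => c.
    by rewrite -[RHS](eqn_add2r (l.+1 * a)) subnK.
  move=> _; have e1 := ext1 (c, a); have e2 := ext2 (c, a).
  rewrite (dirs_rcons w e1 e2) (Kc_rcons e1 e2) iterD_cat scalerA -invfM -natrM.
  by rewrite mulnC.
apply: (@sum_ord_narrow _ b.+1 s.+1 (fun a => (l.+1 * a <= s)%N)
  (fun a => ((a`! * (l.+1)`! ^ a)%:R)^-1 *: Bn l (s - l.+1 * a) (iterD G (nseq a (w l.+1))) w x)) => //.
by move=> a sa; rewrite ltnS; apply: leq_trans sa; exact: leq_pmull.
Qed.

Lemma sum_Sset l s N m n (G : 'cV[R]_N -> 'M[R]_(m, n)) w x :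
  \sum_(c : {ffun 'I_l -> 'I_s.+1} | Sset l s c)
     ((Kc c)%:R)^-1 *: iterD G (dirs c w) x = Bn l s G w x.
Proof. exact: sum_Sset_Bn. Qed.

Lemma Bn_S l s N m n (G : 'cV[R]_N -> 'M[R]_(m, n)) w x : (s < l.+1)%N ->
  Bn l.+1 s G w x = Bn l s G w x.
Proof.
move=> sl; rewrite [LHS]/= big_mkcond big_ord_recl /= muln0 leq0n subn0 fact0 mul1n expn0 invr1 scale1r.
rewrite big1 ?addr0// => c _; rewrite ifF//; apply/negbTE; rewrite -ltnNge.
by apply: leq_trans sl _; rewrite leq_pmulr.
Qed.

Lemma Bn_stable l s N m n (G : 'cV[R]_N -> 'M[R]_(m, n)) w x : (s <= l)%N ->
  Bn l s G w x = Bn s s G w x.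
Proof.
by move/subnK => <-; elim: (l - s)%N => [//|k IH]; rewrite addSn Bn_S ?IH// ltnS leq_addl.
Qed.

(** In weight l + 1 the variable [w l.+1] occurs at most once, and when it occurs the others are
    absent. Hence it enters linearly: the equation for y_i is a linear differential equation in y_i,
    and gamma_i is found by inverting Delta. *)
Lemma Bn_diag l N m n (G : 'cV[R]_N -> 'M[R]_(m, n)) w x :
  Bn l.+1 l.+1 G w x = Bn l l.+1 G w x + ((l.+1)`!%:R)^-1 *: 'D_(w l.+1) G x.
Proof.
rewrite [LHS]/= big_mkcond big_ord_recl /= muln0 leq0n subn0 fact0 mul1n expn0 invr1 scale1r.
congr (_ + _); rewrite big_ord_recl /= /bump /= addn0 muln1 leqnn subnn mul1n expn1.
rewrite big1 ?addr0 => [|c _]; last first.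
  rewrite ifF//; apply/negbTE; rewrite -ltnNge /bump /= !add1n.
  by rewrite !mulnS -[X in (X < _)%N]addn0 -addnS leq_add2l addSn.
have B0 k H : Bn k 0 H w x = H x by elim: k H => [//|k IH] H; rewrite Bn_S.
by rewrite B0.
Qed.

Lemma normr_divn_le (a : R) (k : nat) : (0 < k)%N -> `|a / k%:R| <= `|a|.
Proof.
move=> k0; rewrite normrM ler_piMr// normfV ger0_norm ?ler0n// invf_le1 ?ltr0n//.
by rewrite ler1n.
Qed.

(** Induction on the number of variables. Taylor's formula in the last one gives terms with c
    derivatives and a factor e^((l+1)c); the induction hypothesis expands each of them to order M -
    (l+1)c, which does not exceed the M - c derivatives still available. *)
Lemma lo_faadibruno (P : topologicalType) N m n l M (A : set 'cV[R]_N)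
    (f : P -> 'cV[R]_N -> 'M[R]_(m, n)) (x : P -> 'cV[R]_N) (v : nat -> P -> 'cV[R]_N) (p0 : P) :
  open A -> PCr M A f -> continuous x -> (forall j, continuous (v j)) -> A (x p0) ->
  lo (nbhs (p0, 0 : R)) snd M (fun q : P * R =>
     f q.1 (x q.1 + \sum_(1 <= j < l.+1) (q.2 ^+ j / j`!%:R) *: v j q.1)
     - \sum_(s < M.+1) q.2 ^+ s *: Bn l s (f q.1) (fun j => v j q.1) (x q.1)).
Proof.
move=> oA fA cx cv Ax0.
have e0 : (fun q : P * R => q.2) @ (p0, 0 : R) --> (0 : R) by exact: cvg_snd.
have pF : (fun q : P * R => q.1) @ (p0, 0 : R) --> p0 by exact: cvg_fst.
have e1 : \forall q \near (p0, 0 : R), `|q.2| <= 1.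
  by move/cvgrPdist_le: e0 => /(_ _ ltr01); apply: filterS => i; rewrite sub0r normrN.
elim: l M f fA => [|l IH] M f fA.
  have H0 : lo (nbhs (p0, 0 : R)) snd M (fun q : P * R => 0 : 'M[R]_(m, n)).
    by move=> eta eta0; near=> q; rewrite normr0 mulr_ge0 ?exprn_ge0// ltW.
  apply: lo_eq H0; near=> q; rewrite big_geq// addr0 big_ord_recl /= expr0 scale1r big1 ?addr0 ?subrr//.
  by move=> c _; rewrite scaler0.
pose y (q : P * R) := x q.1 + \sum_(1 <= j < l.+1) (q.2 ^+ j / j`!%:R) *: v j q.1.
pose d (q : P * R) := q.2 ^+ l.+1 / (l.+1)`!%:R.
have eX j : (fun q : P * R => q.2 ^+ j.+1 / (j.+1)`!%:R) @ (p0, 0 : R) --> (0 : R).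
  have h : (fun q : P * R => q.2 ^+ j.+1 / (j.+1)`!%:R) @ (p0, 0 : R) --> ((0 : R) ^+ j.+1 / (j.+1)`!%:R).
    apply: cvgM; last exact: cvg_cst.
    exact: (@cvg_comp _ _ _ (fun q : P * R => q.2) (fun z : R => z ^+ j.+1) _ _ _ e0 (@exprn_continuous R j.+1 0)).
  by rewrite [_ ^+ _]exprS !mul0r in h.
have d0 : d @ (p0, 0 : R) --> (0 : R) by exact: eX.
have yF : y @ (p0, 0 : R) --> x p0.
  rewrite -[x p0]addr0; apply: cvgD.
    by apply: (@cvg_comp _ _ _ (fun q : P * R => q.1) x _ _ _ pF); exact: cx.
  rewrite /y; elim: l {IH y d d0} => [|l IHl].
    rewrite (_ : (fun q : P * R => _) = fun=> 0); first exact: cvg_cst.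
    by apply/funext => q; rewrite big_geq.
  rewrite (_ : (fun q : P * R => _) = (fun q => \sum_(1 <= j < l.+1) (q.2 ^+ j / j`!%:R) *: v j q.1 +
      (q.2 ^+ l.+1 / l.+1`!%:R) *: v l.+1 q.1)); last first.
    by apply/funext => q; rewrite big_nat_recr.
  rewrite -[X in _ --> X]addr0; apply: cvgD => //.
  rewrite -(scale0r (v l.+1 p0)); apply: cvgZ; first exact: eX.
  by apply: (@cvg_comp _ _ _ (fun q : P * R => q.1) (v l.+1) _ _ _ pF); exact: cv.
have dle (q : P * R) : `|d q| <= `|q.2| ^+ l.+1.
  by rewrite -normrX; apply: normr_divn_le; rewrite fact_gt0.
(* [T c] collects the terms of the full expansion in which the last variable occurs exactly [c]
   times. *)
pose T c (q : P * R) := \sum_(s < M.+1 | (l.+1 * c <= s)%N) q.2 ^+ s *: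
  (((c`! * (l.+1)`! ^ c)%:R)^-1 *: Bn l (s - l.+1 * c)
     (iterD (f q.1) (nseq c (v l.+1 q.1))) (fun j => v j q.1) (x q.1)).
have dX (q : P * R) c : d q ^+ c / c`!%:R = q.2 ^+ (l.+1 * c) * ((c`! * (l.+1)`! ^ c)%:R)^-1.
  by rewrite /d expr_div_n -exprM -mulrA -invfM natrM natrX [_ * c`!%:R]mulrC.
have H1 : lo (nbhs (p0, 0 : R)) snd M (fun q : P * R => f q.1 (y q + d q *: v l.+1 q.1) -
    \sum_(c < M.+1) (d q ^+ c / c`!%:R) *: iterD (f q.1) (nseq c (v l.+1 q.1)) (y q)).
  move=> eta eta0; have L := lo_taylor oA fA (cv l.+1) Ax0 pF yF d0.
  apply: filterS2 e1 (L _ _ eta0) => q q1 h; apply: le_trans h _.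
  rewrite ler_wpM2l ?(ltW eta0)// lerXn2r ?nnegrE//.
  by apply: le_trans (dle q) _; rewrite exprS ler_piMr// exprn_ile1.
have H2 c : (c < M.+1)%N -> lo (nbhs (p0, 0 : R)) snd M (fun q : P * R =>
    (d q ^+ c / c`!%:R) *: iterD (f q.1) (nseq c (v l.+1 q.1)) (y q) - T c q).
  rewrite ltnS => cM; have fc := PCr_iterD_nseq oA (cv l.+1) cM fA.
  have [lcM|Mlc] := leqP (l.+1 * c) M.
    have lcM' : (M - l.+1 * c <= M - c)%N by rewrite leq_sub2l// leq_pmull.
    rewrite -[X in lo _ _ X _](subnK lcM).
    apply: (lo_scale (C := 1) _ (IH _ _ (PCr_le lcM' fc))) => //; near=> q.
    rewrite /T (sum_ord_shift (l.+1 * c) _ (fun s => q.2 ^+ s *: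
       (((c`! * (l.+1)`! ^ c)%:R)^-1 *: Bn l (s - l.+1 * c)
       (iterD (f q.1) (nseq c (v l.+1 q.1))) (fun j => v j q.1) (x q.1)))) subSn//.
    under eq_bigr do rewrite addnK scalerA exprD -mulrA -dX mulrC -scalerA.
    rewrite -scaler_sumr -scalerBr normrZ ler_wpM2r// mul1r.
    by rewrite dX -normrX; apply: normr_divn_le; rewrite muln_gt0 fact_gt0 expn_gt0 fact_gt0.
  (* Here (l+1)c exceeds M: [T c] is an empty sum, and the factor e^((l+1)c) alone is o(e^M). *)
  have c0 : (fun q : P * R => (q.1, y q)) @ (p0, 0 : R) --> (p0, x p0) by exact: (cvg_pair (G := nbhs p0) (H := nbhs (x p0)) pF yF).
  have B := c0 _ (PCr_near p0 fc Ax0 ltr01).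
  apply: (lo_bnd (C := `|iterD (f p0) (nseq c (v l.+1 p0)) (x p0)| + 1)) => //.
  apply: filterS2 e1 B => q q1 /= h.
  rewrite /T big_pred0 ?subr0 => [|s]; last first.
    by apply/negbTE; rewrite -ltnNge; apply: leq_ltn_trans Mlc; rewrite -ltnS.
  rewrite normrZ mulrC ler_pM//.
    by rewrite -lerBlDl; apply: le_trans (lerB_dist _ _) h.
  rewrite dX; apply: (@le_trans _ _ (`|q.2| ^+ (l.+1 * c))).
    by rewrite -normrX; apply: normr_divn_le; rewrite muln_gt0 fact_gt0 expn_gt0 fact_gt0.
  by rewrite ler_wiXn2l.
have S2 : lo (nbhs (p0, 0 : R)) snd M (fun q : P * R => \sum_(c < M.+1)
    ((d q ^+ c / c`!%:R) *: iterD (f q.1) (nseq c (v l.+1 q.1)) (y q) - T c q)).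
  by apply: lo_sum => c _; exact: H2.
apply: (lo_eq _ (lo_add H1 S2)); near=> q.
rewrite sumrB addrA subrK big_nat_recr//= addrA; congr (_ - _).
rewrite /T; under eq_bigr do under eq_bigr do rewrite scalerA mulrC -scalerA.
rewrite (exchange_big_dep xpredT)//=; apply: eq_bigr => s _; rewrite scaler_sumr.
rewrite (@sum_ord_narrow _ M.+1 s.+1 (fun c => (l.+1 * c <= s)%N) (fun c =>
  ((c`! * (l.+1)`! ^ c)%:R)^-1 *: (q.2 ^+ s *: Bn l (s - l.+1 * c) (iterD (f q.1) (nseq c (v l.+1 q.1)))
       (fun j => v j q.1) (x q.1))))//; last first.
  by move=> a sa; rewrite ltnS; apply: leq_trans sa; exact: leq_pmull.
by apply: eq_bigr => c _; rewrite scalerA mulrC -scalerA.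
Unshelve. all: by end_near. Qed.

End FaaDiBruno.

(** * Piecewise ordinary differential equations *)

Section PiecewiseODE.
Context {R : realType} (n : nat) (T : R) (ts : nat -> R).
Hypothesis ts0 : ts 0%N = 0.
Hypothesis tsn : ts n = T.
Hypothesis tsS : forall j, (j < n)%N -> ts j < ts j.+1.

Lemma cvg_sumr (I : Type) (F : set_system I) {FF : Filter F} (W : normedModType R) (J : Type)
    (s : seq J) (Q : pred J) (f : J -> I -> W) (l : J -> W) :
  (forall j, Q j -> f j @ F --> l j) ->
  (fun i => \sum_(j <- s | Q j) f j i) @ F --> \sum_(j <- s | Q j) l j.
Proof.
move=> H; elim: s => [|j s IH].
  rewrite big_nil (_ : (fun i => _) = fun=> 0); first exact: cvg_cst.
  by apply/funext => i; rewrite big_nil.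
rewrite big_cons; case: (boolP (Q j)) => Qj.
  rewrite (_ : (fun i => _) = (fun i => f j i + \sum_(j <- s | Q j) f j i)).
    by apply: cvgD => //; exact: H.
  by apply/funext => i; rewrite big_cons Qj.
rewrite (_ : (fun i => _) = (fun i => \sum_(j <- s | Q j) f j i))//.
by apply/funext => i; rewrite big_cons (negbTE Qj).
Qed.

Lemma ts_le j l : (j <= l)%N -> (l <= n)%N -> ts j <= ts l.
Proof.
elim: l => [|l IH]; first by rewrite leqn0 => /eqP ->.
rewrite leq_eqVlt => /predU1P[->//|]; rewrite ltnS => jl ln.
exact: le_trans (IH jl (ltnW ln)) (ltW (tsS ln)).
Qed.

Lemma ts_itv j : (j <= n)%N -> 0 <= ts j <= T.
Proof. by move=> jn; rewrite -ts0 -tsn !ts_le. Qed.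

Lemma T_ge0 : 0 <= T.
Proof. by rewrite -tsn -ts0 ts_le. Qed.

Lemma piece_itv j t : (j < n)%N -> ts j < t < ts j.+1 -> 0 <= t <= T.
Proof.
move=> jn /andP[jt tj]; have /andP[a _] := ts_itv (ltnW jn); have /andP[_ b] := ts_itv jn.
by rewrite (le_trans a (ltW jt)) (le_trans (ltW tj) b).
Qed.

Lemma piecewise_ind (Q : R -> Prop) : Q 0 ->
  (forall j t, (j < n)%N -> ts j < t <= ts j.+1 -> Q (ts j) -> Q t) ->
  forall t, 0 <= t <= T -> Q t.
Proof.
move=> Q0 QS; suff H l : (l <= n)%N -> forall t, 0 <= t <= ts l -> Q t.
  by move=> t; rewrite -tsn; exact: H.
elim: l => [|l IH] ln t.
  by rewrite ts0 => t0; rewrite (_ : t = 0) //; apply/eqP; rewrite eq_le andbC.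
move=> /andP[t0 tl]; have [tl'|lt] := leP t (ts l).
  by apply: IH; rewrite ?t0 ?tl'// ltnW.
apply: (QS l) => //; first by rewrite lt.
by apply: IH; rewrite ?(ltnW ln) ?lexx// andbT; have /andP[] := ts_itv (ltnW ln).
Qed.

Lemma piecewise_nincr (q dq : R -> R) : continuous q ->
  (forall j t, (j < n)%N -> ts j < t < ts j.+1 -> is_derive t 1 q (dq t) /\ dq t <= 0) ->
  forall t, 0 <= t <= T -> q t <= q 0.
Proof.
move=> cq dqj; apply: piecewise_ind => // j t jn /andP[jt tj] qj.
apply: le_trans _ qj; rewrite -subr_le0.
have dqt x : x \in `]ts j, t[ -> is_derive x 1 q (dq x).
  by rewrite in_itv/= => /andP[x1 x2]; apply: (dqj j _ jn _).1; rewrite x1 (lt_le_trans x2).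
have [c + ->] := MVT jt dqt (continuous_subspaceT cq).
rewrite in_itv/= => /andP[c1 c2]; rewrite mulr_le0_ge0 ?subr_ge0 ?(ltW jt)//.
by apply: (dqj j _ jn _).2; rewrite c1 (lt_le_trans c2).
Qed.

(** Each entry of [e], with either sign, minus [b] is non-increasing on every piece, hence on [0, T]
    by continuity at the breakpoints. *)
Lemma piecewise_dist_le m l (e : R -> 'M[R]_(m, l)) (de : nat -> R -> 'M[R]_(m, l))
    (b db : R -> R) : continuous e -> continuous b ->
  (forall j t, (j < n)%N -> ts j < t < ts j.+1 ->
     [/\ is_derive t 1 e (de j t), is_derive t 1 b (db t) & `|de j t| <= db t]) ->
  forall t, 0 <= t <= T -> `|e t - e 0| <= b t - b 0.
Proof.
move=> ce cb H t tT.
have P sg u v : sg = 1 \/ sg = -1 -> sg * (e t u v - e 0 u v) <= b t - b 0.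
  move=> sgE; pose q s := sg * e s u v - b s.
  have cq : continuous q.
    move=> s; apply: cvgB; last exact: cb.
    by apply: cvgM; [exact: cvg_cst|apply: cvg_mx_coord; exact: ce].
  have := @piecewise_nincr q (fun s => 'D_1 q s) cq; rewrite /q.
  rewrite -/q => h0; have h := h0 _ t tT; rewrite /q in h.
  suff h1 : sg * e t u v - b t <= sg * e 0 u v - b 0 by rewrite mulrBr; lra.
  apply: h => j s jn sj; have [d1 d2 dle] := H j s jn sj.
  have d3 : is_derive s 1 q (sg * de j s u v - db s).
    apply: is_deriveB; have d4 := is_derive_coord u v d1.
    rewrite (_ : (fun s => _) = (cst sg * (fun s => e s u v))); last by [].
    by apply: is_derive_eq; rewrite scaler0 addr0.
  have dE : 'D_1 q s = sg * de j s u v - db s by case: d3.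
  rewrite -/q dE; split => //; rewrite subr_le0; apply: le_trans dle.
  apply: le_trans (mx_norm_coord _ u v); case: sgE => ->; first by rewrite mul1r ler_norm.
  by rewrite mulN1r -normrN ler_norm.
apply: mx_norm_le.
  have := @piecewise_nincr (fun s => - b s) (fun s => - db s) _ _ t tT.
  rewrite lerN2 subr_ge0; apply; first by move=> s; apply: cvgN; exact: cb.
  move=> j s jn sj; have [_ d2 dle] := H j s jn sj.
  by split; [exact: is_deriveN|rewrite oppr_le0; exact: le_trans dle].
move=> u v; rewrite !mxE ler_norml.
have := P 1 u v (or_introl erefl); have := P (-1) u v (or_intror erefl); lra.
Qed.

(* The norm of matrices is a maximum, hence not differentiable; Gronwall's inequality is
   proved for the sum of squares instead. *)
Definition sqn N (v : 'cV[R]_N) := \sum_i v i 0 ^+ 2.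

Lemma sqn_ge N (v : 'cV[R]_N) : `|v| ^+ 2 <= sqn v.
Proof.
have S0 : 0 <= sqn v by apply: sumr_ge0 => i _; exact: sqr_ge0.
suff : `|v| <= Num.sqrt (sqn v) by rewrite -(ler_pXn2r (ltn0Sn 1)) ?nnegrE ?sqrtr_ge0// sqr_sqrtr.
apply: mx_norm_le => [|i j]; first exact: sqrtr_ge0.
rewrite -(ler_pXn2r (ltn0Sn 1)) ?nnegrE ?sqrtr_ge0// sqr_sqrtr// ord1 real_normK ?num_real//.
by rewrite /sqn (bigD1 i)//= lerDl; apply: sumr_ge0 => k _; exact: sqr_ge0.
Qed.

Lemma sqn_le N (v : 'cV[R]_N) : sqn v <= N%:R * `|v| ^+ 2.
Proof.
apply: (@le_trans _ _ (\sum_(i < N) `|v| ^+ 2)); last by rewrite sumr_const card_ord mulr_natl.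
apply: ler_sum => i _.
by rewrite -[v i 0 ^+ 2]real_normK ?num_real// lerXn2r ?nnegrE// mx_norm_coord.
Qed.

Lemma is_derive_sqn N (e : R -> 'cV[R]_N) (t : R) de : is_derive t 1 e de ->
  is_derive t 1 (fun s => sqn (e s)) (\sum_i 2 * e t i 0 * de i 0).
Proof.
move=> d; rewrite (_ : (fun s => _) = \sum_i (fun s => e s i 0 ^+ 2)); last first.
  by apply/funext => s; rewrite fct_sumE.
apply: is_derive_sum => i; have di := is_derive_coord i 0 d.
rewrite (_ : (fun s => _) = (fun s => e s i 0) ^+ 2); last by apply/funext => s; rewrite exprfctE.
by apply: is_derive_eq; rewrite expr1.
Qed.

Lemma is_derive_expRM (k t : R) : is_derive t 1 (fun s => expR (k * s)) (k * expR (k * t)).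
Proof.
have h : is_derive t 1 (fun s : R => k * s) k.
  have : is_derive t 1 ( *:%R k) (k *: 1) by apply: is_deriveZ.
  by rewrite [_ *: 1]mulr1.
have := @is_derive1_comp R expR (fun s => k * s) t _ _ (is_derive_expR _) h.
by rewrite mulrC.
Qed.

Lemma continuous_sqn N (e : R -> 'cV[R]_N) : continuous e -> continuous (fun s => sqn (e s)).
Proof.
move=> ce s; rewrite /sqn /prop_for/continuous_at.
apply: cvg_sumr => i _.
exact: (@cvg_comp _ _ _ (fun s => e s i 0) (fun z : R => z ^+ 2) _ _ _
  (cvg_mx_coord (i := i) (j := 0) (ce s)) (@exprn_continuous R 2 _)).
Qed.

Lemma sqn_derive_le N (v dv : 'cV[R]_N) L c : 0 <= L -> 0 <= c -> `|dv| <= L * `|v| + c ->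
  `|\sum_i 2 * v i 0 * dv i 0| <= 2 * (N%:R * (L + 1)) * (sqn v + c ^+ 2).
Proof.
move=> L0 c0 dvL; apply: le_trans (ler_norm_sum _ _ _) _.
have q := sqn_ge v.
apply: (@le_trans _ _ (\sum_(i < N) 2 * (L + 1) * (sqn v + c ^+ 2))); last first.
  rewrite sumr_const card_ord -mulr_natl; lra.
apply: ler_sum => i _; rewrite !normrM (@ger0_norm _ 2)// -!mulrA ler_pM2l//.
have := mx_norm_coord v i 0; have := mx_norm_coord dv i 0.
set a := `|v i 0|; set b := `|dv i 0|; have a0 : 0 <= a := normr_ge0 _; have b0 : 0 <= b := normr_ge0 _.
set x := `|v| in q dvL *; have x0 : 0 <= x := normr_ge0 _; set s := sqn v in q *.
move=> b1 a1; apply: (@le_trans _ _ (x * (L * x + c))).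
  by rewrite ler_pM//; exact: le_trans dvL.
have h1 := ler_wpM2l L0 q; have h2 := sqr_ge0 (x - c); have h3 := mulr_ge0 L0 (sqr_ge0 c).
have h4 := sqr_ge0 c; have h5 := sqr_ge0 x; move: q h1 h2 h3 h4 h5; rewrite !expr2; lra.
Qed.

(** The function [S], which is (|e|^2 + c^2) exp(-2Kt) for the Euclidean norm, is non-increasing:
    adding c^2 to the square absorbs the inhomogeneous term. Returning to the maximum norm costs the
    factor [N] on the initial value. *)
Lemma gronwall N (e : R -> 'cV[R]_N) (de : nat -> R -> 'cV[R]_N) L c :
  0 <= L -> 0 <= c -> continuous e ->
  (forall j t, (j < n)%N -> ts j < t < ts j.+1 -> is_derive t 1 e (de j t)) ->
  (forall j t, (j < n)%N -> ts j < t < ts j.+1 -> `|de j t| <= L * `|e t| + c) ->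
  forall t, 0 <= t <= T -> `|e t| <= (N%:R * `|e 0| + c) * expR (N%:R * (L + 1) * T).
Proof.
move=> L0 c0 ce dej dele t tT; pose K := N%:R * (L + 1).
have K0 : 0 <= K by rewrite mulr_ge0// addr_ge0.
pose S s := (sqn (e s) + c ^+ 2) * expR (- (2 * K) * s).
have cS : continuous S.
  move=> s; apply: cvgM.
    by apply: cvgD; [exact: continuous_sqn|exact: cvg_cst].
  by have := is_derive_continuous (is_derive_expRM (- (2 * K)) s).
have := @piecewise_nincr S (fun s => 'D_1 S s) cS _ t tT.
have -> : S 0 = sqn (e 0) + c ^+ 2 by rewrite /S mulr0 expR0 mulr1.
move=> H; have {}H : S t <= sqn (e 0) + c ^+ 2.
  apply: H => j s jn sj; have ds := dej j s jn sj.
  have dS : is_derive s 1 S ((\sum_i 2 * e s i 0 * de j s i 0) * expR (- (2 * K) * s)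
     + (sqn (e s) + c ^+ 2) * (- (2 * K) * expR (- (2 * K) * s))).
    have d1 := is_derive_sqn ds; have d2 := is_derive_expRM (- (2 * K)) s.
    rewrite (_ : S = (((fun s => sqn (e s)) + cst (c ^+ 2)) * (fun s => expR (- (2 * K) * s)))); last by [].
    apply: (is_derive_eq (is_deriveM (is_deriveD d1 (is_derive_cst _ _ _)) d2)).
    by rewrite addr0 addrC; congr (_ + _); rewrite [LHS]mulrC.
  have dE : 'D_1 S s = (\sum_i 2 * e s i 0 * de j s i 0) * expR (- (2 * K) * s)
     + (sqn (e s) + c ^+ 2) * (- (2 * K) * expR (- (2 * K) * s)) by case: dS.
  split; first (by rewrite dE); rewrite dE [(sqn _ + _) * (_ * _)]mulrA -mulrDl pmulr_lle0 ?expR_gt0//.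
  have := sqn_derive_le L0 c0 (dele j s jn sj).
  rewrite -/K ler_norml => /andP[_]; lra.
have E0 : 0 < expR (K * T) by exact: expR_gt0.
have Et : expR (K * t) <= expR (K * T) by rewrite ler_expR ler_wpM2l//; case/andP: tT.
rewrite -(ler_pXn2r (ltn0Sn 1)) ?nnegrE ?mulr_ge0 ?addr_ge0 ?mulr_ge0 ?(ltW E0)//.
apply: le_trans (sqn_ge _) _.
have {}H : sqn (e t) <= (sqn (e 0) + c ^+ 2) * expR (K * t) ^+ 2.
  have -> : expR (K * t) ^+ 2 = (expR (- (2 * K) * t))^-1.
    by rewrite -expRM_natl -expRN mulrA !mulNr opprK.
  rewrite ler_pdivlMr ?expR_gt0//; apply: le_trans H.
  by rewrite /S ler_wpM2r ?expR_ge0// lerDl sqr_ge0.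
apply: le_trans H _; rewrite exprMn ler_pM ?exprn_ge0 ?expR_ge0//.
- by rewrite addr_ge0 ?sqr_ge0//; apply: le_trans (sqn_ge _); rewrite sqr_ge0.
- apply: (@le_trans _ _ (N%:R ^+ 2 * `|e 0| ^+ 2 + c ^+ 2)).
    rewrite lerD2r; apply: le_trans (sqn_le _) _; rewrite ler_wpM2r ?sqr_ge0//.
    by rewrite -natrX ler_nat; case: (N) => // N'; rewrite leq_pmulr.
  by rewrite sqrrD exprMn; rewrite lerD2r lerDl mulrn_wge0// mulr_ge0// mulr_ge0.
- by rewrite lerXn2r ?nnegrE ?expR_ge0.
Qed.

(** Gronwall backwards in time: the sum of squares times exp(2Kt) is non-decreasing, so a solution
    that vanishes at some time was zero initially. It yields the invertibility of the fundamental
    matrix. *)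
Lemma gronwall_eq0 N (e : R -> 'cV[R]_N) (de : nat -> R -> 'cV[R]_N) L :
  0 <= L -> continuous e ->
  (forall j t, (j < n)%N -> ts j < t < ts j.+1 -> is_derive t 1 e (de j t)) ->
  (forall j t, (j < n)%N -> ts j < t < ts j.+1 -> `|de j t| <= L * `|e t|) ->
  forall t, 0 <= t <= T -> e t = 0 -> e 0 = 0.
Proof.
move=> L0 ce dej dele t tT et0; pose K := N%:R * (L + 1).
pose S s := - (sqn (e s) * expR (2 * K * s)).
have cS : continuous S.
  move=> s; apply: cvgN; apply: cvgM; first exact: continuous_sqn.
  by have := is_derive_continuous (is_derive_expRM (2 * K) s).
have := @piecewise_nincr S (fun s => 'D_1 S s) cS _ t tT.
have -> : S 0 = - sqn (e 0) by rewrite /S mulr0 expR0 mulr1.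
have -> : S t = 0.
  by rewrite /S et0 /sqn big1 ?mul0r ?oppr0// => i _; rewrite mxE expr0n.
move=> H; have {}H : 0 <= - sqn (e 0).
  apply: H => j s jn sj; have ds := dej j s jn sj.
  have dS : is_derive s 1 S (- ((\sum_i 2 * e s i 0 * de j s i 0) * expR (2 * K * s)
     + sqn (e s) * (2 * K * expR (2 * K * s)))).
    have d1 := is_derive_sqn ds; have d2 := is_derive_expRM (2 * K) s.
    rewrite (_ : S = - ((fun s => sqn (e s)) * (fun s => expR (2 * K * s)))); last by [].
    apply: (is_derive_eq (is_deriveN (is_deriveM d1 d2))).
    by rewrite addrC; congr (- (_ + _)); rewrite [LHS]mulrC.
  have dE : 'D_1 S s = - ((\sum_i 2 * e s i 0 * de j s i 0) * expR (2 * K * s)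
     + sqn (e s) * (2 * K * expR (2 * K * s))) by case: dS.
  split; first (by rewrite dE); rewrite dE oppr_le0 [sqn _ * (_ * _)]mulrA -mulrDl mulr_ge0 ?expR_ge0//.
  have := @sqn_derive_le _ (e s) (de j s) L 0 L0 (lexx 0); rewrite addr0 => /(_ (dele j s jn sj)).
  rewrite expr0n addr0 -/K ler_norml => /andP[+ _]; lra.
have h : `|e 0| ^+ 2 == 0.
  by rewrite eq_le sqr_ge0 andbT; apply: le_trans (sqn_ge _) _; rewrite -oppr_ge0.
by move: h; rewrite sqrf_eq0 normr_eq0 => /eqP.
Qed.

(** The intervals of centre [u k] and radius 2C/2^k are nested, and the limit is the supremum of
    their left ends. The explicit rate serves the Picard iteration and the fixed point argument. *)
Lemma geo_cvgR (u : nat -> R) C : (forall k, `|u k.+1 - u k| <= C / 2 ^+ k) ->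
  exists w, forall k, `|w - u k| <= 2 * C / 2 ^+ k.
Proof.
move=> H; have C0 : 0 <= C by have := le_trans (normr_ge0 _) (H 0%N); rewrite expr0 divr1.
have p2 k : 0 < 2 ^+ k :> R by rewrite exprn_gt0.
pose d k := C / 2 ^+ k; have dS k : d k = 2 * d k.+1.
  by rewrite /d exprS invfM mulrCA [2 * (_ * _)]mulrA mulfV ?mul1r.
have d0 k : 0 <= d k by rewrite divr_ge0// ltW.
have am k i : u k - 2 * d k <= u (k + i)%N - 2 * d (k + i)%N.
  elim: i => [|i IH]; first by rewrite addn0.
  apply: le_trans IH _; rewrite addnS; have := H (k + i)%N; rewrite -/(d _) ler_norml.
  rewrite (dS (k + i)%N) => /andP[h _]; lra.
have bm k i : u (k + i)%N + 2 * d (k + i)%N <= u k + 2 * d k.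
  elim: i => [|i IH]; first by rewrite addn0.
  apply: le_trans _ IH; rewrite addnS; have := H (k + i)%N; rewrite -/(d _) ler_norml.
  rewrite (dS (k + i)%N) => /andP[_ h]; lra.
have ab k j : u k - 2 * d k <= u j + 2 * d j.
  apply: le_trans (am k j) _; apply: le_trans _ (bm j k); rewrite addnC.
  have := d0 (j + k)%N; lra.
pose A := [set u k - 2 * d k | k in [set: nat]].
have A0 : A !=set0 by exists (u 0%N - 2 * d 0%N); exists 0%N.
have Aub j : ubound A (u j + 2 * d j) by move=> _ [k _ <-].
exists (sup A) => k; rewrite -mulrA -/(d k) ler_distl; apply/andP; split.
  by apply: ub_le_sup; [exists (u 0%N + 2 * d 0%N)|exists k].
by apply: ge_sup.
Qed.

Lemma geo_cvg m l (u : nat -> 'M[R]_(m, l)) C : (forall k, `|u k.+1 - u k| <= C / 2 ^+ k) ->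
  exists w, forall k, `|w - u k| <= 2 * C / 2 ^+ k.
Proof.
move=> H; have C0 : 0 <= C by have := le_trans (normr_ge0 _) (H 0%N); rewrite expr0 divr1.
have h i j : exists w, forall k, `|w - u k i j| <= 2 * C / 2 ^+ k.
  apply: (geo_cvgR (u := fun k => u k i j)) => k; apply: le_trans (H k).
  by have := mx_norm_coord (u k.+1 - u k) i j; rewrite !mxE.
exists (\matrix_(i, j) sval (cid (h i j))) => k.
apply: mx_norm_le => [|i j]; first by rewrite divr_ge0 ?mulr_ge0// exprn_ge0.
by rewrite !mxE; case: (cid (h i j)).
Qed.

(** Projection onto [a, b]. In time it extends paths given on [0, T] to the whole line; in space it
    truncates a field outside a tube around an orbit. *)
Definition clampR (a b x : R) := Num.max a (Num.min b x).

Lemma clampR_id a b x : a <= x <= b -> clampR a b x = x.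
Proof. by move=> /andP[ax xb]; rewrite /clampR min_r// max_r. Qed.

Lemma clampR_le (a b x : R) : a <= b -> x <= a -> clampR a b x = a.
Proof. by move=> ab xa; rewrite /clampR min_r ?max_l//; lra. Qed.

Lemma clampR_ge (a b x : R) : a <= b -> b <= x -> clampR a b x = b.
Proof. by move=> ab xa; rewrite /clampR min_l ?max_r//; lra. Qed.

Lemma clampR_cases (a b x : R) : a <= b ->
  [\/ x <= a /\ clampR a b x = a, a <= x <= b /\ clampR a b x = x | b <= x /\ clampR a b x = b].
Proof.
move=> ab; have [xa|ax] := leP x a; first by constructor 1; rewrite clampR_le.
have [xb|bx] := leP x b; first by constructor 2; rewrite clampR_id ?(ltW ax).
by constructor 3; rewrite clampR_ge ?(ltW bx).
Qed.

Lemma clampR_itv (a b x : R) : a <= b -> a <= clampR a b x <= b.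
Proof. by move=> ab; case: (clampR_cases x ab) => -[h ->] //; rewrite ?lexx ?ab. Qed.

Lemma clampR_lip (a b x y : R) : a <= b -> `|clampR a b x - clampR a b y| <= `|x - y|.
Proof.
move=> ab; have := ler_norm (x - y); have := ler_norm (y - x); rewrite -(distrC x y) => h1 h2.
rewrite ler_norml.
by case: (clampR_cases x ab) => -[hx ->]; case: (clampR_cases y ab) => -[hy ->];
  apply/andP; split; lra.
Qed.

Lemma continuous_clampR a b : a <= b -> continuous (clampR a b).
Proof.
move=> ab x; apply/cvgrPdist_le => e e0; near=> y.
apply: le_trans (clampR_lip _ _ ab) _; near: y; exact: (cvgrPdist_le _ _).1.
Unshelve. all: by end_near. Qed.

Lemma is_derive_Rintegral (h : R -> R) (a t : R) : continuous h -> a < t ->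
  is_derive t 1 (fun x => Rintegral (@lebesgue_measure R) `[a, x] h) (h t).
Proof.
move=> ch at_; have t1 : t < t + 1 by rewrite ltrDl.
have ih : (@lebesgue_measure R).-integrable `[a, t + 1] (EFin \o h).
  by apply: continuous_compact_integrable; [exact: segment_compact|exact: continuous_subspaceT].
have [d dE] := continuous_FTC1_closed t1 ih at_ (ch t).
by apply: (DeriveDef d); rewrite -derive1E; exact: dE.
Qed.

Lemma piecewise_primitive N (h : nat -> R -> 'cV[R]_N) :
  (forall j, (j < n)%N -> continuous (h j)) ->
  exists G : R -> 'cV[R]_N, [/\ continuous G, G 0 = 0 &
    forall j t, (j < n)%N -> ts j < t < ts j.+1 -> is_derive t 1 G (h j t)].
Proof.
move=> ch.
(* Integrating from -1 makes every time t >= 0, including the breakpoint 0, an interior point for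
   the fundamental theorem of calculus. *)
pose P (j : nat) (i : 'I_N) (x : R) := Rintegral (@lebesgue_measure R) `[-1, x] (fun s => h j s i 0).
have dP j (i : 'I_N) (t : R) : (j < n)%N -> 0 <= t -> is_derive t 1 (P j i) (h j t i 0).
  move=> jn t0; apply: (is_derive_Rintegral (h := fun s => h j s i 0)).
    by move=> s; apply: cvg_mx_coord; exact: ch.
  by apply: lt_le_trans t0; rewrite ltrN10.
(* The clamp freezes the contribution of a piece before its left end and after its right end, so the
   sum of the contributions is continuous and has derivative [h j] inside the piece j. *)
pose Q i (j : 'I_n) t := P j i (clampR (ts j) (ts j.+1) t) - P j i (ts j).
have tsle (j : 'I_n) : ts j <= ts j.+1 by exact/ltW/tsS.
have ts_ge (j : 'I_n) : 0 <= ts j by have /andP[] := ts_itv (ltnW (ltn_ord j)).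
exists (fun t => \col_i \sum_(j < n) Q i j t); split.
- move=> t; apply: cvg_mx => i k; under eq_fun do rewrite mxE; rewrite mxE.
  apply: cvg_sumr => j _; apply: cvgB; last exact: cvg_cst.
  apply: (@continuous_comp _ _ _ (clampR (ts j) (ts j.+1)) (P j i)).
    exact: continuous_clampR.
  apply: (is_derive_continuous (dP j i _ (ltn_ord j) _)).
  by have /andP[+ _] := clampR_itv t (tsle j); exact: le_trans.
- apply/matrixP => i k; rewrite !mxE big1// => j _.
  by rewrite /Q clampR_le ?subrr.
- move=> j0 t jn tj; apply: is_derive_mx => i k; rewrite ord1.
  have -> : (fun y => (\col_i0 (\sum_(j < n) Q i0 j y)) i 0) = \sum_(j < n) Q i j.
    by apply/funext => y; rewrite mxE fct_sumE.
  rewrite (_ : h j0 t i 0 = \sum_(j < n) if (j : nat) == j0 then h j0 t i 0 else 0); last first.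
    rewrite (bigD1 (Ordinal jn))//= eqxx big1 ?addr0// => j; rewrite -val_eqE /= => /negbTE ->.
    by [].
  apply: is_derive_sum => j; case: (ltngtP j j0) => [jj0|j0j|jE].
  + have tt : ts j.+1 < t by case/andP: tj => + _; apply: le_lt_trans; apply: ts_le => //; exact: ltnW.
    apply: (@near_eq_is_derive _ _ _ (cst (P j i (ts j.+1) - P j i (ts j)))) => //.
    near=> y; rewrite /Q clampR_ge//; near: y; exact: lt_le_nbhsr.
  + have tt : t < ts j by case/andP: tj => _; move/lt_le_trans; apply; apply: ts_le => //; exact: ltnW.
    apply: (@near_eq_is_derive _ _ _ (cst 0)) => //.
    near=> y; rewrite /Q clampR_le// ?subrr//; near: y; exact: lt_le_nbhsl.
  + rewrite -jE in tj *; case/andP: tj => t1 t2.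
    apply: (@near_eq_is_derive _ _ _ (P j i - cst (P j i (ts j)))).
      near=> y; rewrite /Q clampR_id//; apply/andP; split; near: y; [exact: lt_le_nbhsr|exact: lt_le_nbhsl].
    rewrite -[h j t i 0]subr0; apply: is_deriveB.
    by apply: dP => //; exact: le_trans (ts_ge j) (ltW t1).
Unshelve. all: by end_near. Qed.

Lemma path_bounded m l (y : R -> 'M[R]_(m, l)) : continuous y ->
  exists2 M, 0 <= M & forall t, 0 <= t <= T -> `|y t| <= M.
Proof.
move=> cy.
have cn : continuous (fun t => `|y t|) by move=> t; apply: cvg_norm; exact: cy.
have [c _ h] := EVT_max T_ge0 (continuous_subspaceT cn).
by exists `|y c| => // t tT; apply: h; rewrite in_itv.
Qed.

Lemma half_expn_le (a e : R) : 0 < e -> exists k, a / 2 ^+ k <= e.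
Proof.
move=> e0; exists (Num.bound (a / e)); rewrite ler_pdivrMr ?exprn_gt0//.
rewrite mulrC -ler_pdivrMr//; apply: le_trans (ler_norm _) _.
apply: le_trans (ltW (archi_boundP (normr_ge0 _))) _.
have -> : Num.bound (a / e) = Num.bound `|a / e|.
  by rewrite /Num.bound normr_id.
by rewrite -natrX ler_nat ltnW// ltn_expl.
Qed.

(** The iterates are compared with the weight exp((2L+1)t), for which the Picard map contracts by
    1/2 on all of [0, T] at once, across the breakpoints. *)
Lemma picard N (g : nat -> R -> 'cV[R]_N -> 'cV[R]_N) L y0 : 0 <= L ->
  (forall j (y : R -> 'cV[R]_N), (j < n)%N -> continuous y -> continuous (fun t => g j t (y t))) ->
  (forall j t y y', (j < n)%N -> 0 <= t <= T -> `|g j t y' - g j t y| <= L * `|y' - y|) ->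
  exists y : R -> 'cV[R]_N, [/\ continuous y, y 0 = y0 &
    forall j t, (j < n)%N -> ts j < t < ts j.+1 -> is_derive t 1 y (g j t (y t))].
Proof.
move=> L0 cg lipg.
pose good (y z : R -> 'cV[R]_N) := [/\ continuous z, z 0 = y0 &
    forall j t, (j < n)%N -> ts j < t < ts j.+1 -> is_derive t 1 z (g j t (y t))].
have goodex y : continuous y -> exists z, good y z.
  move=> cy; have [G [cG G0 dG]] := piecewise_primitive (fun j jn => cg j y jn cy).
  exists (fun t => y0 + G t); split.
  - by move=> t; apply: cvgD; [exact: cvg_cst|exact: cG].
  - by rewrite G0 addr0.
  - by move=> j t jn tj; rewrite -[g j t _]add0r; apply: is_deriveD; exact: dG.
pose step y := get (good y).
have stepP y : continuous y -> good y (step y) by move=> /goodex h; exact: (getPex h).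
pose u k := iter k step (fun=> y0).
have cu k : continuous (u k).
  by elim: k => [|k IH]; [move=> t; exact: cvg_cst|case: (stepP _ IH)].
have cuB i j : continuous (fun s => u i s - u j s) by move=> s; apply: cvgB; exact: cu.
have uS k : good (u k) (u k.+1) by exact: stepP.
have u0 k : u k 0 = y0 by case: k => [//|k]; case: (uS k).
have [C C0 hC] := path_bounded (cuB 1%N 0%N).
pose ka := 2 * L + 1; have ka0 : 0 < ka by rewrite /ka; lra.
have p2 k : 0 < 2 ^+ k :> R by rewrite exprn_gt0.
have bk k t : 0 <= t <= T -> `|u k.+1 t - u k t| <= C / 2 ^+ k * expR (ka * t).
  elim: k t => [|k IH] t tT.
    rewrite expr0 divr1; apply: le_trans (hC t tT) _; rewrite ler_peMr//.
    by rewrite -expR0 ler_expR mulr_ge0 ?(ltW ka0)//; case/andP: tT.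
  pose b s := C / 2 ^+ k.+1 * expR (ka * s).
  have db (s : R) : is_derive s 1 b (C / 2 ^+ k.+1 * (ka * expR (ka * s))).
    have := is_deriveM (is_derive_cst (C / 2 ^+ k.+1) s (1 : R)) (is_derive_expRM ka s).
    by move=> h; apply: (is_derive_eq h); rewrite scaler0 addr0.
  have cb : continuous b by move=> s; exact: (is_derive_continuous (db s)).
  have := piecewise_dist_le (e := fun s => u k.+2 s - u k.+1 s)
    (de := fun j s => g j s (u k.+1 s) - g j s (u k s)) (b := b)
    (cuB _ _) cb _ tT.
  move=> H; have {}H := H (fun s => C / 2 ^+ k.+1 * (ka * expR (ka * s))).
  rewrite !u0 subrr subr0 in H; apply: le_trans (H _) _; last first.
    by rewrite /b lerBlDr lerDl mulr_ge0 ?expR_ge0// divr_ge0 ?(ltW (p2 _)).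
  move=> j s jn sj; have [_ _ d2] := uS k.+1; have [_ _ d1] := uS k.
  have sT := piece_itv jn sj.
  split => //; first by apply: is_deriveB; [exact: d2|exact: d1].
  apply: le_trans (lipg _ _ _ _ jn sT) _; apply: le_trans (ler_wpM2l L0 (IH s sT)) _.
  rewrite !mulrA ler_wpM2r ?expR_ge0// exprS invfM.
  rewrite (_ : C * (2^-1 / 2 ^+ k) * ka = (ka / 2) * (C / 2 ^+ k)); last by ring.
  rewrite -mulrA ler_wpM2r ?divr_ge0 ?(ltW (p2 _))//; rewrite /ka; lra.
pose C' := C * expR (ka * T).
have bk' t k : `|u k.+1 (clampR 0 T t) - u k (clampR 0 T t)| <= C' / 2 ^+ k.
  have tT := clampR_itv t T_ge0; apply: le_trans (bk k _ tT) _.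
  rewrite /C' mulrAC ler_wpM2r ?invr_ge0 ?(ltW (p2 _))// ler_wpM2l// ler_expR ler_pM2l//.
  by case/andP: tT.
(* The limit is taken at clamped times, where the rate is uniform; this makes [y] continuous on the
   whole line. *)
pose y t := sval (cid (geo_cvg (bk' t))).
have yP t k : `|y t - u k (clampR 0 T t)| <= 2 * C' / 2 ^+ k.
  by rewrite /y; case: (cid (geo_cvg (bk' t))).
have cy : continuous y.
  move=> t; apply/cvgrPdist_le => eps eps0.
  have e3 : 0 < eps / 3 by rewrite divr_gt0.
  have [k hk] := half_expn_le (2 * C') e3.
  have cuk : continuous (u k \o clampR 0 T).
    move=> s; apply: continuous_comp; [exact: continuous_clampR T_ge0 s|exact: cu].
  near=> s; have h1 := le_trans (yP t k) hk; have h2 := le_trans (yP s k) hk.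
  have h3 : `|u k (clampR 0 T t) - u k (clampR 0 T s)| <= eps / 3.
    by near: s; have /cvgrPdist_le := cuk t; exact.
  rewrite -(subrKA (u k (clampR 0 T t))); apply: le_trans (ler_normD _ _) _.
  rewrite -(subrKA (u k (clampR 0 T s)) (u k (clampR 0 T t))).
  apply: le_trans (lerD h1 (le_trans (ler_normD _ _) (lerD h3 _))) (_ : _ + (_ + eps / 3) <= _).
    by rewrite distrC.
  lra.
(* The differential equation is read off [step y], whose derivative on the pieces is [g j t (y t)]
   by construction; it remains to see that [step y] and [y] agree on [0, T]. *)
have [cz z0 dz] := stepP y cy.
have zy t : 0 <= t <= T -> step y t = y t.
  move=> tT; apply/eqP; rewrite -subr_eq0 -normr_eq0 eq_le normr_ge0 andbT.
  apply/ler_addgt0Pr => eps eps0; rewrite add0r.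
  have [k hk] := half_expn_le ((L * T + 1) * (2 * C')) eps0; apply: le_trans hk.
  pose c := L * (2 * C' / 2 ^+ k).
  have C'0 : 0 <= C' by rewrite mulr_ge0 ?expR_ge0.
  have dc (s : R) : is_derive s 1 (fun s => c * s) c.
    have : is_derive s 1 ( *:%R c) (c *: 1) by apply: is_deriveZ.
    by rewrite [_ *: 1]mulr1.
  have czu : continuous (fun s => step y s - u k.+1 s).
    by move=> s; apply: cvgB; [exact: cz|exact: cu].
  have := piecewise_dist_le (e := fun s => step y s - u k.+1 s)
    (de := fun j s => g j s (y s) - g j s (u k s)) (b := fun s => c * s) (db := fun=> c)
    czu (fun s => is_derive_continuous (dc s)) _ tT.
  rewrite z0 u0 subrr subr0 mulr0 subr0 => H.
  have {}H : `|step y t - u k.+1 t| <= c * t.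
    apply: H => j s jn sj; have [_ _ d1] := uS k; have sT := piece_itv jn sj.
    split => //; first by apply: is_deriveB; [exact: dz|exact: d1].
    apply: le_trans (lipg _ _ _ _ jn sT) _; rewrite ler_wpM2l//.
    by have := yP s k; rewrite clampR_id.
  have h2 : `|y t - u k.+1 t| <= 2 * C' / 2 ^+ k.
    have := yP t k.+1; rewrite clampR_id// => h; apply: le_trans h _.
    by rewrite ler_wpM2l ?mulr_ge0// lef_pV2 ?posrE// exprS ler_peMl ?(ltW (p2 _))// ler1n.
  rewrite -(subrKA (u k.+1 t)); apply: le_trans (ler_normD _ _) _.
  rewrite -[X in _ + X]normrN opprB; apply: le_trans (lerD H h2) _.
  rewrite -[X in _ <= X]mulrA [X in _ <= X]mulrDl mul1r lerD2r /c mulrAC ler_wpM2r//.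
    by rewrite divr_ge0 ?mulr_ge0// ltW.
  by rewrite ler_wpM2l//; case/andP: tT.
exists (step y); split => // j t jn tj; rewrite zy; first exact: dz.
exact: piece_itv jn tj.
Unshelve. all: by end_near. Qed.

(** Compactness of [0, T] turns the neighbourhoods given by joint continuity at the points of the
    orbit into one radius. *)
Lemma tube N m l (Om : set 'cV[R]_N) (f : R -> 'cV[R]_N -> 'M[R]_(m, l)) (phi : R -> 'cV[R]_N) eta :
  open Om -> PCr 0 Om f -> continuous phi -> (forall t, 0 <= t <= T -> Om (phi t)) -> 0 < eta ->
  exists2 rho, 0 < rho & forall t y, 0 <= t <= T -> `|y - phi t| < rho ->
    Om y /\ `|f t y - f t (phi t)| <= eta.
Proof.
move=> oOm fOm cphi Omphi eta0.
pose Q rho t := forall y, `|y - phi t| < rho -> Om y /\ `|f t y - f t (phi t)| <= eta.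
have /compact_near_coveringP H := @segment_compact _ (0 : R) T.
have : \forall rho \near (0 : R)^'+, `[0, T]%classic `<=` Q rho.
  apply: H => t0; rewrite /= in_itv/= => t0T.
  have [[B1 B2] /= [nB1 nB2] BB] := PCr_near t0 fOm (Omphi _ t0T) (divr_gt0 eta0 (ltr0Sn R 1)).
  have : nbhs (phi t0) (Om `&` B2).
    by apply: filterI => //; apply: open_nbhs_nbhs; split => //; exact: Omphi.
  move=> /near_ballP[r r0 hr].
  exists ([set t | B1 t /\ `|phi t - phi t0| < r / 2], [set rho | rho < r / 2]) => /=.
    split; last by apply: nbhs_right_lt; rewrite divr_gt0.
    apply: filterI => //; have /cvgrPdist_lt := cphi t0 => /(_ (r / 2)).
    by rewrite divr_gt0// => /(_ isT); apply: filterS => s; rewrite distrC.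
  move=> [t rho] /= [[B1t tr] rr] y yrho.
  have y_r : `|y - phi t0| < r.
    rewrite -(subrKA (phi t)) [r]splitr; apply: le_lt_trans (ler_normD _ _) _.
    by rewrite ltrD//; exact: lt_trans rr.
  have [Omy B2y] := hr _ y_r.
  have [Omt B2t] : (Om `&` B2) (phi t) by apply: hr; apply: lt_trans tr _; rewrite ltr_pdivrMr// mulr_natr mulr2n ltrDl.
  split=> //; have h1 := BB (_, _) (conj B1t B2y); have h2 := BB (_, _) (conj B1t B2t).
  rewrite /= in h1 h2; rewrite (splitr eta) -(subrKA (f t0 (phi t0))).
  by apply: le_trans (ler_normD _ _) (lerD h1 _); rewrite distrC.
move=> HQ; near (0 : R)^'+ => rho; exists rho => // t y tT.
by have := near HQ rho; apply => //=; rewrite in_itv.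
Unshelve. all: by end_near. Qed.

Lemma uniform_small (k : nat) (Q : nat -> R -> Prop) :
  (forall j rho rho', 0 < rho' -> rho' <= rho -> Q j rho -> Q j rho') ->
  (forall j, (j < k)%N -> exists2 rho, 0 < rho & Q j rho) ->
  exists2 rho, 0 < rho & forall j, (j < k)%N -> Q j rho.
Proof.
move=> mono; elim: k => [|k IH] H; first by exists 1.
have [r1 r10 h1] := IH (fun j jk => H j (ltnW jk)); have [r2 r20 h2] := H k (ltnSn k).
exists (Num.min r1 r2); first by rewrite lt_min r10.
have m0 : 0 < Num.min r1 r2 by rewrite lt_min r10.
move=> j; rewrite ltnS leq_eqVlt => /predU1P[->|jk].
  by apply: mono h2 => //; rewrite ge_min lexx orbT.
by apply: (mono _ _ _ _ _ (h1 j jk)) => //; rewrite ge_min lexx.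
Qed.

Lemma uniform_large (k : nat) (Q : nat -> R -> Prop) :
  (forall j M M', M <= M' -> Q j M -> Q j M') ->
  (forall j, (j < k)%N -> exists M, Q j M) ->
  exists2 M, 0 <= M & forall j, (j < k)%N -> Q j M.
Proof.
move=> mono; elim: k => [|k IH] H; first by exists 0.
have [r1 r10 h1] := IH (fun j jk => H j (ltnW jk)); have [r2 h2] := H k (ltnSn k).
exists (Num.max r1 r2); first by rewrite le_max r10.
move=> j; rewrite ltnS leq_eqVlt => /predU1P[->|jk].
  by apply: mono h2 => //; rewrite le_max lexx orbT.
by apply: (mono _ _ _ _ (h1 j jk)) => //; rewrite le_max lexx.
Qed.

(** The radius is uniform in time. A small [eta] gives the derivative of the flow, [eta] = 1 a
    Lipschitz constant along the orbit. *)
Lemma tube_strict N m l (Om : set 'cV[R]_N) (f : R -> 'cV[R]_N -> 'M[R]_(m, l))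
    (phi : R -> 'cV[R]_N) eta :
  open Om -> PCr 1 Om f -> continuous phi -> (forall t, 0 <= t <= T -> Om (phi t)) -> 0 < eta ->
  exists2 rho, 0 < rho & forall t y y', 0 <= t <= T -> `|y - phi t| < rho -> `|y' - phi t| < rho ->
   Om y /\ `|f t y' - f t y - \sum_i (y' i 0 - y i 0) *: 'D_(ei i) (f t) (phi t)| <= eta * `|y' - y|.
Proof.
move=> oOm fOm cphi Omphi eta0.
have N1 : 0 < N%:R + 1 :> R by rewrite ltr_wpDl.
have e1 : 0 < eta / (N%:R + 1) by rewrite divr_gt0.
have [r1 r10 h1] := tube oOm (PCrS fOm) cphi Omphi ltr01.
have [r2 r20 h2] : exists2 rho, 0 < rho & forall i, (i < N)%N -> forall iN : (i < N)%N, forall t y,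
   0 <= t <= T -> `|y - phi t| < rho ->
   `|'D_(ei (Ordinal iN)) (f t) y - 'D_(ei (Ordinal iN)) (f t) (phi t)| <= eta / (N%:R + 1).
  apply: (uniform_small (Q := fun i rho => forall iN : (i < N)%N, forall t y,
   0 <= t <= T -> `|y - phi t| < rho ->
   `|'D_(ei (Ordinal iN)) (f t) y - 'D_(ei (Ordinal iN)) (f t) (phi t)| <= eta / (N%:R + 1))).
    by move=> j rho rho' _ rr H iN t y tT yr; apply: H => //; exact: lt_le_trans rr.
  move=> i iN; have [rho rho0 h] := tube oOm (PCr_derive (ei (Ordinal iN)) fOm) cphi Omphi e1.
  exists rho => // iN' t y tT yr; rewrite (bool_irrelevance iN' iN).
  exact: (h t y tT yr).2.
exists (Num.min r1 r2); first by rewrite lt_min r10.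
move=> t y y' tT; rewrite !lt_min => /andP[y1 y2] /andP[y'1 y'2].
split; first exact: (h1 t y tT y1).1.
have inb z : `|z - phi t| < Num.min r1 r2 -> Om z.
  by rewrite lt_min => /andP[z1 _]; exact: (h1 t z tT z1).1.
have := @strict_increment _ _ _ _ (f t) (fun i => 'D_(ei i) (f t) (phi t)) (phi t) (Num.min r1 r2)
  (eta / (N%:R + 1)).
move=> H; have {}H := H (fun z i zr => PCr_derivable (p := t) (v := ei i) fOm (inb z zr)).
apply: le_trans (H _ y y' _ _) _.
- move=> z i; rewrite lt_min => /andP[_ z2].
  by case: i => i iN; exact: (h2 i iN iN t z tT z2).
- by rewrite lt_min y1.
- by rewrite lt_min y'1.
- by rewrite ler_wpM2r// mulrA ler_pdivrMr// mulrC ler_wpM2l ?(ltW eta0)// lerDl.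
Qed.

Lemma path_coef_bounded N m l (Om : set 'cV[R]_N) (f : R -> 'cV[R]_N -> 'M[R]_(m, l))
    (phi : R -> 'cV[R]_N) :
  PCr 0 Om f -> continuous phi -> (forall t, 0 <= t <= T -> Om (phi t)) ->
  exists2 M, 0 <= M & forall t, 0 <= t <= T -> `|f t (phi t)| <= M.
Proof.
move=> fOm cphi Omphi.
have c : continuous (fun t => f (clampR 0 T t) (phi (clampR 0 T t))).
  move=> t; have ct := continuous_clampR T_ge0 (x := t).
  apply: (@continuous_comp _ _ _ (fun t => (clampR 0 T t, phi (clampR 0 T t))) (fun q => f q.1 q.2)).
    apply: (continuous_pair (f := clampR 0 T)) => //.
    by apply: (@continuous_comp _ _ _ (clampR 0 T) phi); [exact: ct|exact: cphi].
  by apply: (PCr_cont fOm); apply: Omphi; exact: clampR_itv T_ge0.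
have [M M0 h] := path_bounded c; exists M => // t tT.
by have := h t tT; rewrite clampR_id.
Qed.

Lemma tube_lipschitz N m (Om : set 'cV[R]_N) (f : nat -> R -> 'cV[R]_N -> 'cV[R]_m)
    (phi : R -> 'cV[R]_N) :
  open Om -> (forall j, (j < n)%N -> PCr 1 Om (f j)) -> continuous phi ->
  (forall t, 0 <= t <= T -> Om (phi t)) ->
  exists2 rho, 0 < rho & exists2 L, 0 <= L & forall j t y y', (j < n)%N -> 0 <= t <= T ->
   `|y - phi t| < rho -> `|y' - phi t| < rho -> Om y /\ `|f j t y' - f j t y| <= L * `|y' - y|.
Proof.
move=> oOm fOm cphi Omphi.
have [rho rho0 h] := uniform_small (k := n) (Q := fun j rho => forall t y y', 0 <= t <= T ->
   `|y - phi t| < rho -> `|y' - phi t| < rho -> Om y /\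
   `|f j t y' - f j t y - \sum_i (y' i 0 - y i 0) *: 'D_(ei i) (f j t) (phi t)| <= 1 * `|y' - y|)
  (fun j rho rho' _ rr H t y y' tT yr y'r => H t y y' tT (lt_le_trans yr rr) (lt_le_trans y'r rr))
  (fun j jn => tube_strict oOm (fOm j jn) cphi Omphi ltr01).
have [M M0 hM] : exists2 M, 0 <= M & forall j, (j < n)%N -> forall t, 0 <= t <= T ->
   \sum_i `|'D_(ei i) (f j t) (phi t)| <= M.
  apply: (uniform_large (Q := fun j M => forall t, 0 <= t <= T ->
   \sum_i `|'D_(ei i) (f j t) (phi t)| <= M)).
    by move=> j M M' MM H t tT; exact: le_trans (H t tT) MM.
  move=> j jn; have H (i : 'I_N) : exists M, forall t, 0 <= t <= T -> `|'D_(ei i) (f j t) (phi t)| <= M.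
    by have [M _ hM] := path_coef_bounded (PCr_derive (ei i) (fOm j jn)) cphi Omphi; exists M.
  exists (\sum_i sval (cid (H i))) => t tT; apply: ler_sum => i _.
  by case: (cid (H i)) => M /= /(_ t tT).
exists rho => //; exists (1 + M); first by rewrite addr_ge0.
move=> j t y y' jn tT yr y'r; have [Omy hy] := h j jn t y y' tT yr y'r; split => //.
rewrite mulrDl -lerBlDr; apply: le_trans hy; apply: le_trans (lerB_dist _ _).
rewrite lerD2l lerN2; have := norm_lincomb_le (y' - y) (fun i => 'D_(ei i) (f j t) (phi t)).
under eq_bigr do rewrite !mxE.
move/le_trans; apply; rewrite mulrC ler_wpM2r//; exact: hM.
Qed.

End PiecewiseODE.

(** * Existence, uniqueness and smoothness of the piecewise flow *)

Section Flow.
Context {R : realType} (n : nat) (T : R) (ts : nat -> R).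
Hypothesis ts0 : ts 0%N = 0.
Hypothesis tsn : ts n = T.
Hypothesis tsS : forall j, (j < n)%N -> ts j < ts j.+1.
Hypothesis n_gt0 : (0 < n)%N.
Local Notation T0 := (T_ge0 ts0 tsn tsS).

(* Indices are shifted by one: [f j] is the field on the piece ]ts j, ts j.+1[. *)
Definition psol N (Om : set 'cV[R]_N) (f : nat -> R -> 'cV[R]_N -> 'cV[R]_N) (phi : R -> 'cV[R]_N) :=
  [/\ continuous phi, (forall t, 0 <= t <= T -> Om (phi t)) &
   forall j t, (j < n)%N -> ts j < t < ts j.+1 -> is_derive t 1 phi (f j t (phi t))].

(** The fields are Lipschitz in a tube around [phi1], which [phi2] might leave. Where the orbits are
    at least [rho] apart, boundedness of the fields along both gives a difference of at most M <= (M
    / rho)|e|. The linear inequality thus holds everywhere, and Gronwall applies without a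
    continuation argument. *)
Lemma psol_unique N (Om : set 'cV[R]_N) f phi1 phi2 :
  open Om -> (forall j, (j < n)%N -> PCr 1 Om (f j)) ->
  psol Om f phi1 -> psol Om f phi2 -> phi1 0 = phi2 0 ->
  forall t, 0 <= t <= T -> phi1 t = phi2 t.
Proof.
move=> oOm fOm [c1 O1 d1] [c2 O2 d2] e0 t tT.
have [rho rho0 [L L0 lip]] := tube_lipschitz ts0 tsn tsS oOm fOm c1 O1.
have [M M0 hM] : exists2 M, 0 <= M & forall j, (j < n)%N -> forall t, 0 <= t <= T ->
    `|f j t (phi1 t)| + `|f j t (phi2 t)| <= M.
  apply: (uniform_large (Q := fun j M => forall t, 0 <= t <= T ->
    `|f j t (phi1 t)| + `|f j t (phi2 t)| <= M)).
    by move=> j M M' MM H s sT; exact: le_trans (H s sT) MM.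
  move=> j jn; have f0 := PCrS (fOm j jn).
  have [M1 _ h1] := path_coef_bounded ts0 tsn tsS f0 c1 O1.
  have [M2 _ h2] := path_coef_bounded ts0 tsn tsS f0 c2 O2.
  by exists (M1 + M2) => s sT; rewrite lerD ?h1 ?h2.
pose K := L + M / rho; have K0 : 0 <= K by rewrite addr_ge0// divr_ge0// ltW.
have ce : continuous (fun t => phi1 t - phi2 t) by move=> s; apply: cvgB; [exact: c1|exact: c2].
have := gronwall ts0 tsn tsS (e := fun t => phi1 t - phi2 t)
  (de := fun j s => f j s (phi1 s) - f j s (phi2 s)) K0 (lexx 0) ce.
rewrite e0 subrr normr0 mulr0 addr0 mul0r => H.
have {}H : `|phi1 t - phi2 t| <= 0.
  apply: H => // j s jn sj; first by apply: is_deriveB; [exact: d1|exact: d2].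
  rewrite addr0; have sT := piece_itv ts0 tsn tsS jn sj.
  have [dr|dr] := ltP (`|phi1 s - phi2 s|) rho.
    have r1 : `|phi2 s - phi1 s| < rho by rewrite distrC.
    have r2 : `|phi1 s - phi1 s| < rho by rewrite subrr normr0.
    have [_] := lip j s (phi2 s) (phi1 s) jn sT r1 r2.
    move/le_trans; apply; by rewrite ler_wpM2r// lerDl divr_ge0// ltW.
  apply: le_trans (ler_normB _ _) _; apply: le_trans (hM j jn s sT) _.
  rewrite mulrDl -[M in M <= _]add0r lerD ?mulr_ge0// mulrAC ler_pdivlMr//.
  by rewrite ler_wpM2l.
by apply/eqP; rewrite -subr_eq0 -normr_le0.
Qed.

Definition clipv N rho (v : 'cV[R]_N) : 'cV[R]_N := \col_i clampR (- rho) rho (v i 0).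

Lemma clipv_norm N rho (v : 'cV[R]_N) : 0 <= rho -> `|clipv rho v| <= rho.
Proof.
move=> r0; apply: mx_norm_le => // i j; rewrite mxE ler_norml.
by apply: clampR_itv; rewrite ge0_cp.
Qed.

Lemma clipv_id N rho (v : 'cV[R]_N) : `|v| <= rho -> clipv rho v = v.
Proof.
move=> vr; apply/matrixP => i j; rewrite mxE ord1 clampR_id// -ler_norml.
exact: le_trans (mx_norm_coord _ _ _) vr.
Qed.

Lemma clipv_lip N rho (v w : 'cV[R]_N) : 0 <= rho -> `|clipv rho v - clipv rho w| <= `|v - w|.
Proof.
move=> r0; apply: mx_norm_le => // i j; rewrite !mxE.
have rr : - rho <= rho by rewrite ge0_cp.
apply: le_trans (clampR_lip _ _ rr) _.
by have := mx_norm_coord (v - w) i 0; rewrite !mxE.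
Qed.

Lemma continuous_clipv N rho : 0 <= rho -> continuous (@clipv N rho).
Proof.
move=> r0 x; apply: (@cvg_mx _ _ _ (nbhs_filter x)) => i j; under eq_fun do rewrite mxE; rewrite mxE.
apply: (@continuous_comp _ _ _ (fun v : 'cV[R]_N => v i 0) (clampR (- rho) rho)).
  exact: coord_continuous.
by apply: continuous_clampR; rewrite ge0_cp.
Qed.

(** Truncated outside a tube around [phi], the field becomes globally Lipschitz and [picard]
    applies. Gronwall then keeps the solutions with close initial values inside the tube, where the
    truncation does nothing. *)
Lemma flow_ex N (Om : set 'cV[R]_N) f phi :
  open Om -> (forall j, (j < n)%N -> PCr 1 Om (f j)) -> psol Om f phi ->
  exists2 rho, 0 < rho & exists2 C, 0 <= C & forall x, `|x - phi 0| < rho ->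
    exists psi, [/\ psol Om f psi, psi 0 = x &
      forall t, 0 <= t <= T -> `|psi t - phi t| <= C * `|x - phi 0|].
Proof.
move=> oOm fOm [cphi Ophi dphi].
have [rho rho0 [L L0 lip]] := tube_lipschitz ts0 tsn tsS oOm fOm cphi Ophi.
pose r := rho / 2; have r0 : 0 < r by rewrite divr_gt0.
have r_rho : r < rho by rewrite ltr_pdivrMr// mulr_natr mulr2n ltrDl.
pose pc t := phi (clampR 0 T t).
have cT t := clampR_itv t T0.
pose g j t y := f j t (pc t + clipv r (y - pc t)).
have inb t y : `|pc t + clipv r (y - pc t) - phi (clampR 0 T t)| < rho.
  by rewrite addrAC subrr add0r; apply: le_lt_trans (clipv_norm _ (ltW r0)) r_rho.
have cpc : continuous pc.
  by move=> t; apply: (@continuous_comp _ _ _ (clampR 0 T) phi); [exact: continuous_clampR T0 t|exact: cphi].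
have cg j (y : R -> 'cV[R]_N) : (j < n)%N -> continuous y -> continuous (fun t => g j t (y t)).
  move=> jn cy t.
  apply: (@continuous_comp _ _ _ (fun t => (t, pc t + clipv r (y t - pc t))) (fun q => f j q.1 q.2)).
    apply: (continuous_pair (f := id)); first exact: cvg_id.
    apply: cvgD; first exact: cpc.
    apply: (@continuous_comp _ _ _ (fun t => y t - pc t) (clipv r)).
      by apply: cvgB; [exact: cy|exact: cpc].
    exact: continuous_clipv (ltW r0) _.
  apply: (PCr_cont (fOm j jn)).
  exact: (lip j _ _ _ jn (cT t) (inb t (y t)) (inb t (y t))).1.
have lg j t y y' : (j < n)%N -> 0 <= t <= T -> `|g j t y' - g j t y| <= L * `|y' - y|.
  move=> jn tT; have pE : clampR 0 T t = t by rewrite clampR_id.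
  have [_ h] := lip j _ _ _ jn (cT t) (inb t y) (inb t y').
  rewrite pE in h; apply: le_trans h _; rewrite ler_wpM2l//.
  rewrite opprD addrACA subrr add0r; apply: le_trans (clipv_lip _ _ (ltW r0)) _.
  by rewrite opprB addrA subrK.
pose C := N%:R * expR (N%:R * (L + 1) * T).
have C0 : 0 <= C by rewrite mulr_ge0// expR_ge0.
have C1 : 0 < C + 1 by rewrite ltr_wpDl.
exists (r / (C + 1)); first by rewrite divr_gt0.
exists C => // x xr.
have [psi [cpsi psi0 dpsi]] := picard ts0 tsn tsS x L0 cg lg.
have gphi j t : 0 <= t <= T -> g j t (phi t) = f j t (phi t).
  move=> tT; rewrite /g /pc clampR_id// subrr clipv_id ?addr0//.
  by rewrite normr0 ltW.
have ce : continuous (fun t => psi t - phi t) by move=> s; apply: cvgB; [exact: cpsi|exact: cphi].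
have B t : 0 <= t <= T -> `|psi t - phi t| <= C * `|x - phi 0|.
  move=> tT; have := gronwall ts0 tsn tsS (e := fun t => psi t - phi t)
    (de := fun j s => g j s (psi s) - g j s (phi s)) L0 (lexx 0) ce.
  rewrite psi0 addr0 /C mulrAC; apply => // j s jn sj.
    apply: is_deriveB; first exact: dpsi.
    by rewrite gphi; [exact: dphi|exact: piece_itv jn sj].
  by rewrite addr0; apply: lg => //; exact: piece_itv jn sj.
have Br t : 0 <= t <= T -> `|psi t - phi t| <= r.
  move=> tT; apply: le_trans (B t tT) _; apply: le_trans (ler_wpM2l C0 (ltW xr)) _.
  by rewrite mulrCA ger_pMr// ler_pdivrMr// mul1r lerDl.
have gpsi j t : 0 <= t <= T -> g j t (psi t) = f j t (psi t).
  by move=> tT; rewrite /g /pc clampR_id// clipv_id ?Br// addrC subrK.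
exists psi; split => //; split => // [t tT|j t jn tj].
  apply: (lip 0%N t (psi t) (psi t) n_gt0 tT _ _).1; exact: le_lt_trans (Br t tT) r_rho.
by rewrite -gpsi; [exact: dpsi|exact: piece_itv jn tj].
Qed.

(** [Phi] is any selection of orbits, not a constructed map: uniqueness determines it on [0, T],
    where its smoothness is studied. *)
Definition flow_family N (Om : set 'cV[R]_N) f (A : set 'cV[R]_N) (Phi : 'cV[R]_N -> R -> 'cV[R]_N) :=
  forall x, A x -> psol Om f (Phi x) /\ Phi x 0 = x.

Lemma flow_family_lip N (Om : set 'cV[R]_N) f A Phi x :
  open Om -> open A -> (forall j, (j < n)%N -> PCr 1 Om (f j)) -> flow_family Om f A Phi -> A x ->
  exists2 rho, 0 < rho & exists2 C, 0 <= C & forall y, `|y - x| < rho ->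
    A y /\ forall t, 0 <= t <= T -> `|Phi y t - Phi x t| <= C * `|y - x|.
Proof.
move=> oOm oA fOm fam Ax; have [solx x0] := fam x Ax.
have [r1 r10 [C C0 h]] := flow_ex oOm fOm solx.
have [r2 r20 h2] := (near_ballP _ _).1 (open_nbhs_nbhs (conj oA Ax)).
exists (Num.min r1 r2); first by rewrite lt_min r10.
exists C => // y; rewrite lt_min => /andP[y1 y2]; have Ay := h2 y y2; split=> // t tT.
rewrite -x0 in y1; have [psi [solpsi psi0 B]] := h y y1; have [soly yE] := fam y Ay.
rewrite -[X in _ * `|_ - X|]x0 (psol_unique oOm fOm soly solpsi) ?psi0//; exact: B.
Qed.

Lemma linear_ode N (a : nat -> R -> 'I_N -> 'cV[R]_N) (h : nat -> R -> 'cV[R]_N) v :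
  (forall j i, (j < n)%N -> continuous (fun t => a j t i)) ->
  (forall j, (j < n)%N -> continuous (h j)) ->
  exists w : R -> 'cV[R]_N, [/\ continuous w, w 0 = v &
    forall j t, (j < n)%N -> ts j < t < ts j.+1 ->
      is_derive t 1 w (\sum_i w t i 0 *: a j t i + h j t)].
Proof.
move=> ca ch.
have [M M0 hM] : exists2 M, 0 <= M & forall j, (j < n)%N -> forall t, 0 <= t <= T ->
   \sum_i `|a j t i| <= M.
  apply: (uniform_large (Q := fun j M => forall t, 0 <= t <= T -> \sum_i `|a j t i| <= M)).
    by move=> j M M' MM H t tT; exact: le_trans (H t tT) MM.
  move=> j jn; have H (i : 'I_N) : exists M, forall t, 0 <= t <= T -> `|a j t i| <= M.
    by have [M _ hM] := path_bounded ts0 tsn tsS (ca j i jn); exists M.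
  exists (\sum_i sval (cid (H i))) => t tT; apply: ler_sum => i _.
  by case: (cid (H i)) => M /= /(_ t tT).
apply: (@picard _ _ _ _ ts0 tsn tsS _ (fun j t w => \sum_i w i 0 *: a j t i + h j t) M) => //.
- move=> j y jn cy t; apply: cvgD; last exact: ch.
  apply: cvg_sumr => i _; apply: cvgZ; last exact: ca.
  by apply: cvg_mx_coord; exact: cy.
- move=> j t y y' jn tT; rewrite opprD addrACA subrr addr0 -sumrB.
  have := norm_lincomb_le (y' - y) (a j t).
  under eq_bigr do rewrite !mxE scalerBl.
  by move/le_trans; apply; rewrite mulrC ler_wpM2r// hM.
Qed.

Lemma continuous_path_coef N m (Om : set 'cV[R]_N) (f : R -> 'cV[R]_N -> 'cV[R]_m)
   (phi : R -> 'cV[R]_N) : PCr 0 Om f -> continuous phi -> (forall t, 0 <= t <= T -> Om (phi t)) ->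
  continuous (fun t => f t (phi (clampR 0 T t))).
Proof.
move=> fOm cphi Omphi t.
apply: (@continuous_comp _ _ _ (fun t => (t, phi (clampR 0 T t))) (fun q => f q.1 q.2)).
  apply: (continuous_pair (f := id)); first exact: cvg_id.
  by apply: (@continuous_comp _ _ _ (clampR 0 T) phi); [exact: continuous_clampR T0 t|exact: cphi].
by apply: (PCr_cont fOm); apply: Omphi; exact: clampR_itv T0.
Qed.

Definition var_sol N (f : nat -> R -> 'cV[R]_N -> 'cV[R]_N) (phi : R -> 'cV[R]_N) v (w : R -> 'cV[R]_N) :=
  [/\ continuous w, w 0 = v & forall j t, (j < n)%N -> ts j < t < ts j.+1 ->
      is_derive t 1 w (\sum_i w t i 0 *: 'D_(ei i) (f j t) (phi t))].

Lemma var_sol_ex N (Om : set 'cV[R]_N) f phi v :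
  (forall j, (j < n)%N -> PCr 1 Om (f j)) -> psol Om f phi -> exists w, var_sol f phi v w.
Proof.
move=> fOm [cphi Omphi _].
have [w [cw w0 dw]] := @linear_ode N (fun j t i => 'D_(ei i) (f j t) (phi (clampR 0 T t)))
  (fun=> cst 0) v (fun j i jn => continuous_path_coef (PCr_derive (ei i) (fOm j jn)) cphi Omphi)
  (fun j jn t => @cvg_cst _ _ _ _ _).
exists w; split=> // j t jn tj; have := dw j t jn tj.
by rewrite addr0 clampR_id//; exact: piece_itv jn tj.
Qed.

(** The defect Phi(x + hv) - Phi(x) - hw satisfies a linear differential inequality whose
    inhomogeneous term is eta C |h||v|, by strict differentiability of the fields along the orbit;
    Gronwall bounds it by a multiple of eta |h|. *)
Lemma flow_derive N (Om : set 'cV[R]_N) f A Phi x v w :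
  open Om -> open A -> (forall j, (j < n)%N -> PCr 1 Om (f j)) -> flow_family Om f A Phi -> A x ->
  var_sol f (Phi x) v w -> forall t, 0 <= t <= T -> is_derive x v (fun y => Phi y t) (w t).
Proof.
move=> oOm oA fOm fam Ax [cw w0 dw] t tT; have [[cx Ox dx] x0] := fam x Ax.
have [r1 r10 [C C0 hC]] := flow_family_lip oOm oA fOm fam Ax.
have [M M0 hM] : exists2 M, 0 <= M & forall j, (j < n)%N -> forall s, 0 <= s <= T ->
   \sum_i `|'D_(ei i) (f j s) (Phi x s)| <= M.
  apply: (uniform_large (Q := fun j M => forall s, 0 <= s <= T ->
   \sum_i `|'D_(ei i) (f j s) (Phi x s)| <= M)).
    by move=> j M M' MM H s sT; exact: le_trans (H s sT) MM.
  move=> j jn; have H (i : 'I_N) : exists M, forall s, 0 <= s <= T -> `|'D_(ei i) (f j s) (Phi x s)| <= M.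
    by have [M _ hM] := path_coef_bounded ts0 tsn tsS (PCr_derive (ei i) (fOm j jn)) cx Ox; exists M.
  exists (\sum_i sval (cid (H i))) => s sT; apply: ler_sum => i _.
  by case: (cid (H i)) => M /= /(_ s sT).
suff H : (fun h : R => h^-1 *: (Phi (h *: v + x) t - Phi x t)) @ 0^' --> w t.
  by apply: DeriveDef; [apply/cvg_ex; exists (w t)|exact: cvg_lim].
apply/cvgrPdist_le => eps eps0.
pose E := expR (N%:R * (M + 1) * T); have E0 : 0 < E by exact: expR_gt0.
pose B := C * `|v| * E + 1; have B0 : 0 < B by rewrite ltr_wpDl// !mulr_ge0// ltW.
pose eta := eps / B; have eta0 : 0 < eta by rewrite divr_gt0.
have [r2 r20 h2] := uniform_small (k := n) (Q := fun j rho => forall s y y', 0 <= s <= T ->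
   `|y - Phi x s| < rho -> `|y' - Phi x s| < rho -> Om y /\
   `|f j s y' - f j s y - \sum_i (y' i 0 - y i 0) *: 'D_(ei i) (f j s) (Phi x s)| <= eta * `|y' - y|)
  (fun j rho rho' _ rr H t y y' tT yr y'r => H t y y' tT (lt_le_trans yr rr) (lt_le_trans y'r rr))
  (fun j jn => tube_strict oOm (fOm j jn) cx Ox eta0).
have V1 : 0 < `|v| + 1 by rewrite ltr_wpDl.
have C1 : 0 < C + 1 by rewrite ltr_wpDl.
near=> h.
have hn0 : h != 0 by near: h; exact: nbhs_dnbhs_neq.
have : `|h| < Num.min r1 (r2 / (C + 1)) / (`|v| + 1).
  near: h; apply: dnbhs0_lt; apply: divr_gt0 => //.
  by rewrite lt_min r10/= divr_gt0.
rewrite ltr_pdivlMr// lt_min => /andP[]; set d := `|h| * `|v|.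
have dd : d <= `|h| * (`|v| + 1) by rewrite ler_wpM2l// lerDl.
move=> /(le_lt_trans dd) dr1 /(le_lt_trans dd); rewrite ltr_pdivlMr// => dr2.
have d0 : 0 <= d by rewrite mulr_ge0.
have yx : `|h *: v + x - x| = d by rewrite addrK normrZ.
have [Ay hy] := hC (h *: v + x) (eq_ind_r (fun z => z < r1) dr1 yx).
have [[cy Oy dy] y0] := fam _ Ay; set y := h *: v + x in Ay hy cy Oy dy y0 yx *.
rewrite yx in hy.
have hy2 s : 0 <= s <= T -> `|Phi y s - Phi x s| < r2.
  by move=> sT; apply: le_lt_trans (hy s sT) _; apply: le_lt_trans dr2; rewrite mulrC ler_wpM2l// lerDl.
pose e s := Phi y s - Phi x s - h *: w s.
pose de j s := f j s (Phi y s) - f j s (Phi x s) - h *: \sum_i w s i 0 *: 'D_(ei i) (f j s) (Phi x s).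
have ce : continuous e.
  move=> s; apply: cvgB; first by apply: cvgB; [exact: cy|exact: cx].
  by apply: cvgZr; exact: cw.
have cc : 0 <= eta * (C * d) by rewrite mulr_ge0 ?(ltW eta0)// mulr_ge0.
have := gronwall ts0 tsn tsS M0 cc ce (de := de).
have -> : e 0 = 0 by rewrite /e y0 x0 w0 addrK subrr.
rewrite normr0 mulr0 add0r => H; have {}H : `|e t| <= eta * (C * d) * E.
  apply: H => // j s jn sj; have sT := piece_itv ts0 tsn tsS jn sj.
    apply: is_deriveB; first by apply: is_deriveB; [exact: dy|exact: dx].
    by apply: is_deriveZ; exact: dw.
  have xr : `|Phi x s - Phi x s| < r2 by rewrite subrr normr0.
  have [_ k1] := h2 j jn s _ _ sT xr (hy2 s sT).
  have -> : de j s = (f j s (Phi y s) - f j s (Phi x s) -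
      \sum_i (Phi y s i 0 - Phi x s i 0) *: 'D_(ei i) (f j s) (Phi x s)) +
      \sum_i e s i 0 *: 'D_(ei i) (f j s) (Phi x s).
    rewrite /de -[RHS]addrA; congr (_ + _); rewrite scaler_sumr -!sumrN -big_split/=.
    apply: eq_bigr => i _; rewrite scalerA -!scaleNr -scalerDl; congr (_ *: _).
    by rewrite /e !mxE [LHS]mulNr; lra.
  rewrite addrC; apply: le_trans (ler_normD _ _) _; apply: lerD.
    apply: le_trans (norm_lincomb_le _ _) _; rewrite mulrC ler_wpM2r//; exact: hM.
  by apply: le_trans k1 _; rewrite ler_wpM2l ?(ltW eta0)// hy.
have -> : w t - h^-1 *: (Phi y t - Phi x t) = - (h^-1 *: e t).
  by rewrite /e [in RHS]scalerBr scalerA mulVf// scale1r opprB.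
rewrite normrN normrZ normfV ler_pdivrMl ?normr_gt0//; apply: le_trans H _.
rewrite (_ : eta * (C * d) * E = `|h| * (eta * (C * `|v| * E))); last by rewrite /d; ring.
rewrite ler_wpM2l// /eta mulrAC ler_pdivrMr// ler_wpM2l ?(ltW eps0)// /B lerDl.
exact: ler01.
Unshelve. all: by end_near. Qed.

Lemma continuous_distI (X : topologicalType) m l (f : X -> 'M[R]_(m, l)) x :
  (forall eps, 0 < eps -> \forall y \near x, `|f y - f x| <= eps) -> {for x, continuous f}.
Proof.
move=> H; apply/cvgrPdist_le => eps /H; apply: filterS => y; by rewrite distrC.
Qed.

(** Base case of the smoothness of the flow. For C^1 fields the coefficients of the variational
    equation are merely continuous in space, so continuity in the initial point is a Gronwall
    estimate for two linear equations with uniformly close coefficients. *)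
Lemma var_sol_continuous N (Om : set 'cV[R]_N) f A Phi v W x t :
  open Om -> open A -> (forall j, (j < n)%N -> PCr 1 Om (f j)) -> flow_family Om f A Phi ->
  (forall y, A y -> var_sol f (Phi y) v (W y)) -> A x -> 0 <= t <= T ->
  {for x, continuous (fun y => W y t)}.
Proof.
move=> oOm oA fOm fam vW Ax tT; have [[cx Ox dx] x0] := fam x Ax.
have [cw w0 dw] := vW x Ax.
have [r1 r10 [C C0 hC]] := flow_family_lip oOm oA fOm fam Ax.
have [M M0 hM] : exists2 M, 0 <= M & forall j, (j < n)%N -> forall s, 0 <= s <= T ->
   \sum_i `|'D_(ei i) (f j s) (Phi x s)| <= M.
  apply: (uniform_large (Q := fun j M => forall s, 0 <= s <= T ->
   \sum_i `|'D_(ei i) (f j s) (Phi x s)| <= M)).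
    by move=> j M M' MM H s sT; exact: le_trans (H s sT) MM.
  move=> j jn; have H (i : 'I_N) : exists M, forall s, 0 <= s <= T -> `|'D_(ei i) (f j s) (Phi x s)| <= M.
    by have [M _ hM] := path_coef_bounded ts0 tsn tsS (PCr_derive (ei i) (fOm j jn)) cx Ox; exists M.
  exists (\sum_i sval (cid (H i))) => s sT; apply: ler_sum => i _.
  by case: (cid (H i)) => M /= /(_ s sT).
have [MW MW0 hMW] := path_bounded ts0 tsn tsS cw.
pose L := M + N%:R; have L0 : 0 <= L by rewrite addr_ge0.
pose E := expR (N%:R * (L + 1) * T); have E0 : 0 < E by exact: expR_gt0.
pose B := MW * N%:R * E + 1; have B0 : 0 < B by rewrite ltr_wpDl// !mulr_ge0// ltW.
apply: continuous_distI => eps eps0.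
(* The bound 1 keeps the coefficients along the nearby orbit below [L], and [eps / B] makes the
   final estimate at most [eps]. *)
pose eta := Num.min 1 (eps / B); have eta0 : 0 < eta by rewrite lt_min ltr01 divr_gt0.
have [r2 r20 h2] : exists2 r2, 0 < r2 & forall j, (j < n)%N -> forall i : 'I_N, forall s z,
    0 <= s <= T -> `|z - Phi x s| < r2 ->
    `|'D_(ei i) (f j s) z - 'D_(ei i) (f j s) (Phi x s)| <= eta.
  apply: (uniform_small (Q := fun j r2 => forall i : 'I_N, forall s z,
    0 <= s <= T -> `|z - Phi x s| < r2 ->
    `|'D_(ei i) (f j s) z - 'D_(ei i) (f j s) (Phi x s)| <= eta)).
    by move=> j rho rho' _ rr H i s z sT zr; apply: H => //; exact: lt_le_trans rr.
  move=> j jn.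
  have [r r0 h] : exists2 r, 0 < r & forall k, (k < N)%N -> forall i : 'I_N, i = k :> nat ->
    forall s z, 0 <= s <= T -> `|z - Phi x s| < r ->
    `|'D_(ei i) (f j s) z - 'D_(ei i) (f j s) (Phi x s)| <= eta.
    apply: (uniform_small (Q := fun k r => forall i : 'I_N, i = k :> nat ->
      forall s z, 0 <= s <= T -> `|z - Phi x s| < r ->
      `|'D_(ei i) (f j s) z - 'D_(ei i) (f j s) (Phi x s)| <= eta)).
      by move=> k rho rho' _ rr H i ik s z sT zr; apply: H => //; exact: lt_le_trans rr.
    move=> k kN; have [r r0 h] := tube oOm (PCr_derive (ei (Ordinal kN)) (fOm j jn)) cx Ox eta0.
    exists r => // i ik s z sT zr; have -> : i = Ordinal kN by exact: val_inj.
    exact: (h s z sT zr).2.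
  by exists r => // i s z; exact: (h i (ltn_ord i) i).
have C1 : 0 < C + 1 by rewrite ltr_wpDl.
have : \forall y \near x, `|y - x| < Num.min r1 (r2 / (C + 1)).
  by apply/near_ballP; exists (Num.min r1 (r2 / (C + 1))) => //; rewrite lt_min r10/= divr_gt0.
apply: filterS => y; rewrite lt_min ltr_pdivlMr// => /andP[yr1 yr2].
have [Ay hy] := hC y yr1; have [cwy w0y dwy] := vW y Ay.
have hy2 s : 0 <= s <= T -> `|Phi y s - Phi x s| < r2.
  by move=> sT; apply: le_lt_trans (hy s sT) _; apply: le_lt_trans yr2; rewrite mulrC ler_wpM2l// lerDl.
pose de j s := \sum_i W y s i 0 *: 'D_(ei i) (f j s) (Phi y s)
  - \sum_i W x s i 0 *: 'D_(ei i) (f j s) (Phi x s).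
have ce : continuous (fun s => W y s - W x s) by move=> s; apply: cvgB; [exact: cwy|exact: cw].
have cc : 0 <= MW * (N%:R * eta) by rewrite mulr_ge0// mulr_ge0// ltW.
have := gronwall ts0 tsn tsS L0 cc ce (de := de).
rewrite w0y w0 subrr normr0 mulr0 add0r => H.
have {}H : `|W y t - W x t| <= MW * (N%:R * eta) * E.
  apply: H => // j s jn sj; have sT := piece_itv ts0 tsn tsS jn sj.
    by apply: is_deriveB; [exact: dwy|exact: dw].
  have -> : de j s = \sum_i (W y s - W x s) i 0 *: 'D_(ei i) (f j s) (Phi y s) +
     \sum_i W x s i 0 *: ('D_(ei i) (f j s) (Phi y s) - 'D_(ei i) (f j s) (Phi x s)).
    rewrite /de -sumrB -big_split/=; apply: eq_bigr => i _.
    by rewrite !mxE scalerBl scalerBr addrA subrK.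
  have b1 : \sum_i `|'D_(ei i) (f j s) (Phi y s) - 'D_(ei i) (f j s) (Phi x s)| <= N%:R * eta.
    rewrite -[N in leRHS]card_ord mulr_natl -sumr_const; apply: ler_sum => i _.
    by apply: h2 => //; exact: hy2.
  apply: le_trans (ler_normD _ _) _; apply: lerD.
    apply: le_trans (norm_lincomb_le _ _) _; rewrite mulrC ler_wpM2r//.
    apply: (@le_trans _ _ (\sum_i (`|'D_(ei i) (f j s) (Phi x s)| +
        `|'D_(ei i) (f j s) (Phi y s) - 'D_(ei i) (f j s) (Phi x s)|))).
      apply: ler_sum => i _; rewrite -lerBlDl; exact: lerB_dist.
    rewrite big_split/=; apply: lerD (hM j jn s sT) _; apply: le_trans b1 _.
    by rewrite ler_piMr// ge_min lexx.
  apply: le_trans (norm_lincomb_le _ _) _; apply: ler_pM => //; last exact: hMW.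
  exact: sumr_ge0.
apply: le_trans H _.
apply: (@le_trans _ _ (MW * N%:R * E * (eps / B))).
  rewrite (_ : MW * (N%:R * eta) * E = MW * N%:R * E * eta); last by ring.
  by rewrite ler_wpM2l ?mulr_ge0 ?(ltW E0)// ge_min lexx orbT.
by rewrite mulrA ler_pdivrMr// mulrC ler_wpM2l ?(ltW eps0)// /B lerDl.
Qed.

Lemma flow_continuous N (Om : set 'cV[R]_N) f A Phi x t :
  open Om -> open A -> (forall j, (j < n)%N -> PCr 1 Om (f j)) -> flow_family Om f A Phi ->
  A x -> 0 <= t <= T -> {for x, continuous (fun y => Phi y t)}.
Proof.
move=> oOm oA fOm fam Ax tT.
have [r1 r10 [C C0 hC]] := flow_family_lip oOm oA fOm fam Ax.
have C1 : 0 < C + 1 by rewrite ltr_wpDl.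
apply: continuous_distI => eps eps0.
have : \forall y \near x, `|y - x| < Num.min r1 (eps / (C + 1)).
  by apply/near_ballP; exists (Num.min r1 (eps / (C + 1))) => //; rewrite lt_min r10/= divr_gt0.
apply: filterS => y; rewrite lt_min ltr_pdivlMr// => /andP[yr1 yr2].
apply: le_trans ((hC y yr1).2 t tT) _; apply: le_trans (ltW yr2).
by rewrite mulrC ler_wpM2l// lerDl.
Qed.

Lemma PCr_coord (P : topologicalType) (U : normedModType R) m l r (A : set U)
    (f : P -> U -> 'M[R]_(m, l)) i j : open A -> PCr r A f -> PCr r A (fun p x => f p x i j).
Proof. by move=> oA /PCr_mxP; exact. Qed.

Lemma PCr_col_mx (P : topologicalType) (U : normedModType R) m1 m2 r (A : set U)
    (f1 : P -> U -> 'cV[R]_m1) (f2 : P -> U -> 'cV[R]_m2) : open A ->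
  PCr r A f1 -> PCr r A f2 -> PCr r A (fun p x => col_mx (f1 p x) (f2 p x)).
Proof.
move=> oA /PCr_mxP h1 /PCr_mxP h2; apply/PCr_mxP => // i j.
case: (split_ordP i) => k ->.
  by apply: PCr_ext (h1 oA k j) => // p x _; rewrite col_mxEu.
by apply: PCr_ext (h2 oA k j) => // p x _; rewrite col_mxEd.
Qed.

Lemma lin_like_usubmx m1 m2 : lin_like (usubmx : 'cV[R]_(m1 + m2) -> 'cV[R]_m1).
Proof.
split=> [x|h x v]; last by apply/matrixP => i j; rewrite !mxE.
apply: (@cvg_mx _ _ _ (nbhs_filter x)) => i j; under eq_fun do rewrite mxE; rewrite mxE.
exact: coord_continuous.
Qed.

Lemma lin_like_dsubmx m1 m2 : lin_like (dsubmx : 'cV[R]_(m1 + m2) -> 'cV[R]_m2).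
Proof.
split=> [x|h x v]; last by apply/matrixP => i j; rewrite !mxE.
apply: (@cvg_mx _ _ _ (nbhs_filter x)) => i j; under eq_fun do rewrite mxE; rewrite mxE.
exact: coord_continuous.
Qed.

Lemma lin_like_coord m l i j : lin_like (fun x : 'M[R]_(m, l) => x i j).
Proof. by split=> [x|h x v]; [exact: coord_continuous|rewrite !mxE]. Qed.

Lemma continuous_col_mx (X : topologicalType) m1 m2 (f1 : X -> 'cV[R]_m1) (f2 : X -> 'cV[R]_m2) x :
  {for x, continuous f1} -> {for x, continuous f2} ->
  {for x, continuous (fun y => col_mx (f1 y) (f2 y))}.
Proof.
move=> c1 c2; apply: (@cvg_mx _ _ _ (nbhs_filter x)) => i j.
case: (split_ordP i) => k ->.
  rewrite col_mxEu; under eq_fun do rewrite col_mxEu; exact: cvg_mx_coord.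
rewrite col_mxEd; under eq_fun do rewrite col_mxEd; exact: cvg_mx_coord.
Qed.

Lemma is_derive_col_mx (V : normedModType R) m1 m2 (f1 : V -> 'cV[R]_m1) (f2 : V -> 'cV[R]_m2)
    x v d1 d2 : is_derive x v f1 d1 -> is_derive x v f2 d2 ->
  is_derive x v (fun y => col_mx (f1 y) (f2 y)) (col_mx d1 d2).
Proof.
move=> h1 h2; apply: is_derive_mx => i j; case: (split_ordP i) => k ->.
  rewrite col_mxEu (_ : (fun y => _) = (fun y => f1 y k j)); first exact: is_derive_coord.
  by apply/funext => y; rewrite col_mxEu.
rewrite col_mxEd (_ : (fun y => _) = (fun y => f2 y k j)); first exact: is_derive_coord.
by apply/funext => y; rewrite col_mxEd.
Qed.

Lemma open_lin_preimage (U W : normedModType R) (L : U -> W) (B : set W) :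
  lin_like L -> open B -> open [set x | B (L x)].
Proof. by move=> [cL _] oB; apply: (open_comp (f := L)) => // x _; exact: cL. Qed.

Lemma flow_variation N (Om : set 'cV[R]_N) f A Phi :
  open Om -> open A -> (forall j, (j < n)%N -> PCr 1 Om (f j)) -> flow_family Om f A Phi ->
  exists W : 'cV[R]_N -> 'cV[R]_N -> R -> 'cV[R]_N,
  (forall y v, A y -> var_sol f (Phi y) v (W y v)) /\
  (forall y v t, A y -> 0 <= t <= T -> is_derive y v (fun z => Phi z t) (W y v t)).
Proof.
move=> oOm oA fOm fam; pose W y v := get [set w | var_sol f (Phi y) v w].
have hW y v : A y -> var_sol f (Phi y) v (W y v).
  by move=> Ay; exact: (getPex (var_sol_ex v fOm (fam y Ay).1)).
exists W; split=> // y v t Ay tT; exact: (flow_derive oOm oA fOm fam Ay (hW y v Ay) tT).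
Qed.

(** An orbit together with its variational solution is an orbit of a system of twice the dimension,
    with fields one order less smooth; the derivative of the flow along [v] is the second block of
    that flow at [col_mx x v]. The dimension is therefore quantified inside the induction. *)
Lemma flow_PCr r : forall N (Om : set 'cV[R]_N) f A Phi t,
  open Om -> open A -> (forall j, (j < n)%N -> PCr r.+1 Om (f j)) -> flow_family Om f A Phi ->
  0 <= t <= T -> PCr r.+1 A (fun (_ : R) x => Phi x t).
Proof.
elim: r => [|r IH] N Om f A Phi t oOm oA fOm fam tT.
  have [W [hW dW]] := flow_variation oOm oA fOm fam.
  have dP x v Ax := dW x v t Ax tT.
  apply: PCrSI.
  - move=> p x Ax; apply: (@continuous_comp _ _ _ snd (fun y => Phi y t)); first exact: cvg_snd.
    exact: (flow_continuous oOm oA fOm fam Ax tT).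
  - by move=> _ x v Ax; case: (dP x v Ax).
  - move=> v; split=> // p x Ax; apply: (@continuous_near_eq _ _ (fun q : R * _ => W q.2 v t)).
      by apply: filterS (near_snd p oA Ax) => q Aq; case: (dP q.2 v Aq).
    apply: (@continuous_comp _ _ _ snd (fun y => W y v t)); first exact: cvg_snd.
    exact: (var_sol_continuous oOm oA fOm fam (fun y Ay => hW y v Ay) Ax tT).
have f1 j (jn : (j < n)%N) : PCr 1 Om (f j) := PCr_le (isT : (1 <= r.+2)%N) (fOm j jn).
have [W [hW dW]] := flow_variation oOm oA f1 fam.
have dP x v Ax := dW x v t Ax tT.
apply: PCrSI.
- move=> p x Ax; apply: (@continuous_comp _ _ _ snd (fun y => Phi y t)); first exact: cvg_snd.
  exact: (flow_continuous oOm oA f1 fam Ax tT).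
- by move=> _ x v Ax; case: (dP x v Ax).
move=> v.
pose Om2 : set 'cV[R]_(N + N) := [set s | Om (usubmx s)].
pose A2 : set 'cV[R]_(N + N) := [set s | A (usubmx s)].
have oOm2 : open Om2 by apply: open_lin_preimage oOm; exact: lin_like_usubmx.
have oA2 : open A2 by apply: open_lin_preimage oA; exact: lin_like_usubmx.
pose g j t (s : 'cV[R]_(N + N)) := col_mx (f j t (usubmx s))
  (\sum_i (dsubmx s) i 0 *: 'D_(ei i) (f j t) (usubmx s)).
pose Phi2 (s : 'cV[R]_(N + N)) t := col_mx (Phi (usubmx s) t) (W (usubmx s) (dsubmx s) t).
have gOm2 j : (j < n)%N -> PCr r.+1 Om2 (g j).
  move=> jn; have lu : PCr r.+1 Om2 (fun _ : R => usubmx) := PCr_lin _ _ _ (lin_like_usubmx N N).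
  have ld : PCr r.+1 Om2 (fun _ : R => dsubmx) := PCr_lin _ _ _ (lin_like_dsubmx N N).
  have ldi i : PCr r.+1 Om2 (fun (_ : R) s => dsubmx s i 0) := PCr_coord i 0 oOm2 ld.
  have u1 : PCr r.+1 Om2 (fun t s => f j t (usubmx s)).
    by apply: (PCr_comp oOm2 oOm _ (PCrS (fOm j jn)) lu).
  have u2 i : PCr r.+1 Om2 (fun t s => 'D_(ei i) (f j t) (usubmx s)).
    by apply: (PCr_comp (f := fun t => 'D_(ei i) (f j t)) oOm2 oOm _ (PCr_derive (ei i) (fOm j jn)) lu).
  apply: (PCr_col_mx oOm2 u1).
  exact: (PCr_sum (f := fun i t s => dsubmx s i 0 *: 'D_(ei i) (f j t) (usubmx s)) _ oOm2
    (fun i _ => PCrZ oOm2 (ldi i) (u2 i))).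
have fam2 : flow_family Om2 g A2 Phi2.
  move=> s As; have [[cP OP dp] P0] := fam _ As; have [cw w0 dw] := hW _ (dsubmx s) As.
  split; last by rewrite /Phi2 P0 w0 vsubmxK.
  split.
  - by move=> u; apply: continuous_col_mx; [exact: cP|exact: cw].
  - by move=> u uT; rewrite /Om2 /= /Phi2 col_mxKu; exact: OP.
  - move=> j u jn uj; rewrite /g /Phi2 col_mxKu col_mxKd.
    by apply: is_derive_col_mx; [exact: dp|exact: dw].
have H := IH _ _ _ _ _ t oOm2 oA2 gOm2 fam2 tT.
have c1 : PCr r.+1 A (fun (_ : R) x => col_mx x v).
  apply: PCr_col_mx oA _ (PCr_cst _ _ _ _).
  by apply: PCr_lin; split=> [x|//]; exact: cvg_id.
have c2 : PCr r.+1 A (fun (_ : R) x => Phi2 (col_mx x v) t).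
  apply: (PCr_comp oA oA2 _ H c1) => p x Ax.
  by rewrite /A2 /= col_mxKu.
have ld : PCr r.+1 setT (fun _ : R => dsubmx) := PCr_lin _ _ _ (lin_like_dsubmx N N).
have c3 : PCr r.+1 A (fun (_ : R) x => dsubmx (Phi2 (col_mx x v) t)).
  exact: (PCr_comp oA openT (fun _ _ _ => I) ld c2).
apply: (PCr_ext oA _ c3) => p x Ax.
by rewrite /Phi2 col_mxKu !col_mxKd; case: (dP x v Ax).
Qed.

End Flow.

(** * Implicit functions *)

Section ImplicitFunction.
Context {R : realType}.

(** A first step of length at most [a] and the factor 1/2 keep all iterates in the ball of radius
    2a, where the contraction property is assumed. *)
Lemma contraction_fix N (G : 'cV[R]_N -> 'cV[R]_N) x0 a : 0 <= a ->
  (forall x y, `|x - x0| <= 2 * a -> `|y - x0| <= 2 * a -> `|G x - G y| <= 2^-1 * `|x - y|) ->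
  `|G x0 - x0| <= a -> exists2 w, `|w - x0| <= 2 * a & G w = w.
Proof.
move=> a0 ctr Gx0; pose u k := iter k G x0.
have p2 k : 0 < 2 ^+ k :> R by rewrite exprn_gt0.
have x00 : `|x0 - x0| <= 2 * a by rewrite subrr normr0 mulr_ge0.
have uin k : `|u k - x0| <= 2 * a.
  elim: k => [//|k IH]; rewrite -(subrKA (G x0)); apply: le_trans (ler_normD _ _) _.
  have := ctr _ _ IH x00; rewrite /= => h; apply: le_trans (lerD h Gx0) _; lra.
have du k : `|u k.+1 - u k| <= a / 2 ^+ k.
  elim: k => [|k IH]; first by rewrite expr0 divr1.
  apply: le_trans (ctr _ _ (uin k.+1) (uin k)) _.
  by rewrite exprS invfM mulrCA ler_wpM2l.
have [w hw] := geo_cvg du.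
have win : `|w - x0| <= 2 * a by have := hw 0%N; rewrite expr0 divr1.
exists w => //; apply/eqP; rewrite -subr_eq0 -normr_eq0 eq_le normr_ge0 andbT.
apply/ler_addgt0Pr => eps eps0; rewrite add0r.
have [k hk] := half_expn_le (4 * a) eps0; apply: le_trans hk.
rewrite -(subrKA (u k.+1)); apply: le_trans (ler_normD _ _) _.
have h1 := ctr _ _ win (uin k); have h2 := hw k; have h3 := hw k.+1.
rewrite [`|u k.+1 - w|]distrC; apply: le_trans (lerD h1 h3) _.
have : 2 * a / 2 ^+ k.+1 = a / 2 ^+ k by rewrite exprS invfM mulrACA mulfV ?mul1r.
move=> ->; move: h2; rewrite -!mulrA; set d := a / 2 ^+ k.
have d0 : 0 <= d by rewrite divr_ge0// ltW.
lra.
Qed.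

Lemma mulmx_norm_le m n (M : 'M[R]_(m, n)) (v : 'cV[R]_n) : `|M *m v| <= n%:R * `|M| * `|v|.
Proof.
apply: mx_norm_le => [|i j]; first by rewrite !mulr_ge0.
rewrite mxE; apply: le_trans (ler_norm_sum _ _ _) _.
apply: (@le_trans _ _ (\sum_(k < n) `|M| * `|v|)); last first.
  by rewrite sumr_const card_ord -mulrA mulr_natl.
apply: ler_sum => k _.
by rewrite normrM ler_pM ?mx_norm_coord.
Qed.

Lemma PCrV (P : topologicalType) (U : normedModType R) r (A : set U) (f : P -> U -> R) :
  open A -> (forall p x, A x -> f p x != 0) -> PCr r A f -> PCr r A (fun p x => (f p x)^-1).
Proof.
move=> oA f0; elim: r f f0 => [|r IH] f f0 fA.
  by split=> // p x Ax; apply: cvgV; [exact: f0|exact: (PCr_cont fA)].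
have IHf := IH f f0 (PCrS fA).
apply: PCrSI.
- by move=> p x Ax; apply: cvgV; [exact: f0|exact: (PCr_cont fA)].
- by move=> p x v Ax; apply: derivableV; [exact: f0|exact: PCr_derivable fA Ax].
move=> v; apply: (@PCr_ext _ _ _ _ _ _ (fun p x => - 1 * ((f p x)^-1 * (f p x)^-1) * 'D_v (f p) x)) => //.
  move=> p x Ax; rewrite deriveV ?f0//; last exact: PCr_derivable fA Ax.
  by rewrite mulN1r mulNr scaleNr expr2 invfM.
exact: (PCrM oA (PCrM oA (PCr_cst _ _ _ _) (PCrM oA IHf IHf)) (PCr_derive v fA)).
Qed.

Lemma PCr_det (P : topologicalType) (U : normedModType R) n r (A : set U)
    (f : P -> U -> 'M[R]_n) : open A -> PCr r A f -> PCr r A (fun p x => \det (f p x)).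
Proof.
move=> oA fA; apply: PCr_sum => // s _; apply: (PCrM oA (PCr_cst _ _ _ _)).
by apply: PCr_prod => // i _; exact: PCr_coord.
Qed.

Lemma PCr_invmx (P : topologicalType) (U : normedModType R) n r (A : set U)
    (f : P -> U -> 'M[R]_n) : open A -> (forall p x, A x -> \det (f p x) != 0) ->
  PCr r A f -> PCr r A (fun p x => invmx (f p x)).
Proof.
move=> oA f0 fA.
apply: (@PCr_ext _ _ _ _ _ _ (fun p x => (\det (f p x))^-1 *: \adj (f p x))) => //.
  by move=> p x Ax; rewrite /invmx unitmxE unitfE f0.
apply: (PCrZ oA (PCrV oA f0 (PCr_det oA fA))).
apply/PCr_mxP => // i j.
apply: (@PCr_ext _ _ _ _ _ _ (fun p x => cofactor (f p x) j i)) => //.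
  by move=> p x _; rewrite mxE.
apply: (PCrM oA (PCr_cst _ _ _ _)); apply: PCr_det => //; apply/PCr_mxP => // k l.
apply: (@PCr_ext _ _ _ _ _ _ (fun p x => f p x (lift j k) (lift i l))) => //.
  by move=> p x _; rewrite !mxE.
exact: PCr_coord.
Qed.

Definition partial_mx q e (Q : 'cV[R]_(q + e) -> 'cV[R]_e) (s : 'cV[R]_(q + e)) : 'M[R]_e :=
  \matrix_(i, j) ('D_(col_mx 0 (ei j)) Q s) i 0.

Lemma open_nonzero (U : normedModType R) (B : set U) (f : U -> R) : open B ->
  PCr 0 B (fun _ : R => f) -> open [set x | B x /\ f x != 0].
Proof.
move=> oB [cf _]; rewrite openE => x [Bx fx0].
have c : {for x, continuous f}.
  apply: (@continuous_comp _ _ _ (fun y : U => (0 : R, y)) (fun q : R * U => f q.2)).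
    by apply: (continuous_pair (f := fun=> 0 : R) (g := id)); [exact: cst_continuous|exact: cvg_id].
  exact: cf.
apply: filterI; first exact: open_nbhs_nbhs.
exact: (cvgr_neq0 _ c fx0).
Qed.

Lemma PCr_derive_lin N m n r (A : set 'cV[R]_N) (f : 'cV[R]_N -> 'M[R]_(m, n)) x v w (c : R) :
  open A -> PCr r.+1 A (fun _ : R => f) -> A x ->
  'D_(c *: v + w) f x = c *: 'D_v f x + 'D_w f x.
Proof.
move=> oA fA Ax; have E u := PCr_derive_sum (0 : R) u oA fA Ax.
rewrite !E scaler_sumr -big_split/=; apply: eq_bigr => i _.
by rewrite !mxE scalerDl scalerA.
Qed.

Lemma partial_mxE q e r (B : set 'cV[R]_(q + e)) (Q : 'cV[R]_(q + e) -> 'cV[R]_e) s b :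
  open B -> PCr r.+1 B (fun _ : R => Q) -> B s ->
  partial_mx Q s *m b = 'D_(col_mx 0 b) Q s.
Proof.
move=> oB QB Bs; have E u := PCr_derive_sum (0 : R) u oB QB Bs.
apply/matrixP => i j; rewrite ord1 mxE E summxE.
under eq_bigr do rewrite mxE E summxE mulr_suml.
rewrite exchange_big/=; apply: eq_bigr => k _; rewrite mxE.
case: (split_ordP k) => l ->.
  rewrite col_mxEu mxE mul0r big1// => l' _.
  by rewrite mxE col_mxEu mxE !mul0r.
rewrite col_mxEd (bigD1 l)//= big1 ?addr0 => [|l' ll']; last first.
  by rewrite mxE col_mxEd !mxE eq_sym (negbTE ll') !mul0r.
by rewrite mxE col_mxEd !mxE !eqxx mul1r mulrC.
Qed.

Lemma norm_col_mx q e (a : 'cV[R]_q) (b : 'cV[R]_e) d : `|a| < d -> `|b| < d -> `|col_mx a b| < d.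
Proof.
move=> ad bd; have d0 : 0 < d := le_lt_trans (normr_ge0 _) ad.
apply: mx_norm_lt => // i j; case: (split_ordP i) => k ->.
  by rewrite col_mxEu; exact: le_lt_trans (mx_norm_coord _ _ _) ad.
by rewrite col_mxEd; exact: le_lt_trans (mx_norm_coord _ _ _) bd.
Qed.

Lemma col_mxB q e (a a' : 'cV[R]_q) (b b' : 'cV[R]_e) :
  col_mx a b - col_mx a' b' = col_mx (a - a') (b - b').
Proof. by rewrite opp_col_mx add_col_mx. Qed.

Lemma norm_col_mx0 q e (b : 'cV[R]_e) : `|col_mx (0 : 'cV[R]_q) b| = `|b|.
Proof.
apply/eqP; rewrite eq_le; apply/andP; split; apply: mx_norm_le => // i j.
  case: (split_ordP i) => k ->; first by rewrite col_mxEu mxE normr0.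
  by rewrite col_mxEd mx_norm_coord.
by have := mx_norm_coord (col_mx (0 : 'cV[R]_q) b) (rshift q i) j; rewrite col_mxEd.
Qed.

Lemma open_normB N (x0 : 'cV[R]_N) d : open [set x | `|x - x0| < d].
Proof.
rewrite openE => x /= xd; apply/near_ballP; exists (d - `|x - x0|); first by rewrite subr_gt0.
move=> y yx /=; rewrite -(subrKA x); apply: le_lt_trans (ler_normD _ _) _.
by rewrite -ltrBrDr.
Qed.

(** Besides a smooth solution [bt], the conclusion keeps the bound |bt p - b| <= C |Q(p, b)| for
    approximate solutions [b]. This bound gives the differentiability of [bt], and later the
    comparison of [bt] with the curve of the gamma_j. *)
Lemma implicit_function q e r (B : set 'cV[R]_(q + e)) (Q : 'cV[R]_(q + e) -> 'cV[R]_e) p0 b0 :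
  open B -> PCr r.+1 B (fun _ : R => Q) -> B (col_mx p0 b0) -> Q (col_mx p0 b0) = 0 ->
  \det (partial_mx Q (col_mx p0 b0)) != 0 ->
  exists rho del C (bt : 'cV[R]_q -> 'cV[R]_e), [/\ 0 < rho, 0 < del, bt p0 = b0,
    (forall p, `|p - p0| < rho -> [/\ `|bt p - b0| < del, B (col_mx p (bt p)) & Q (col_mx p (bt p)) = 0]) &
    (forall p b, `|p - p0| < rho -> `|b - b0| < del -> `|bt p - b| <= C * `|Q (col_mx p b)|) /\
    PCr r.+1 [set p | `|p - p0| < rho] (fun _ : R => bt)].
Proof.
move=> oB QB Bs0 Qs0 det0; set s0 := col_mx p0 b0 in Bs0 Qs0 det0.
pose J s := partial_mx Q s.
have JB : PCr r B (fun _ : R => J).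
  apply/PCr_mxP => // i j.
  apply: (@PCr_ext _ _ _ _ _ _ (fun _ s => ('D_(col_mx 0 (ei j)) Q s) i 0)) => //.
    by move=> p x _; rewrite mxE.
  exact: PCr_coord oB (PCr_derive _ QB).
(* On [B'] the partial derivative in the last block is invertible, so the formula for the derivative
   of [bt] makes sense along the whole graph. *)
pose B' := [set s | B s /\ \det (J s) != 0].
have oB' : open B' by apply: (open_nonzero oB); exact: (PCr_le (leq0n r) (PCr_det oB JB)).
have B'B : B' `<=` B by move=> s [].
pose M := invmx (J s0); have uJ : J s0 \in unitmx by rewrite unitmxE unitfE.
pose K := e%:R * `|M| + 1; have K0 : 0 < K by rewrite ltr_wpDl// mulr_ge0.
have MK (v : 'cV[R]_e) : `|M *m v| <= K * `|v|.
  by apply: le_trans (mulmx_norm_le _ _) _; rewrite ler_wpM2r// lerDl.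
(* A strict remainder with constant 1/(2K), followed by [M], which expands by at most [K], makes
   [G p] a contraction by 1/2. *)
have K2 : 0 < 2^-1 / K by rewrite divr_gt0// invr_gt0.
have [d1 d10 sd] := PCr_sdiff (0 : R) oB QB Bs0 K2.
have [d2 d20 inB] := (near_ballP _ _).1 (open_nbhs_nbhs (conj oB' (conj Bs0 det0))).
pose del := Num.min d1 d2; have del0 : 0 < del by rewrite lt_min d10.
have ball_s p b : `|p - p0| < del -> `|b - b0| < del -> `|col_mx p b - s0| < del.
  by move=> h1 h2; rewrite /s0 col_mxB; exact: norm_col_mx.
pose G p b := b - M *m Q (col_mx p b).
have ctr p b b' : `|p - p0| < del -> `|b - b0| < del -> `|b' - b0| < del ->
    `|G p b - G p b'| <= 2^-1 * `|b - b'|.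
  move=> hp hb hb'; have k1 := ball_s p b hp hb; have k2 := ball_s p b' hp hb'.
  rewrite !lt_min in k1 k2; case/andP: k1 => k1 _; case/andP: k2 => k2 _.
  have := sd _ _ k2 k1; rewrite col_mxB subrr norm_col_mx0 => h.
  have S : \sum_i (col_mx p b i 0 - col_mx p b' i 0) *: 'D_(ei i) Q s0 = J s0 *m (b - b').
    rewrite (partial_mxE _ oB QB Bs0) (PCr_derive_sum (0 : R) _ oB QB Bs0).
    apply: eq_bigr => i _; congr (_ *: _).
    have := congr1 (fun m : 'cV[R]_(q + e) => m i 0) (col_mxB p p b b').
    by rewrite subrr !mxE.
  rewrite S in h.
  have -> : G p b - G p b' = - (M *m (Q (col_mx p b) - Q (col_mx p b') - J s0 *m (b - b'))).
    rewrite /G [M *m (_ - J s0 *m _)]mulmxBr [M *m (Q _ - Q _)]mulmxBr mulmxA mulVmx// mul1mx.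
    move: (M *m Q (col_mx p b)) (M *m Q (col_mx p b')) => u w.
    by apply/matrixP => i j; rewrite !mxE; ring.
  rewrite normrN; apply: le_trans (MK _) _.
  apply: le_trans (ler_wpM2l (ltW K0) h) _; rewrite mulrA mulrCA mulfV ?mulr1//.
  exact: lt0r_neq0.
have cQ p b : B (col_mx p b) -> {for p, continuous (fun p' => Q (col_mx p' b))}.
  move=> Bpb; apply: (@continuous_comp _ _ _ (fun p' => (0 : R, col_mx p' b)) (fun z => Q z.2)).
    apply: (continuous_pair (f := fun=> 0 : R) (g := fun p' => col_mx p' b)); first exact: cst_continuous.
    by apply: continuous_col_mx; [exact: cvg_id|exact: cst_continuous].
  exact: (PCr_cont QB Bpb).
(* With this residual the first Newton step is at most del/4, so the fixed point lies within del/2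
   of [b0]. *)
have e4 : 0 < del / 4 / K by rewrite !divr_gt0.
have [d3 d30 Qsmall] := (near_ballP _ _).1 (continuous_dist_le (cQ _ _ Bs0) e4).
pose rho := Num.min del d3; have rho0 : 0 < rho by rewrite lt_min del0.
have fixex p : exists b, `|p - p0| < rho -> `|b - b0| < del /\ Q (col_mx p b) = 0.
  have [pr|pr] := boolP (`|p - p0| < rho); last by exists b0.
  move: (pr); rewrite lt_min => /andP[pd p3].
  have [|||w wd Gw] := @contraction_fix _ (G p) b0 (del / 4).
  - by rewrite divr_ge0// ltW.
  - have dd : 2 * (del / 4) < del by lra.
    by move=> x y xd yd; apply: ctr => //; [exact: le_lt_trans dd|exact: le_lt_trans dd].
  - rewrite /G addrAC subrr add0r normrN; apply: le_trans (MK _) _.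
    have := Qsmall p p3; rewrite Qs0 subr0 => h.
    by apply: le_trans (ler_wpM2l (ltW K0) h) _; rewrite mulrCA mulfV ?mulr1// lt0r_neq0.
  exists w => _; split; first by apply: le_lt_trans wd _; lra.
  have /eqP : M *m Q (col_mx p w) = 0.
    by move: Gw; rewrite /G => /eqP; rewrite -subr_eq0 addrAC subrr add0r oppr_eq0 => /eqP.
  by move/eqP/(congr1 (mulmx (J s0))); rewrite mulmxA mulmxV// mul1mx mulmx0.
pose bt p := sval (cid (fixex p)).
have btP p : `|p - p0| < rho -> `|bt p - b0| < del /\ Q (col_mx p (bt p)) = 0.
  by rewrite /bt; case: (cid (fixex p)).
have rdel p : `|p - p0| < rho -> `|p - p0| < del by rewrite lt_min => /andP[].
have est p b : `|p - p0| < rho -> `|b - b0| < del -> `|bt p - b| <= 2 * K * `|Q (col_mx p b)|.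
  move=> pr bd; have [btd Qbt] := btP p pr; have := ctr p (bt p) b (rdel _ pr) btd bd.
  have -> : G p (bt p) = bt p by rewrite /G Qbt mulmx0 subr0.
  rewrite /G opprB addrA addrAC -/(G p b) => h.
  have h2 := MK (Q (col_mx p b)).
  have : `|bt p - b| <= `|bt p - b + M *m Q (col_mx p b)| + `|M *m Q (col_mx p b)|.
    by rewrite -{1}[bt p - b](addrK (M *m Q (col_mx p b))); exact: ler_normB.
  lra.
have btB p : `|p - p0| < rho -> B' (col_mx p (bt p)).
  move=> pr; have [btd _] := btP p pr; apply: inB.
  by have := ball_s p _ (rdel _ pr) btd; rewrite lt_min => /andP[].
exists rho, del, (2 * K), bt; split => //.
- have p00 : `|p0 - p0| < rho by rewrite subrr normr0.
  have b00 : `|b0 - b0| < del by rewrite subrr normr0.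
  by have := est p0 b0 p00 b00; rewrite Qs0 normr0 mulr0 normr_le0 subr_eq0 => /eqP.
- by move=> p pr; have [btd Qbt] := btP p pr; split=> //; exact/B'B/btB.
split=> //; set A := [set p | `|p - p0| < rho]; have oA : open A by exact: open_normB.
have cbt p : A p -> {for p, continuous bt}.
  move=> Ap; apply: continuous_distI => eps eps0; have [btd Qbt] := btP p Ap.
  have e2 : 0 < eps / (2 * K) by rewrite divr_gt0// mulr_gt0.
  have := continuous_dist_le (cQ _ _ (B'B _ (btB p Ap))) e2.
  apply: filterS2 (open_nbhs_nbhs (conj oA Ap)) => p' Ap'; rewrite Qbt subr0 => h.
  apply: le_trans (est p' (bt p) Ap' btd) _.
  by rewrite -ler_pdivlMl ?mulr_gt0// mulrC.
(* The estimate [est] is applied to the linear predictor [bt p + h *: be]: the derivative of [Q]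
   along [col_mx v be] vanishes, so the predictor has residual o(h). *)
have dbt p v : A p -> is_derive p v bt
    (- (invmx (J (col_mx p (bt p))) *m 'D_(col_mx v 0) Q (col_mx p (bt p)))).
  move=> Ap; set s := col_mx p (bt p); set be := - _.
  have [btd Qbt] := btP p Ap; have [Bs dets] := btB p Ap.
  have uJs : J s \in unitmx by rewrite unitmxE unitfE.
  have D0 : 'D_(col_mx v be) Q s = 0.
    have -> : col_mx v be = 1 *: col_mx v 0 + col_mx 0 be.
      by rewrite scale1r add_col_mx addr0 add0r.
    rewrite (PCr_derive_lin _ _ _ oB QB Bs) scale1r -(partial_mxE _ oB QB Bs).
    by rewrite /be mulmxN mulmxA mulmxV// mul1mx subrr.
  have qcvg : (fun h : R => h^-1 *: (Q (h *: col_mx v be + s) - Q s)) @ 0^' --> (0 : 'cV[R]_e).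
    by rewrite -D0; exact: (PCr_derivable (p := (0 : R)) QB Bs).
  suff H : (fun h : R => h^-1 *: (bt (h *: v + p) - bt p)) @ 0^' --> be.
    by apply: DeriveDef; [apply/cvg_ex; exists be|exact: cvg_lim].
  apply/cvgrPdist_le => eps eps0.
  have e2 : 0 < eps / (2 * K) by rewrite divr_gt0// mulr_gt0.
  have V1 : 0 < `|v| + 1 by rewrite ltr_wpDl.
  have B1 : 0 < `|be| + 1 by rewrite ltr_wpDl.
  have pr : 0 < rho - `|p - p0| by rewrite subr_gt0.
  have dr : 0 < del - `|bt p - b0| by rewrite subr_gt0.
  near=> h.
  have hn0 : h != 0 by near: h; exact: nbhs_dnbhs_neq.
  have h1 : `|h| < (rho - `|p - p0|) / (`|v| + 1) by near: h; apply: dnbhs0_lt; rewrite divr_gt0.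
  have h2 : `|h| < (del - `|bt p - b0|) / (`|be| + 1) by near: h; apply: dnbhs0_lt; rewrite divr_gt0.
  have h3 : `|h^-1 *: (Q (h *: col_mx v be + s) - Q s)| <= eps / (2 * K).
    by rewrite -[X in `|X|]opprK normrN -sub0r; near: h; move/cvgrPdist_le: qcvg; exact.
  have Ah : `|h *: v + p - p0| < rho.
    rewrite -addrA; apply: le_lt_trans (ler_normD _ _) _; rewrite -ltrBrDr normrZ.
    rewrite ltr_pdivlMr// in h1; apply: le_lt_trans h1; rewrite ler_wpM2l// lerDl//.
  have bh : `|bt p + h *: be - b0| < del.
    rewrite addrAC addrC; apply: le_lt_trans (ler_normD _ _) _; rewrite -ltrBrDr normrZ.
    rewrite ltr_pdivlMr// in h2; apply: le_lt_trans h2; rewrite ler_wpM2l// lerDl//.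
  have := est _ _ Ah bh.
  have -> : col_mx (h *: v + p) (bt p + h *: be) = h *: col_mx v be + s.
    by rewrite scale_col_mx add_col_mx [bt p + _]addrC.
  move=> h4; rewrite Qbt subr0 in h3.
  have -> : be - h^-1 *: (bt (h *: v + p) - bt p) = - (h^-1 *: (bt (h *: v + p) - (bt p + h *: be))).
    by rewrite opprD addrA [in RHS]scalerBr scalerA mulVf// scale1r opprB.
  rewrite normrN normrZ; apply: le_trans (ler_wpM2l (normr_ge0 _) h4) _.
  by rewrite mulrCA -normrZ -ler_pdivlMl ?mulr_gt0// mulrC.
(* Bootstrap: the derivative of [bt] is a C^r function of [p] and [bt p], so each order of
   smoothness gives the next. *)
suff H k : (k <= r.+1)%N -> PCr k A (fun _ : R => bt) by exact: H.
elim: k => [|k IH] kr.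
  split=> // u p Ap; apply: (@continuous_comp _ _ _ snd bt); first exact: cvg_snd.
  exact: cbt.
apply: PCrSI.
- move=> u p Ap; apply: (@continuous_comp _ _ _ snd bt); first exact: cvg_snd.
  exact: cbt.
- by move=> _ p v Ap; case: (dbt p v Ap).
move=> v; pose H s := - 1 *: (invmx (J s) *m 'D_(col_mx v 0) Q s).
have kr' : (k <= r)%N by [].
have HB : PCr k B' (fun _ : R => H).
  apply: (PCrZc (-1) oB'); apply: (PCr_mulmx oB').
    by apply: (PCr_invmx oB') => [_ s [] //|]; apply: PCrW B'B _; exact: PCr_le JB.
  by apply: PCrW B'B _; exact: PCr_le (PCr_derive _ QB).
have cA : PCr k A (fun (_ : R) p => col_mx p (bt p)).
  apply: (PCr_col_mx oA _ (IH (ltnW kr))).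
  by apply: PCr_lin; split=> [x|//]; exact: cvg_id.
have c3 : PCr k A (fun (_ : R) p => H (col_mx p (bt p))).
  exact: (PCr_comp oA oB' (fun _ p Ap => btB p Ap) HB cA).
apply: (PCr_ext oA _ c3) => _ p Ap; case: (dbt p v Ap) => _ ->.
by rewrite /H scaleN1r.
Unshelve. all: by end_near. Qed.

End ImplicitFunction.

(** * Comparison of coefficients and integration over the pieces *)

Section Tools.
Context {R : realType}.
Local Notation mu := (@lebesgue_measure R).

(** Passage from joint smoothness in (t, x), or (t, x, eps), to smoothness in space with time as a
    parameter: [J p] is affine with linear part [L], so a derivative along [v] is one of [g] along
    [L v]. *)
Lemma Cr_PCr (P : topologicalType) (U V W : normedModType R) r (A : set V) (B : set U)
    (g : V -> W) (J : P -> U -> V) (L : U -> V) :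
  continuous (fun q : P * U => J q.1 q.2) ->
  (forall p (h : R) v x, J p (h *: v + x) = h *: L v + J p x) ->
  (forall p x, B x -> A (J p x)) -> Cr r A g -> PCr r B (fun p x => g (J p x)).
Proof.
move=> cJ JL BA; elim: r g => [|r IH] g [cg dg].
  split=> // p x Bx; apply: (@continuous_comp _ _ _ (fun q : P * U => J q.1 q.2) g).
    exact: cJ.
  exact: cg (BA _ _ Bx).
have quot p x v : (fun h : R => h^-1 *: ((g \o J p \o shift x) (h *: v) - g (J p x))) =
    (fun h : R => h^-1 *: ((g \o shift (J p x)) (h *: L v) - g (J p x))).
  by apply/funext=> h /=; rewrite JL.
case: dg => dg Ig; apply: PCrSI => [p x Bx|p x v Bx|v].
- apply: (@continuous_comp _ _ _ (fun q : P * U => J q.1 q.2) g); first exact: cJ.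
  exact: cg (BA _ _ Bx).
- by have := dg (J p x) (L v) (BA _ _ Bx); rewrite /derivable -quot.
- have -> : (fun p x => 'D_v (fun y => g (J p y)) x) = (fun p x => 'D_(L v) g (J p x)).
    by apply/funext=> p; apply/funext=> x; rewrite /derive -quot.
  exact: IH (Ig _).
Qed.

Lemma Bn_eq l s N m n (G : 'cV[R]_N -> 'M[R]_(m, n)) w w' x :
  (forall q, (1 <= q <= l)%N -> w q = w' q) -> Bn l s G w x = Bn l s G w' x.
Proof.
elim: l s G => [//|l IH] s G ww /=; apply: eq_bigr => c _.
rewrite ww ?ltnS ?leqnn //; congr (_ *: _); apply: IH => q /andP[q1 ql].
by apply: ww; rewrite q1 leqW.
Qed.

(** A term of weight [s] takes at most [s] derivatives, as every variable has weight at least 1. *)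
Lemma Bn_PCr (P : topologicalType) l s M N m n (A : set 'cV[R]_N)
    (f : P -> 'cV[R]_N -> 'M[R]_(m, n)) (v : nat -> P -> 'cV[R]_N) :
  open A -> (forall j, continuous (v j)) -> (s <= M)%N -> PCr M A f ->
  PCr (M - s) A (fun p x => Bn l s (f p) (fun j => v j p) x).
Proof.
move=> oA cv; elim: l s M f => [|l IH] s M f sM fM /=.
  case: eqP => _; last exact: PCr_cst.
  exact: PCr_le (leq_subr s M) fM.
apply: PCr_sum => // c lc.
have cM : (c <= M)%N by apply: leq_trans sM; apply: leq_trans lc; rewrite leq_pmull.
apply: PCrZc => //.
have sM' : (s - l.+1 * c <= M - c)%N.
  by apply: leq_sub => //; rewrite leq_pmull.
have := IH _ _ _ sM' (PCr_iterD_nseq oA (cv l.+1) cM fM).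
apply: PCr_le; rewrite -subnDA; apply: leq_sub2l.
rewrite -leq_subRL; last by apply: leq_trans lc; rewrite leq_pmull.
by apply: leq_sub2l; rewrite leq_pmull.
Qed.

Lemma continuous_Bn (P : topologicalType) l s M N m n (A : set 'cV[R]_N)
    (f : P -> 'cV[R]_N -> 'M[R]_(m, n)) (v : nat -> P -> 'cV[R]_N) (x : P -> 'cV[R]_N) :
  open A -> (forall j, continuous (v j)) -> (s <= M)%N -> PCr M A f ->
  continuous x -> (forall p, A (x p)) ->
  continuous (fun p => Bn l s (f p) (fun j => v j p) (x p)).
Proof.
move=> oA cv sM fM cx Ax p.
apply: (@continuous_comp _ _ _ (fun p => (p, x p))
  (fun q => Bn l s (f q.1) (fun j => v j q.1) q.2)).
  by apply: continuous_pair; [exact: cvg_id|exact: cx].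
have HB := Bn_PCr l oA cv sM fM; exact: (PCr_cont (p := p) HB (Ax p)).
Qed.

(** Letting e tend to 0 shows that the lowest coefficient vanishes, and dividing by e lowers k. With
    K = 0 this identifies the averaged functions; with K = eta |f| it compares the reduced map with
    f_k. *)
Lemma lead_coef_bound (W : normedModType R) k (a : nat -> W) f K : 0 <= K ->
  (forall eta, 0 < eta -> exists2 rho, 0 < rho & forall e : R, 0 < e < rho ->
     `|\sum_(c < k.+1) e ^+ c *: a c - e ^+ k *: f| <= (K + eta) * e ^+ k) ->
  (forall c, (c < k)%N -> a c = 0) /\ `|a k - f| <= K.
Proof.
move=> K0; elim: k a => [|k IH] a H.
  split=> //; apply/ler_addgt0Pr => eta e0; have [rho r0 /(_ (rho / 2))] := H _ e0.
  by rewrite big_ord1 expr0 !scale1r mulr1; apply; lra.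
have a0 : a 0%N = 0.
  apply/eqP; rewrite -normr_le0; apply/ler_addgt0Pr => eta e0; rewrite add0r.
  have [rho r0 Hr] := H 1 ltr01.
  (* For e <= 1 everything except [a 0] is at most e S, which is at most [eta] as soon as e <= eta /
     S. *)
  pose S := \sum_(c < k.+1) `|a c.+1| + `|f| + K + 1.
  have S0 : 0 < S by rewrite !ltr_wpDl ?addr_ge0 ?sumr_ge0.
  pose e := Num.min (Num.min (rho / 2) 1) (eta / S).
  have e_gt0 : 0 < e by rewrite !lt_min ltr01 !divr_gt0.
  have e_lt : e < rho by rewrite !gt_min; apply/orP; left; apply/orP; left; lra.
  have e_le1 : e <= 1 by rewrite !ge_min lexx orbT.
  have e_leS : e <= eta / S by rewrite !ge_min lexx orbT.
  have ek c : (0 < c)%N -> `|e ^+ c| <= e.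
    case: c => // c _; rewrite ger0_norm ?exprn_ge0 ?(ltW e_gt0) // exprS ler_piMr ?(ltW e_gt0) //.
    by rewrite exprn_ile1 ?(ltW e_gt0).
  have := Hr e; rewrite e_gt0 e_lt => /(_ isT); rewrite big_ord_recl /= expr0 scale1r -addrA.
  set Z := (X in `|_ + X|) => HZ.
  have : `|a 0%N| <= `|a 0%N + Z| + `|Z|.
    by rewrite -[X in `|X| <= _](addrK Z); apply: le_trans (ler_normD _ _) _; rewrite normrN.
  move/le_trans; apply.
  have Zle : `|Z| <= (\sum_(c < k.+1) `|a c.+1| + `|f|) * e.
    apply: le_trans (ler_normD _ _) _; rewrite normrN mulrDl; apply: lerD; last first.
      by rewrite normrZ mulrC ler_wpM2l // ek.
    rewrite mulr_suml; apply: le_trans (ler_norm_sum _ _ _) _; apply: ler_sum => c _.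
    by rewrite normrZ mulrC ler_wpM2l // ek.
  have : (K + 1) * e ^+ k.+1 <= (K + 1) * e.
    by rewrite ler_wpM2l ?addr_ge0 //; apply: le_trans (ler_norm _) (ek _ _).
  move=> H1; have H2 : e * S <= eta by rewrite -ler_pdivlMr.
  have H3 : e * S = (\sum_(c < k.+1) `|a c.+1| + `|f|) * e + (K + 1) * e by rewrite /S; ring.
  lra.
have [|IH1 IH2] := IH (fun c => a c.+1); last by split=> // -[|c] //; exact: IH1.
move=> eta e0; have [rho r0 Hr] := H _ e0; exists rho => // e er; have := Hr e er.
have e_gt0 : 0 < e by case/andP: er.
rewrite big_ord_recl /= a0 scaler0 add0r.
have -> : \sum_(i < k.+1) e ^+ bump 0 i *: a (bump 0 i) - e ^+ k.+1 *: f =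
    e *: (\sum_(i < k.+1) e ^+ i *: a i.+1 - e ^+ k *: f).
  rewrite scalerBr scaler_sumr scalerA -exprS; congr (_ - _); apply: eq_bigr => i _.
  by rewrite scalerA -exprS.
by rewrite normrZ gtr0_norm // exprS mulrCA ler_pM2l.
Qed.

Lemma integrable_setU d (S : measurableType d) (nu : {measure set S -> \bar R})
    (f : S -> \bar R) (A B : set S) : measurable A -> measurable B ->
  [disjoint A & B] -> nu.-integrable A f -> nu.-integrable B f -> nu.-integrable (A `|` B) f.
Proof.
move=> mA mB dAB IA IB; have /integrableP[fA iA] := IA; have /integrableP[fB iB] := IB.
have mf := (@measurable_funU _ _ _ _ _ _ _ mA mB).2 (conj fA fB).
apply/integrableP; split=> //.
rewrite ge0_integral_setU //; first exact: lte_add_pinfty.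
have /integrableP[nA _] := integrable_abse IA; have /integrableP[nB _] := integrable_abse IB.
exact: (@measurable_funU _ _ _ _ _ _ _ mA mB).2 (conj nA nB).
Qed.

Lemma Rintegrable_set1 (f : R -> R) (t : R) : mu.-integrable [set t] (EFin \o f).
Proof.
apply/integrableP; split; first exact: measurable_fun_set1.
by rewrite integral_set1.
Qed.

Section pieces.
Context (n : nat) (T : R) (ts : nat -> R).
Hypothesis ts0 : ts 0%N = 0.
Hypothesis tsn : ts n = T.
Hypothesis tsS : forall j, (j < n)%N -> ts j < ts j.+1.

(** Bridge between the Lebesgue integrals that define y_i and differential equations on the pieces.
    The integrand is prescribed inside the pieces; the breakpoints form a null set. *)
Lemma piecewise_integral (g G : R -> R) (gj : nat -> R -> R) : continuous G -> G 0 = 0 ->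
  (forall j, (j < n)%N -> continuous (gj j)) ->
  (forall j t, (j < n)%N -> ts j < t < ts j.+1 -> is_derive t 1 G (gj j t)) ->
  (forall j t, (j < n)%N -> ts j < t < ts j.+1 -> g t = gj j t) ->
  forall t, 0 <= t <= T -> Rintegral mu `[0, t] g = G t.
Proof.
move=> cG G0 cg dG eg.
suff H t : 0 <= t <= T -> mu.-integrable `[0, t] (EFin \o g) /\ Rintegral mu `[0, t] g = G t.
  by move=> t /H[].
move: t; apply: (piecewise_ind ts0 tsn tsS).
  by rewrite set_itv1; split; [exact: Rintegrable_set1|rewrite Rintegral_set1].
move=> j t jn /andP[jt tj] [ij Ij].
have tj0 : 0 <= ts j by have /andP[] := ts_itv ts0 tsn tsS (ltnW jn).
have gE s : [set` `]ts j, t[] s -> g s = gj j s.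
  by rewrite /= in_itv /= => /andP[s1 s2]; apply: eg; rewrite // s1 (lt_le_trans s2).
have gi : mu.-integrable `[ts j, t] (EFin \o gj j).
  apply: continuous_compact_integrable; first exact: segment_compact.
  by apply: continuous_subspaceT => x; exact: cg.
have gio : mu.-integrable `]ts j, t[ (EFin \o gj j).
  by apply: integrableS gi => //; exact: subset_itvW.
have igo : mu.-integrable `]ts j, t[ (EFin \o g).
  by apply: eq_integrable gio => // s; rewrite inE => /gE /= ->.
have E1 : [set` `]ts j, t]] = [set` `]ts j, t[] `|` [set t].
  by rewrite setUitv1 // bnd_simp.
have dj1 : [disjoint [set` `]ts j, t[] & [set t]].
  by apply/disj_setPS => s [] /=; rewrite in_itv /= => /andP[_ +] st; rewrite st ltxx.
have igc : mu.-integrable `]ts j, t] (EFin \o g).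
  by rewrite E1; apply: integrable_setU => //; exact: Rintegrable_set1.
have E2 : [set` `[0, t]] = [set` `[0, ts j]] `|` [set` `]ts j, t]].
  by rewrite (@itv_bndbnd_setU _ _ _ (BRight (ts j))) ?bnd_simp ?(ltW jt).
have dj2 : [disjoint [set` `[0, ts j]] & [set` `]ts j, t]]].
  apply/disj_setPS => s [] /=; rewrite !in_itv /= => /andP[_ s1] /andP[s2 _].
  by move: (lt_le_trans s2 s1); rewrite ltxx.
have iT : mu.-integrable `[0, t] (EFin \o g) by rewrite E2; apply: integrable_setU.
split=> //.
rewrite E2 Rintegral_setU -?E2 // Ij -(Rintegral_itv_bndo_bndc igo).
have -> : Rintegral mu `]ts j, t[ g = Rintegral mu `[ts j, t] (gj j).
  rewrite -Rintegral_itv_obnd_cbnd; last first.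
    by apply: integrableS gi => //; apply: subset_itvr; rewrite bnd_simp.
  rewrite -(Rintegral_itv_bndo_bndc gio); apply: eq_Rintegral => s; rewrite inE; exact: gE.
rewrite [X in _ + X](_ : _ = G t - G (ts j)); first by rewrite addrC subrK.
rewrite /Rintegral (@continuous_FTC2 _ _ G (ts j) t) //.
- by apply: continuous_subspaceT => x; exact: cg.
- split; last by apply: cvg_at_left_filter; exact: cG.
    move=> s; rewrite in_itv /= => /andP[s1 s2].
    by have [] : is_derive s 1 G (gj j s) by apply: dG; rewrite // s1 (lt_le_trans s2).
  by apply: cvg_at_right_filter; exact: cG.
- move=> s; rewrite in_itv /= => /andP[s1 s2]; rewrite derive1E.
  by have [_ ->] : is_derive s 1 G (gj j s) by apply: dG; rewrite // s1 (lt_le_trans s2).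
Qed.

Lemma lin_field_bound N (Om : set 'cV[R]_N) (f : nat -> R -> 'cV[R]_N -> 'cV[R]_N) phi :
  (forall j, (j < n)%N -> PCr 1 Om (f j)) -> continuous phi ->
  (forall t, 0 <= t <= T -> Om (phi t)) ->
  exists2 L, 0 <= L & forall j t (v : 'cV[R]_N), (j < n)%N -> 0 <= t <= T ->
    `|\sum_i v i 0 *: 'D_(ei i) (f j t) (phi t)| <= L * `|v|.
Proof.
move=> fC cphi Ophi.
have [M M0 HM] : exists2 M, 0 <= M & forall j, (j < n)%N -> forall t, 0 <= t <= T ->
    forall i, `|'D_(ei i) (f j t) (phi t)| <= M.
  apply: (uniform_large (Q := fun j M => forall t, 0 <= t <= T ->
    forall i, `|'D_(ei i) (f j t) (phi t)| <= M)) => [j M M' MM H t tT i|j jn].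
    exact: le_trans (H _ tT i) MM.
  have [M M0 HM] : exists2 M, 0 <= M & forall i, (i < N)%N -> forall (iN : (i < N)%N) t, 0 <= t <= T ->
      `|'D_(ei (Ordinal iN)) (f j t) (phi t)| <= M.
    apply: (uniform_large (Q := fun i M => forall (iN : (i < N)%N) t, 0 <= t <= T ->
      `|'D_(ei (Ordinal iN)) (f j t) (phi t)| <= M)) => [i M M' MM H iN t tT|i iN].
      exact: le_trans (H _ _ tT) MM.
    have [M M0 HM] := path_coef_bounded ts0 tsn tsS (PCr_derive (ei (Ordinal iN)) (fC j jn)) cphi Ophi.
    by exists M => iN' t tT; rewrite (bool_irrelevance iN' iN); exact: HM.
  by exists M => t tT [i iN]; exact: HM.
exists (\sum_(i < N) M) => [|j t v jn tT]; first by rewrite sumr_ge0.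
apply: le_trans (norm_lincomb_le _ _) _; rewrite mulrC ler_wpM2r //.
by apply: ler_sum => i _; exact: HM.
Qed.

Lemma var_sol_eq0 N (Om : set 'cV[R]_N) f phi v w :
  (forall j, (j < n)%N -> PCr 1 Om (f j)) -> psol n T ts Om f phi ->
  var_sol n ts f phi v w -> forall t, 0 <= t <= T -> w t = 0 -> v = 0.
Proof.
move=> fC [cphi Ophi dphi] [cw <- dw].
have [L L0 HL] := lin_field_bound fC cphi Ophi.
apply: (gronwall_eq0 ts0 tsn tsS L0 cw dw) => j t jn jt.
by apply: HL => //; exact: (piece_itv ts0 tsn tsS jn jt).
Qed.

End pieces.
End Tools.

(** * Lyapunov-Schmidt reduction *)

Section Bifurcation.
Context {R : realType}.

(* The perturbation parameter is carried as a last state coordinate, constant along solutions,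
   so that smoothness in it is smoothness in the initial condition. *)
Definition ext N (z : 'cV[R]_N) (e : R) : 'cV[R]_(N + 1) := col_mx z (const_mx e).
Definition pdir N : 'cV[R]_(N + 1) := ext 0 1.

Lemma extE N (z : 'cV[R]_N) e : ext z e = ext z 0 + e *: pdir N.
Proof.
rewrite /ext /pdir /ext scale_col_mx add_col_mx scaler0 addr0; congr col_mx.
by apply/matrixP => i j; rewrite !mxE add0r mulr1.
Qed.

Lemma ext_lin N (h : R) (v z : 'cV[R]_N) e : ext (h *: v + z) e = h *: ext v 0 + ext z e.
Proof.
rewrite /ext scale_col_mx add_col_mx; congr col_mx.
by apply/matrixP => i j; rewrite !mxE mulr0 add0r.
Qed.

Lemma extB N (z z' : 'cV[R]_N) e : ext z e - ext z' e = ext (z - z') 0.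
Proof. by rewrite addrC -scaleN1r /ext scale_col_mx add_col_mx; congr col_mx;
  [rewrite scaleN1r addrC|apply/matrixP => i j; rewrite !mxE; ring]. Qed.

Lemma norm_ext0 N (z : 'cV[R]_N) : `|ext z 0| = `|z|.
Proof.
apply/eqP; rewrite eq_le; apply/andP; split; apply: mx_norm_le => // i j; rewrite ord1.
  rewrite -(splitK i); case: (fintype.split i) => k /=.
    by rewrite /ext col_mxEu mx_norm_coord.
  by rewrite /ext col_mxEd mxE normr0.
by have := mx_norm_coord (ext z 0) (lshift 1 i) 0; rewrite /ext col_mxEu.
Qed.

Lemma norm_ext_lt N (z z0 : 'cV[R]_N) e r : `|z - z0| < r -> `|e| < r -> `|ext z e - ext z0 0| < r.
Proof.
move=> zr er; rewrite /ext col_mxB; apply: norm_col_mx => //.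
apply: mx_norm_lt => [|i j]; first exact: le_lt_trans er.
by rewrite !mxE subr0.
Qed.

Lemma norm_ext_le N (z z0 : 'cV[R]_N) e r : `|z - z0| <= r -> `|e| <= r -> `|ext z e - ext z0 0| <= r.
Proof.
move=> zr er; apply/ler_addgt0Pr => eta eta0; apply: ltW; apply: norm_ext_lt.
  by apply: le_lt_trans zr _; rewrite ltrDl.
by apply: le_lt_trans er _; rewrite ltrDl.
Qed.

Lemma continuous_ext N (e : R) : continuous (fun z : 'cV[R]_N => ext z e).
Proof.
move=> z; apply: (@continuous_col_mx _ _ _ _ id (fun=> const_mx e)); first exact: cvg_id.
exact: cst_continuous.
Qed.

(** The factor e^i lowers the order asked of [f i] to k - i, which is the regularity that g_i has.
    The double sum is regrouped by the total order a = i + l. *)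
Lemma lo_faadibruno_sum (P : topologicalType) N m n k (A : set 'cV[R]_N)
    (f : nat -> P -> 'cV[R]_N -> 'M[R]_(m, n)) (x : P -> 'cV[R]_N)
    (v : nat -> P -> 'cV[R]_N) (p0 : P) :
  open A -> (forall i, (i <= k)%N -> PCr (k - i) A (f i)) ->
  continuous x -> (forall j, continuous (v j)) -> A (x p0) ->
  lo (nbhs (p0, 0 : R)) snd k (fun q : P * R =>
     \sum_(i < k.+1) q.2 ^+ i *:
        f i q.1 (x q.1 + \sum_(1 <= j < k.+1) (q.2 ^+ j / j`!%:R) *: v j q.1)
     - \sum_(a < k.+1) q.2 ^+ a *:
        \sum_(l < a.+1) Bn l l (f (a - l)%N q.1) (fun j => v j q.1) (x q.1)).
Proof.
move=> oA fA cx cv Ax0.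
pose g i (q : P * R) := f i q.1 (x q.1 + \sum_(1 <= j < k.+1) (q.2 ^+ j / j`!%:R) *: v j q.1)
     - \sum_(s < (k - i).+1) q.2 ^+ s *: Bn k s (f i q.1) (fun j => v j q.1) (x q.1).
have H : lo (nbhs (p0, 0 : R)) snd k (fun q => \sum_(i < k.+1) q.2 ^+ i *: g i q).
  apply: lo_sum => -[i /= ik] _; rewrite ltnS in ik.
  rewrite -[X in lo _ _ X _](subnK ik).
  apply: (lo_scale (C := 1) _ (lo_faadibruno k oA (fA i ik) cx cv Ax0)) => //.
  by apply: filterE => q; rewrite normrZ normrX mul1r.
apply: lo_eq H; apply: filterE => q.
rewrite /g; under eq_bigr do rewrite scalerBr.
rewrite sumrB; congr (_ - _).
pose b i s := q.2 ^+ (s + i) *: Bn s s (f i q.1) (fun j => v j q.1) (x q.1).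
transitivity (\sum_(i < k.+1) \sum_(a < k.+1 | (i <= a)%N) b i (a - i)%N).
  apply: eq_bigr => -[i /= ik] _; rewrite ltnS in ik.
  rewrite (sum_ord_shift i k.+1 (fun a => b i (a - i)%N)) subSn // scaler_sumr.
  apply: eq_bigr => -[s /= sk] _; rewrite ltnS in sk.
  rewrite addnK /b exprD scalerA mulrC; congr (_ *: _).
  by apply: Bn_stable; apply: leq_trans sk (leq_subr _ _).
rewrite (exchange_big_dep xpredT) //=; apply: eq_bigr => -[a /= ak] _.
rewrite (@sum_ord_narrow _ k.+1 a.+1 (fun i => (i <= a)%N) (fun i => b i (a - i)%N)) //.
rewrite (reindex_inj rev_ord_inj) scaler_sumr /=; apply: eq_big => -[l /= la].
  by rewrite subSS leq_subr.
rewrite ltnS in la.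
by move=> _; rewrite subSS /b subKn // subnKC.
Qed.

Section zero_branch.
Context (d k : nat) (B : set 'cV[R]_(d + 1)) (E : 'cV[R]_(d + 1) -> 'cV[R]_d)
  (f : 'cV[R]_d -> 'cV[R]_d) (a0 : 'cV[R]_d) (M : 'M[R]_d).
Hypothesis oB : open B.
Hypothesis EB : PCr k.+1 B (fun _ : R => E).
Hypothesis Ba0 : B (ext a0 0).
Hypothesis low : \forall a \near a0, forall c, (c < k)%N -> iterD E (nseq c (pdir d)) (ext a 0) = 0.
Hypothesis lead : forall eta, 0 < eta -> \forall a \near a0,
  `|(k`!%:R)^-1 *: iterD E (nseq k (pdir d)) (ext a 0) - f a| <= eta * `|f a|.
Hypothesis fa0 : f a0 = 0.
Hypothesis df : forall eta, 0 < eta -> \forall a \near a0, `|f a - M *m (a - a0)| <= eta * `|a - a0|.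
Local Notation F c := (iterD E (nseq c (pdir d))).

Let cpdir : continuous (fun _ : R => pdir d).
Proof. by move=> x; exact: cst_continuous. Qed.

Lemma lead0 : F k (ext a0 0) = 0.
Proof.
have := nbhs_singleton (lead ltr01); rewrite fa0 normr0 mulr0 subr0 normr_le0 scaler_eq0.
by rewrite gt_eqF ?invr_gt0 ?ltr0n ?fact_gt0 //= => /eqP.
Qed.

(** The k-th derivative of [E] in the parameter is C^1, hence strictly differentiable at (a0, 0),
    with some derivative [L] in the direction of [a] after division by k!. At t = 0, [lead] compares
    it with [f]: the relative error is small against |f| = O(|a - a0|), since [f] vanishes at [a0],
    so [L] and [M] agree to any relative accuracy. *)
Lemma lead_strict eta : 0 < eta -> exists2 rho, 0 < rho & forall (a a' : 'cV[R]_d) (t : R),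
  `|a - a0| < rho -> `|a' - a0| < rho -> `|t| < rho ->
  `|(k`!%:R)^-1 *: (F k (ext a' t) - F k (ext a t)) - M *m (a' - a)| <= eta * `|a' - a|.
Proof.
move=> eta0; pose K := d%:R * `|M| + 1; have K0 : 0 < K by rewrite ltr_wpDl // mulr_ge0.
have FB : PCr 1 B (fun _ : R => F k).
  have := PCr_iterD_nseq oB cpdir (leqnSn k) EB.
  by rewrite subSnn.
pose L v : 'cV[R]_d := (k`!%:R)^-1 *: 'D_(ext v 0) (F k) (ext a0 0).
have ik_le (v : 'cV[R]_d) : `|(k`!%:R)^-1 *: v| <= `|v|.
  rewrite normrZ ler_piMl // gtr0_norm ?invr_gt0 ?ltr0n ?fact_gt0 //.
  by rewrite invf_le1 ?ltr0n ?fact_gt0 // ler1n fact_gt0.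
have e4 : 0 < eta / 4 by rewrite divr_gt0.
have sdL th : 0 < th -> exists2 rho, 0 < rho & forall (a a' : 'cV[R]_d) (t : R),
  `|a - a0| < rho -> `|a' - a0| < rho -> `|t| < rho ->
  `|(k`!%:R)^-1 *: (F k (ext a' t) - F k (ext a t)) - L (a' - a)| <= th * `|a' - a|.
  move=> th0; have [rho rho0 sd] := PCr_sdiff (0 : R) oB FB Ba0 th0.
  exists rho => // a a' t ra ra' rt.
  have := sd _ _ (norm_ext_lt ra rt) (norm_ext_lt ra' rt).
  have -> : \sum_i (ext a' t i 0 - ext a t i 0) *: 'D_(ei i) (F k) (ext a0 0) =
      'D_(ext (a' - a) 0) (F k) (ext a0 0).
    rewrite (PCr_derive_sum (0 : R) _ oB FB Ba0); apply: eq_bigr => i _; congr (_ *: _).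
    by rewrite -(extB a' a t) !mxE.
  rewrite extB norm_ext0 => h; apply: le_trans h.
  by rewrite /L -scalerBr; exact: ik_le.
have Lz : forall th, 0 < th -> exists2 rho, 0 < rho & forall v : 'cV[R]_d, `|v| < rho ->
    `|L v - M *m v| <= th * `|v|.
  move=> th th0; pose t4 := th / 4; have t40 : 0 < t4 by rewrite divr_gt0.
  (* [lead] is used with t4 / (K + 1) because [df] gives |f| <= (K + 1)|v|. *)
  pose t5 := Num.min 1 (t4 / (K + 1)).
  have K1 : 0 < K + 1 by rewrite ltr_wpDl // ltW.
  have t50 : 0 < t5 by rewrite lt_min ltr01 divr_gt0.
  have [r1 r10 H1] := sdL t4 t40.
  have [r2 r20 H2] := (near_ballP _ _).1 (lead t50).
  have m0 : 0 < Num.min 1 t4 by rewrite lt_min ltr01.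
  have [r3 r30 H3] := (near_ballP _ _).1 (df m0).
  pose r := Num.min r1 (Num.min r2 r3).
  have r0 : 0 < r by rewrite !lt_min r10 r20.
  exists r => // v; rewrite !lt_min => /and3P[v1 v2 v3].
  have v0 : `|a0 - a0| < r1 by rewrite subrr normr0.
  have va : `|a0 + v - a0| = `|v| by rewrite addrAC subrr add0r.
  have := H1 a0 (a0 + v) 0 v0; rewrite va normr0 addrAC subrr add0r => /(_ v1 r10); rewrite lead0 subr0.
  have := H2 (a0 + v); rewrite va => /(_ v2).
  have := H3 (a0 + v); rewrite va addrAC subrr add0r => /(_ v3).
  set ek := _ *: _; set fv := f _; move=> h3 h2 h1.
  have fvK : `|fv| <= (K + 1) * `|v|.
    have : `|fv| <= `|fv - M *m v| + `|M *m v| by rewrite -{1}[fv](subrK (M *m v)) ler_normD.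
    have := mulmx_norm_le M v.
    have : Num.min 1 t4 * `|v| <= 1 * `|v| by rewrite ler_wpM2r // ge_min lexx.
    have -> : (K + 1) * `|v| = d%:R * `|M| * `|v| + 2 * `|v| by rewrite /K; ring.
    have := normr_ge0 v; lra.
  have h2' : `|ek - fv| <= t4 * `|v|.
    apply: le_trans h2 _; apply: (@le_trans _ _ (t4 / (K + 1) * `|fv|)).
      by rewrite ler_wpM2r // ge_min lexx orbT.
    apply: le_trans (ler_wpM2l _ fvK) _; first by apply: divr_ge0; apply: ltW.
    by rewrite mulrA divfK // gt_eqF.
  have h3' : `|fv - M *m v| <= t4 * `|v|.
    by apply: le_trans h3 _; rewrite ler_wpM2r // ge_min lexx orbT.
  have -> : L v - M *m v = - (ek - L v) + (ek - fv) + (fv - M *m v).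
    by move: (L v) (M *m v) => x y; rewrite opprB !addrA !subrK.
  apply: le_trans (ler_normD _ _) _; apply: le_trans (lerD (ler_normD _ _) (lexx _)) _.
  by rewrite normrN; have : t4 * `|v| = th * `|v| / 4 by [rewrite /t4; ring]; have := normr_ge0 v; nra.
have [r1 r10 H1] := sdL _ e4; have [r2 r20 H2] := Lz _ e4.
exists (Num.min r1 (r2 / 2)) => [|a a' t]; first by rewrite lt_min r10 divr_gt0.
rewrite !lt_min => /andP[a1 a2] /andP[b1 b2] /andP[t1 _].
have := H1 a a' t a1 b1 t1.
have := H2 (a' - a); have ->// : `|a' - a| < r2.
  have -> : a' - a = (a' - a0) - (a - a0) by rewrite opprB addrA subrK.
  by apply: le_lt_trans (ler_normB _ _) _; lra.
move=> /(_ isT) h2 h1.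
set u := _ *: _ in h1 *; rewrite -[u](subrK (L (a' - a))) -addrA.
apply: le_trans (ler_normD _ _) _; have := normr_ge0 (a' - a); nra.
Qed.

Lemma is_derive_pdir c a (t : R) : (c <= k)%N -> B (ext a t) ->
  is_derive t 1 (fun s => F c (ext a s)) (F c.+1 (ext a t)).
Proof.
move=> ck Bt.
have -> : (fun s => F c (ext a s)) = (fun s : R => F c (ext a 0 + s *: pdir d)).
  by apply/funext => s; rewrite -extE.
rewrite [X in F c.+1 X]extE; apply: (@is_derive_line _ _ _ (F c)); rewrite -extE.
have := PCr_iterD_nseq oB cpdir (leqW ck) EB; rewrite subSn // => H.
exact: (PCr_derivable (p := (0 : R)) H Bt).
Qed.

(* The increment in [a] is expanded in [t] (Taylor), so mixed derivatives need not commute. *)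
Lemma increment_strict eta : 0 < eta -> exists2 rho, 0 < rho & forall (a a' : 'cV[R]_d) (t : R),
  `|a - a0| < rho -> `|a' - a0| < rho -> `|t| < rho ->
  `|E (ext a' t) - E (ext a t) - t ^+ k *: (M *m (a' - a))| <= eta * `|a' - a| * `|t| ^+ k.
Proof.
move=> eta0; pose K : R := k`!%:R.
have K1 : 1 <= K by rewrite ler1n fact_gt0.
have K0 : 0 < K by apply: lt_le_trans K1.
have th0 : 0 < eta / 3 / K by rewrite !divr_gt0.
have [r1 r10 H1] := lead_strict th0.
have [r2 r20 H2] := (near_ballP _ _).1 (open_nbhs_nbhs (conj oB Ba0)).
have [r3 r30 H3] := (near_ballP _ _).1 low.
pose r := Num.min r1 (Num.min r2 r3); have r0 : 0 < r by rewrite !lt_min r10 r20.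
exists r => // a a' t; rewrite !lt_min => /and3P[a1 a2 a3] /and3P[b1 b2 b3] /and3P[t1 t2 _].
pose g c (s : R) := F c (ext a' s) - F c (ext a s).
have dg c (s : R) : (c < k)%N -> `|s| <= `|t| -> is_derive s 1 (g c) (g c.+1 s).
  move=> ck st; have s2 : `|s| < r2 by apply: le_lt_trans t2.
  by apply: is_deriveB; apply: is_derive_pdir; rewrite 1?ltnW //; apply: H2; apply: norm_ext_lt.
have gk s : `|s| <= `|t| -> `|g k s - K *: (M *m (a' - a))| <= eta / 3 * `|a' - a|.
  move=> st; have := H1 a a' s a1 b1 (le_lt_trans st t1).
  have -> : g k s - K *: (M *m (a' - a)) = K *: (K^-1 *: g k s - M *m (a' - a)).
    by rewrite scalerBr scalerA mulfV ?gt_eqF // scale1r.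
  rewrite normrZ gtr0_norm // => h; apply: le_trans (ler_wpM2l (ltW K0) h) _.
  by rewrite mulrA [K * _]mulrC divfK ?gt_eqF.
have g0 : `|(0 : R)| <= `|t| by rewrite normr0.
have gk0 s : `|s| <= `|t| -> `|g k s - g k 0| <= 2 * (eta / 3 * `|a' - a|).
  move=> st; have -> : g k s - g k 0 = (g k s - K *: (M *m (a' - a))) - (g k 0 - K *: (M *m (a' - a))).
    by move: (g k s) (g k 0) (K *: _) => x y c; rewrite opprB addrA subrK.
  by apply: le_trans (ler_normB _ _) _; have := gk _ st; have := gk _ g0; lra.
have := taylor1 dg gk0 (lexx `|t|).
rewrite big_ord_recr /= big1 ?add0r => [|[c ck] _] /=; last first.
  by rewrite /g !H3 // subr0 scaler0.
move=> h; rewrite -/(g 0%N t).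
have -> : g 0%N t - t ^+ k *: (M *m (a' - a)) =
    (g 0%N t - (t ^+ k / K) *: g k 0) + (t ^+ k / K) *: (g k 0 - K *: (M *m (a' - a))).
  move: (g 0%N t) (g k 0) (M *m _) => x y w.
  by rewrite scalerBr scalerA divfK ?gt_eqF // addrA subrK.
apply: le_trans (ler_normD _ _) _; rewrite normrZ.
have h2 : `|t ^+ k / K| <= `|t| ^+ k by rewrite -normrX; apply: normr_divn_le; exact: fact_gt0.
have h3 := ler_pM (normr_ge0 _) (normr_ge0 _) h2 (gk _ g0).
apply: le_trans (lerD h h3) _.
by rewrite [leLHS](_ : _ = eta * `|a' - a| * `|t| ^+ k) //; field.
Qed.

(* Newton's method for [E (ext a e) / e ^ k]: by [increment_strict] the map
   a |-> a - M^-1 E (ext a e) / e ^ k is a contraction with a constant independent of [e]. *)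
Lemma zero_branch : \det M != 0 -> exists2 eps1, 0 < eps1 & exists2 C, 0 <= C &
  forall e : R, 0 < `|e| < eps1 -> exists a, [/\ `|a - a0| <= C * `|e|, B (ext a e) & E (ext a e) = 0].
Proof.
move=> dM; have uM : M \in unitmx by rewrite unitmxE unitfE.
pose N := invmx M; pose K := d%:R * `|N| + 1; have K0 : 0 < K by rewrite ltr_wpDl // mulr_ge0.
have NK (v : 'cV[R]_d) : `|N *m v| <= K * `|v|.
  by apply: le_trans (mulmx_norm_le _ _) _; rewrite ler_wpM2r // lerDl.
have eta0 : 0 < 2^-1 / K by rewrite divr_gt0 // invr_gt0.
have [r1 r10 H1] := increment_strict eta0.
have [r2 r20 H2] := (near_ballP _ _).1 (open_nbhs_nbhs (conj oB Ba0)).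
pose D := `|F k.+1 (ext a0 0)| + 1; have D0 : 0 < D by rewrite ltr_wpDl.
(* At [a0] the derivatives in the parameter vanish up to order k, the last one because [f] vanishes
   there. Hence the residual is O(e^(k+1)) and the first Newton step O(e), which is the rate in the
   conclusion. *)
have [r3 r30 H3] : exists2 r3, 0 < r3 & forall e : R, `|e| < r3 -> `|E (ext a0 e)| <= D * `|e| ^+ k.+1.
  have L : lo (nbhs (0 : R)) id k.+1 (fun e : R => E (ext a0 0 + e *: pdir d) -
      \sum_(c < k.+2) (e ^+ c / c`!%:R) *: F c (ext a0 0)).
    by apply: (lo_taylor (p := fun=> 0 : R) (y := fun=> ext a0 0) oB EB cpdir Ba0);
      [exact: cvg_cst|exact: cvg_cst|exact: cvg_id].
  have /nbhs_ballP := L _ ltr01.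
  move=> [r3 r30 H]; exists r3 => // e er.
  have := H e; rewrite /ball /= sub0r normrN => /(_ er).
  rewrite -extE big_ord_recr /= big1 ?add0r => [|[c ck] _] /=.
    rewrite mul1r => h; set w := _ *: _ in h.
    rewrite -[E _](subrK w); apply: le_trans (ler_normD _ _) _.
    have wE : `|w| <= `|e| ^+ k.+1 * `|F k.+1 (ext a0 0)|.
      by rewrite normrZ ler_wpM2r // -normrX; apply: normr_divn_le; exact: fact_gt0.
    by rewrite /D; set X := `|F k.+1 _| in wE *; lra.
  rewrite ltnS leq_eqVlt in ck; case/orP: ck => [/eqP->|ck]; last first.
    by rewrite (nbhs_singleton low) // scaler0.
  by rewrite lead0 scaler0.
pose K2 := K * D; have K20 : 0 < K2 by rewrite mulr_gt0.
pose r := Num.min r1 (Num.min r2 r3); have r0 : 0 < r by rewrite !lt_min r10 r20.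
have K3 : 0 < 2 * K2 + 1 by rewrite addr_gt0 // mulr_gt0.
(* Both |e| and the radius 2 K2 |e| of the contraction ball stay below [r]. *)
exists (r / (2 * K2 + 1)); first by rewrite divr_gt0.
exists (2 * K2); first by rewrite mulr_ge0 // ltW.
move=> e /andP[e0]; rewrite ltr_pdivlMr // => er.
have eN : e != 0 by rewrite -normr_gt0.
have er' : `|e| < r by apply: le_lt_trans er; rewrite ler_peMr // lerDr mulr_ge0 // ltW.
have e2r : 2 * (K2 * `|e|) < r.
  by move: er; rewrite mulrDr mulr1 [`|e| * _]mulrC -mulrA => h; lra.
move: (er'); rewrite !lt_min => /and3P[er1 er2 er3].
pose G a := a - N *m (e ^- k *: E (ext a e)).
have Gdiff a a' : `|a - a0| <= 2 * (K2 * `|e|) -> `|a' - a0| <= 2 * (K2 * `|e|) ->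
    `|G a - G a'| <= 2^-1 * `|a - a'|.
  move=> ha ha'; have a1 := le_lt_trans ha e2r; have a2 := le_lt_trans ha' e2r.
  move: a1 a2; rewrite !lt_min => /andP[a1 _] /andP[a2 _].
  have -> : G a - G a' = - (N *m (e ^- k *: (E (ext a e) - E (ext a' e) - e ^+ k *: (M *m (a - a'))))).
    rewrite [e ^- k *: (_ - e ^+ k *: _)]scalerBr scalerA mulVf ?expf_neq0 // scale1r.
    rewrite [N *m (_ - M *m _)]mulmxBr mulmxA mulVmx // mul1mx opprB scalerBr mulmxBr /G.
    move: (N *m _) (N *m _) => u w.
    by apply/matrixP => i j; rewrite !mxE; ring.
  rewrite normrN; apply: le_trans (NK _) _; rewrite normrZ.
  apply: le_trans (ler_wpM2l (ltW K0) (ler_wpM2l (normr_ge0 _) (H1 _ _ _ a2 a1 er1))) _.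
  rewrite normfV normrX [leLHS](_ : _ = 2^-1 * `|a - a'|) //.
  by move: (expf_neq0 k (negbT (gt_eqF e0))) (negbT (gt_eqF K0)) => /=; move: (`|e| ^+ k) => X X0 KN; field; rewrite X0 KN.
have Ga0 : `|G a0 - a0| <= K2 * `|e|.
  rewrite /G addrAC subrr add0r normrN; apply: le_trans (NK _) _.
  rewrite normrZ /K2 -mulrA ler_wpM2l ?(ltW K0) //.
  apply: le_trans (ler_wpM2l (normr_ge0 _) (H3 _ er3)) _.
  rewrite normfV normrX exprSr mulrCA [X in D * X]mulrA mulVf ?mul1r //.
  by rewrite expf_neq0 // gt_eqF.
have [w wa Gw] := contraction_fix (mulr_ge0 (ltW K20) (normr_ge0 e)) Gdiff Ga0.
exists w; split; first by rewrite -mulrA.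
  apply: H2; apply: norm_ext_lt => //; apply: le_lt_trans wa _; apply: lt_le_trans e2r _.
  by rewrite /r !ge_min lexx orbT.
have : N *m (e ^- k *: E (ext w e)) = 0.
  by move: Gw; rewrite /G => /eqP; rewrite -subr_eq0 addrAC subrr add0r oppr_eq0 => /eqP.
move/(congr1 (mulmx M)); rewrite mulmxA mulmxV // mul1mx mulmx0 => /eqP.
by rewrite scaler_eq0 invr_eq0 expf_eq0 (negbTE eN) andbF /= => /eqP.
Qed.

End zero_branch.
End Bifurcation.

(** * From the displacement map to the bifurcation equation *)

Section LyapunovSchmidt.
Context {R : realType} (d e k : nat) (A : set 'cV[R]_(d + e + 1))
  (h : 'cV[R]_(d + e + 1) -> 'cV[R]_(d + e)) (Y : 'cV[R]_(d + e) -> 'M[R]_(d + e)).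
Let B : set 'cV[R]_(d + e) := [set z | A (ext z 0)].
Hypothesis oA : open A.
Hypothesis hA : PCr k.+1 A (fun _ : R => h).
Hypothesis YB : PCr k B (fun _ : R => Y).
Hypothesis dY : forall z, B z -> \det (Y z) != 0.

Let cpdir : continuous (fun _ : R => pdir (R := R) (d + e)).
Proof. by move=> x; exact: cst_continuous. Qed.

Lemma lin_like_ext N : lin_like (fun z : 'cV[R]_N => ext z 0).
Proof. by split=> [|c x v]; [exact: continuous_ext|exact: ext_lin]. Qed.

Let oB : open B.
Proof. exact: open_lin_preimage (lin_like_ext _) oA. Qed.

Lemma is_derive_lin_comp (V : normedModType R) N m (L : 'cV[R]_N -> 'cV[R]_m)
    (g : V -> 'cV[R]_N) x v dg :
  lin_like L -> is_derive x v g dg -> is_derive x v (fun y => L (g y)) (L dg).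
Proof.
move=> LL dg'; have := PCr_chain (0 : R) openT (PCr_lin R 1 setT LL) I dg'.
by have [_ ->] := is_derive_lin (g x) dg LL.
Qed.

Lemma lin_like_mulmx m N (X : 'M[R]_(m, N)) : lin_like (fun y : 'cV[R]_N => X *m y).
Proof.
split=> [x|c x y]; last by rewrite mulmxDr scalemxAr.
apply: continuous_distI => eps eps0; pose K := N%:R * `|X| + 1.
have K0 : 0 < K by rewrite ltr_wpDl // mulr_ge0.
apply/near_ballP; exists (eps / K); first by rewrite divr_gt0.
move=> y; rewrite ltr_pdivlMr // => yx; rewrite -mulmxBr.
apply: le_trans (mulmx_norm_le _ _) _; apply: le_trans (ltW yx).
by rewrite mulrC ler_wpM2l // lerDl.
Qed.

Lemma PCr_lip N m n r (C : set 'cV[R]_N) (g : 'cV[R]_N -> 'M[R]_(m, n)) x :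
  open C -> PCr r.+1 C (fun _ : R => g) -> C x ->
  exists2 rho, 0 < rho & exists2 K, 0 <= K & forall y y',
    `|y - x| < rho -> `|y' - x| < rho -> `|g y' - g y| <= K * `|y' - y|.
Proof.
move=> oC gC Cx; have [rho rho0 H] := PCr_sdiff (0 : R) oC gC Cx ltr01.
exists rho => //; exists (1 + \sum_i `|'D_(ei i) g x|); first by rewrite addr_ge0 // sumr_ge0.
move=> y y' yr y'r; have := H _ _ yr y'r; set S := \sum_i _ *: _ => gS.
have hS : `|S| <= `|y' - y| * \sum_i `|'D_(ei i) g x|.
  have -> : S = \sum_i (y' - y) i 0 *: 'D_(ei i) g x by apply: eq_bigr => i _; rewrite !mxE.
  exact: norm_lincomb_le.
rewrite -[g y' - g y](subrK S); apply: le_trans (ler_normD _ _) _.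
by rewrite mulrDl; apply: lerD => //; rewrite mulrC.
Qed.

Lemma norm_le_sub m1 m2 (v : 'cV[R]_(m1 + m2)) : `|v| <= `|usubmx v| + `|dsubmx v|.
Proof.
apply: mx_norm_le => [|i j]; first by rewrite addr_ge0.
rewrite -{1}(vsubmxK v) ord1 -(splitK i); case: (fintype.split i) => l /=.
  by rewrite col_mxEu; apply: le_trans (mx_norm_coord _ _ _) _; rewrite lerDl.
by rewrite col_mxEd; apply: le_trans (mx_norm_coord _ _ _) _; rewrite lerDr.
Qed.

Lemma norm_usubmx m1 m2 (v : 'cV[R]_(m1 + m2)) : `|usubmx v| <= `|v|.
Proof. by apply: mx_norm_le => // i j; rewrite mxE; exact: mx_norm_coord. Qed.

Lemma norm_dsubmx m1 m2 (v : 'cV[R]_(m1 + m2)) : `|dsubmx v| <= `|v|.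
Proof. by apply: mx_norm_le => // i j; rewrite mxE; exact: mx_norm_coord. Qed.

Lemma cvg_curve N (z : 'cV[R]_N) (w : nat -> 'cV[R]_N) l :
  (fun t : R => z + \sum_(1 <= j < l.+1) (t ^+ j / j`!%:R) *: w j) @ (0 : R) --> z.
Proof.
rewrite -[X in _ --> X]addr0; apply: cvgD; first exact: cvg_cst.
elim: l => [|l IH].
  rewrite (_ : (fun t : R => _) = fun=> 0); first exact: cvg_cst.
  by apply/funext => t; rewrite big_geq.
rewrite (_ : (fun t : R => _) = (fun t => \sum_(1 <= j < l.+1) (t ^+ j / j`!%:R) *: w j +
    (t ^+ l.+1 / l.+1`!%:R) *: w l.+1)); last first.
  by apply/funext => t; rewrite big_nat_recr.
rewrite -[X in _ --> X]addr0; apply: cvgD => //.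
rewrite -(scale0r (w l.+1)); apply: cvgZ; last exact: cvg_cst.
have H0 : (fun t : R => t ^+ l.+1 / l.+1`!%:R) @ (0 : R) --> (0 : R) ^+ l.+1 / l.+1`!%:R.
  by apply: cvgM; [exact: exprn_continuous|exact: cvg_cst].
by rewrite [0 ^+ _]exprS !mul0r in H0.
Qed.

(** The function g_i written through the displacement map [h]; it agrees with [gfun] once y_i(T, z)
    is known to be the i-th derivative in the parameter. *)
Definition gco i z := invmx (Y z) *m ((i`!%:R)^-1 *: iterD h (nseq i (pdir (d + e))) (ext z 0)).

(** Of the C^(k+1) map [h], [i] derivatives are spent, and [Y] is C^k; the order k - i is what
    [lo_faadibruno_sum] asks of the i-th coefficient. *)
Lemma gco_PCr i : (i <= k)%N -> PCr (k - i) B (fun _ : R => gco i).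
Proof.
move=> ik; apply: (PCr_mulmx oB).
  by apply: (PCr_invmx oB) => [_ z Bz|]; [exact: dY|exact: PCr_le (leq_subr _ _) YB].
apply: (PCrZc _ oB).
have H := PCr_iterD_nseq oA cpdir (leqW ik) hA.
have H' := PCr_le (leq_sub2r i (leqnSn k)) H.
exact: (PCr_comp oB oA (fun _ z Bz => Bz) H' (PCr_lin _ _ _ (lin_like_ext _))).
Qed.

Lemma lo_nbhs2 M (W : normedModType R) (g : R * R -> W) :
  lo (nbhs (0 : R, 0 : R)) snd M g -> lo (nbhs (0 : R)) id M (fun t => g (0, t)).
Proof.
apply: (@lo_comp R R (R * R)%type (nbhs (0 : R)) (nbhs (0 : R, 0 : R)) snd M W g (fun t => (0, t))).
by apply: (cvg_pair (G := nbhs (0 : R)) (H := nbhs (0 : R))); [exact: cvg_cst|exact: cvg_id].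
Qed.

Section curve.
Context (z : 'cV[R]_(d + e)) (gam : nat -> 'cV[R]_e) (phi : 'cV[R]_d).
Hypothesis Bz : B z.
Hypothesis hz : h (ext z 0) = 0.
Local Notation w := (fun j => col_mx 0 (gam j)).
Hypothesis ucoef : forall m, (1 <= m <= k)%N ->
  \sum_(l < m.+1) Bn l l (fun y => usubmx (gco (m - l) y)) w z = if m == k then phi else 0.
Hypothesis dcoef : forall m, (1 <= m <= k)%N ->
  \sum_(l < m.+1) Bn l l (fun y => dsubmx (gco (m - l) y)) w z = 0.
Local Notation c := (fun t : R => z + \sum_(1 <= j < k.+1) (t ^+ j / j`!%:R) *: w j).

Lemma lo_gco_sum m (p : 'cV[R]_(d + e) -> 'cV[R]_m) (psi : 'cV[R]_m) : lin_like p -> (0 < k)%N ->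
  (forall q, (1 <= q <= k)%N ->
    \sum_(l < q.+1) Bn l l (fun y => p (gco (q - l) y)) w z = if q == k then psi else 0) ->
  lo (nbhs (0 : R)) id k (fun t => \sum_(i < k.+1) t ^+ i *: p (gco i (c t)) - t ^+ k *: psi).
Proof.
move=> lp k0 pc.
have pP i : (i <= k)%N -> PCr (k - i) B (fun (_ : R) y => p (gco i y)).
  move=> ik; apply: (PCr_comp (B := setT) oB openT _ (PCr_lin _ _ _ lp) (gco_PCr ik)) => //.
have c1 : continuous (fun _ : R => z) by move=> x; exact: cst_continuous.
have c2 : forall j : nat, continuous (fun _ : R => col_mx (0 : 'cV[R]_d) (gam j)) by move=> j x; exact: cst_continuous.
have := lo_nbhs2 (lo_faadibruno_sum (p0 := (0 : R)) oB pP c1 c2 Bz).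
apply: lo_eq; apply: filterE => t /=; congr (_ - _).
have p0 : p 0 = 0 by have := lp.2 (-1) 0 0; rewrite scaler0 addr0 scaleN1r addNr.
rewrite (bigD1 ord_max) //= [X in _ + X]big1 ?addr0 => [|[q qk] /= qm].
  by rewrite pc ?k0 ?leqnn // eqxx.
have kq : q != k by []; clear qm; rewrite ltnS in qk; case: q qk kq => [|q] qk qm.
  (* Order 0 vanishes because [z] is the initial value of a periodic orbit of the unperturbed
     system. *)
  by rewrite big_ord1 /= /gco /= hz scaler0 mulmx0 p0 scaler0.
by rewrite pc // (negbTE (_ : q.+1 != k)) ?scaler0.
Qed.

(** Up to o(t^k), [h] is Y(c t) times the sum of t^i g_i(c t). The recursions for gamma_j and f_i
    kill all coefficients of that sum except the upper one of order k, and Y(c t) may be replaced by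
    Y(z) since the error carries the factor t^k. *)
Lemma curve_expansion : (0 < k)%N ->
  lo (nbhs (0 : R)) id k (fun t => h (ext (c t) t) - t ^+ k *: (Y z *m col_mx phi 0)).
Proof.
move=> k0; have cz : c @ (0 : R) --> z by exact: cvg_curve.
have cB : \forall t \near (0 : R), B (c t).
  by apply: cz; exact: open_nbhs_nbhs.
have cY : (fun t => Y (c t)) @ (0 : R) --> Y z.
  apply: (@cvg_comp _ _ _ c Y _ _ _ cz).
  apply: (@continuous_comp _ _ _ (fun y => (0 : R, y)) (fun q => Y q.2)).
    by apply: (continuous_pair (f := fun=> 0 : R) (g := id)); [exact: cst_continuous|exact: cvg_id].
  exact: (PCr_cont YB).
have L1 : lo (nbhs (0 : R)) id k (fun t => h (ext (c t) 0 + t *: pdir (d + e)) -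
    \sum_(i < k.+1) (t ^+ i / i`!%:R) *: iterD h (nseq i (pdir (d + e))) (ext (c t) 0)).
  apply: (lo_taylor (p := fun=> 0 : R) (y := fun t => ext (c t) 0) oA (PCrS hA) cpdir Bz).
  - exact: cvg_cst.
  - by apply: (@cvg_comp _ _ _ c (fun z => ext z 0) _ _ _ cz); exact: continuous_ext.
  - exact: cvg_id.
pose G t := \sum_(i < k.+1) t ^+ i *: gco i (c t).
pose H t := G t - t ^+ k *: col_mx phi 0.
have LH : lo (nbhs (0 : R)) id k H.
  have lu := lo_gco_sum (lin_like_usubmx d e) k0 ucoef.
  have ld : lo (nbhs (0 : R)) id k (fun t => \sum_(i < k.+1) t ^+ i *: dsubmx (gco i (c t)) - t ^+ k *: 0).
    by apply: (lo_gco_sum (lin_like_dsubmx d e) k0) => q qk; rewrite dcoef // if_same.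
  move=> eta eta0; have e2 : 0 < eta / 2 by rewrite divr_gt0.
  apply: filterS2 (lu _ e2) (ld _ e2) => t h1 h2; apply: le_trans (norm_le_sub _) _.
  have -> : usubmx (H t) = \sum_(i < k.+1) t ^+ i *: usubmx (gco i (c t)) - t ^+ k *: phi.
    rewrite /H /G; rewrite linearB linearZ /= col_mxKu linear_sum /=; congr (_ - _).
    by apply: eq_bigr => i _; rewrite linearZ.
  have -> : dsubmx (H t) = \sum_(i < k.+1) t ^+ i *: dsubmx (gco i (c t)) - t ^+ k *: 0.
    rewrite /H /G; rewrite linearB linearZ /= col_mxKd linear_sum /=; congr (_ - _).
    by apply: eq_bigr => i _; rewrite linearZ.
  by apply: le_trans (lerD h1 h2) _; rewrite -mulrDl -splitr.
pose C := (d + e)%:R * (`|Y z| + 1); have C0 : 0 <= C by rewrite mulr_ge0 // addr_ge0.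
have Y1 : \forall t \near (0 : R), `|Y (c t)| <= `|Y z| + 1.
  move/cvgrPdist_le: cY => /(_ _ ltr01); apply: filterS => t ht.
  rewrite -[Y (c t)](subrK (Y z)); apply: le_trans (ler_normD _ _) _.
  by rewrite distrC addrC lerD2l.
have L2 : lo (nbhs (0 : R)) id (k + 0) (fun t => Y (c t) *m H t).
  apply: (lo_scale C0 LH); apply: filterS Y1 => t ht; rewrite expr0 mulr1.
  apply: le_trans (mulmx_norm_le _ _) _; rewrite ler_wpM2r // ler_wpM2l //.
have L3 : lo (nbhs (0 : R)) id k (fun t => t ^+ k *: ((Y (c t) - Y z) *m col_mx phi 0)).
  move=> eta eta0; pose K := (d + e)%:R * `|col_mx phi (0 : 'cV[R]_e)| + 1.
  have K0 : 0 < K by rewrite ltr_wpDl // mulr_ge0.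
  move/cvgrPdist_le: cY => /(_ _ (divr_gt0 eta0 K0)); apply: filterS => t ht.
  rewrite normrZ normrX mulrC ler_wpM2r ?exprn_ge0 //.
  apply: le_trans (mulmx_norm_le _ _) _; rewrite distrC in ht.
  apply: (@le_trans _ _ (`|Y (c t) - Y z| * K)).
    by rewrite mulrAC mulrC ler_wpM2l // lerDl.
  by rewrite -ler_pdivlMr.
rewrite addn0 in L2; apply: lo_eq (lo_add (lo_add L1 L2) L3).
apply: filterS cB => t Bt; rewrite -extE.
have -> : \sum_(i < k.+1) (t ^+ i / i`!%:R) *: iterD h (nseq i (pdir (d + e))) (ext (c t) 0) =
    Y (c t) *m G t.
  rewrite /G mulmx_sumr; apply: eq_bigr => i _.
  rewrite -scalemxAr /gco mulmxA mulmxV ?mul1mx ?scalerA //.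
  by rewrite unitmxE unitfE; exact: dY.
rewrite /H mulmxBr -scalemxAr mulmxBl scalerBr.
by rewrite !addrA !subrK.
Qed.

End curve.

Section branch.
Context (beta : 'cV[R]_d -> 'cV[R]_e) (gam : 'cV[R]_d -> nat -> 'cV[R]_e)
  (f : 'cV[R]_d -> 'cV[R]_d) (a0 : 'cV[R]_d) (M : 'M[R]_d).
Local Notation zb a := (col_mx a (beta a)).
Local Notation z0 := (zb a0).
Local Notation w a := (fun j => col_mx 0 (gam a j)).
Hypothesis k_gt0 : (0 < k)%N.
Hypothesis Bz0 : B z0.
Hypothesis cbeta : {for a0, continuous beta}.
Hypothesis dh : forall z v, B z -> 'D_(ext v 0) h (ext z 0) = (Y z - 1%:M) *m v.
Hypothesis hz : \forall a \near a0, h (ext (zb a) 0) = 0.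
Hypothesis ucoef : \forall a \near a0, forall m, (1 <= m <= k)%N ->
  \sum_(l < m.+1) Bn l l (fun y => usubmx (gco (m - l) y)) (w a) (zb a) = if m == k then f a else 0.
Hypothesis dcoef : \forall a \near a0, forall m, (1 <= m <= k)%N ->
  \sum_(l < m.+1) Bn l l (fun y => dsubmx (gco (m - l) y)) (w a) (zb a) = 0.
Hypothesis detD : \det (drsubmx (1%:M - invmx (Y z0) : 'M[R]_(d + e, d + e))) != 0.
Hypothesis fa0 : f a0 = 0.
Hypothesis df : forall eta, 0 < eta -> \forall a \near a0, `|f a - M *m (a - a0)| <= eta * `|a - a0|.
Hypothesis detM : \det M != 0.

Let A0 := invmx (Y z0).
(** Reorders ((a, eps), b) as ((a, b), eps): the implicit function theorem solves for the last
    block, which has to be b, whereas [h] takes the parameter last. *)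
Let shuf (x : 'cV[R]_(d + 1 + e)) : 'cV[R]_(d + e + 1) :=
  col_mx (col_mx (usubmx (usubmx x)) (dsubmx x)) (dsubmx (usubmx x)).
Let H x := A0 *m h (shuf x).
Let B1 : set 'cV[R]_(d + 1 + e) := [set x | A (shuf x)].

Let shufE a t b : shuf (col_mx (ext a t) b) = ext (col_mx a b) t.
Proof. by rewrite /shuf col_mxKu col_mxKd /ext col_mxKu col_mxKd. Qed.

Let lin_shuf : lin_like shuf.
Proof.
split=> [x|c x v].
  have cu := (lin_like_usubmx (R := R) (d + 1) e).1.
  apply: (@continuous_col_mx _ _ _ _ (fun x => col_mx (usubmx (usubmx x)) (dsubmx x)) (fun x => dsubmx (usubmx x))).
    apply: (@continuous_col_mx _ _ _ _ (fun x => usubmx (usubmx x)) dsubmx).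
      exact: (continuous_comp (cu x) ((lin_like_usubmx d 1).1 _)).
    exact: (lin_like_dsubmx (d + 1) e).1.
  exact: (continuous_comp (cu x) ((lin_like_dsubmx d 1).1 _)).
by rewrite /shuf !linearP /= !scale_col_mx !add_col_mx.
Qed.

Let oB1 : open B1.
Proof. exact: open_lin_preimage lin_shuf oA. Qed.

Let H_PCr : PCr k.+1 B1 (fun _ : R => H).
Proof.
apply: (PCr_mulmx oB1); first exact: PCr_cst.
exact: (PCr_comp oB1 oA (fun _ z Bz => Bz) hA (PCr_lin _ _ _ lin_shuf)).
Qed.

Let uY : Y z0 \in unitmx.
Proof. by rewrite unitmxE unitfE; exact: dY. Qed.

Let Q x := dsubmx (H x).
Let F x := usubmx (H x).

Let Q_PCr : PCr k.+1 B1 (fun _ : R => Q).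
Proof.
by apply: (PCr_comp (B := setT) oB1 openT _ (PCr_lin _ _ _ (lin_like_dsubmx d e)) H_PCr).
Qed.

Let F_PCr : PCr k.+1 B1 (fun _ : R => F).
Proof.
by apply: (PCr_comp (B := setT) oB1 openT _ (PCr_lin _ _ _ (lin_like_usubmx d e)) H_PCr).
Qed.

Let x0 := col_mx (ext a0 0) (beta a0).

Let Bx0 : B1 x0.
Proof. by rewrite /B1 /x0 /= shufE. Qed.

Let Qx0 : Q x0 = 0.
Proof. by rewrite /Q /H /x0 shufE (nbhs_singleton hz) mulmx0 linear0. Qed.

(** The z-derivative of the displacement is Y - 1, which the preconditioner turns into 1 - Y^-1; the
    lower right block is Delta. This is where hypothesis (i) enters. *)
Let partialQ : partial_mx Q x0 = drsubmx (1%:M - A0 : 'M[R]_(d + e, d + e)).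
Proof.
apply/matrixP => i j; rewrite mxE.
have e0 : (0 : 'cV[R]_(d + 1)) = ext 0 0.
  by rewrite /ext -[LHS]vsubmxK !linear0; congr col_mx; apply/matrixP => ? ?; rewrite !mxE.
have D1 : is_derive x0 (col_mx 0 (ei j) : 'cV[R]_(d + 1 + e)) shuf (ext (col_mx 0 (ei j)) 0).
  by have := is_derive_lin x0 (col_mx 0 (ei j)) lin_shuf; rewrite {2}e0 shufE.
have := PCr_chain (0 : R) oA hA Bx0 D1.
rewrite {1}/x0 shufE dh // => D2.
have := is_derive_lin_comp (lin_like_dsubmx d e) (is_derive_lin_comp (lin_like_mulmx A0) D2).
rewrite mulmxA mulmxBr mulmx1 [A0 *m Y z0]mulVmx // => -[_ D3].
have -> : 'D_(col_mx 0 (ei j)) Q x0 = dsubmx ((1%:M - A0) *m col_mx 0 (ei j)) by exact: D3.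
rewrite -[1%:M - A0 in LHS]submxK mul_block_col !mulmx0 !add0r col_mxKd.
by rewrite /ei -colE mxE.
Qed.

(* [bt] solves the lower block of the preconditioned equation, and [E] is the upper block along
   it. Comparing [bt] with the truncated curve of the gamma_j shows that the coefficients of [E]
   of order less than [k] vanish and that the one of order [k] is f + o(|f|) near [a0]. *)
Lemma bifurcation_branch : exists2 eps1, 0 < eps1 & exists2 C, 0 <= C &
  forall t : R, 0 < `|t| < eps1 -> exists z, [/\ `|z - z0| <= C * `|t|, A (ext z t) & h (ext z t) = 0].
Proof.
have detQ : \det (partial_mx Q x0) != 0 by rewrite partialQ.
have [rho [del [C [bt [rho0 del0 bt0 btP [btC btPCr]]]]]] :=
  implicit_function oB1 Q_PCr Bx0 Qx0 detQ.
pose Bp : set 'cV[R]_(d + 1) := [set p | `|p - ext a0 0| < rho].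
have oBp : open Bp by exact: open_normB.
have Bp0 : Bp (ext a0 0) by rewrite /Bp /= subrr normr0.
pose E p := F (col_mx p (bt p)).
have EP : PCr k.+1 Bp (fun _ : R => E).
  apply: (PCr_comp oBp oB1 _ F_PCr) => [_ p Bpp|]; first by have [] := btP p Bpp.
  apply: (PCr_col_mx oBp _ btPCr).
  by apply: PCr_lin; split=> [x|//]; exact: cvg_id.
have [r1 r10 [K1 K10 H1]] := PCr_lip oBp btPCr Bp0.
have [r2 r20 [K2 K20 H2]] := PCr_lip oB1 F_PCr Bx0.
(* Replacing [bt] by a nearby [b] changes the upper block by at most a multiple of the lower one, by
   the residual bound for [bt] and the Lipschitz bound for [F]. *)
have [K3 K30 [r3 r30 [r3r H3]]] : exists2 K3, 0 <= K3 & exists2 r3, 0 < r3 & r3 <= rho /\ forall p b,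
    `|p - ext a0 0| < r3 -> `|b - beta a0| < r3 ->
    `|E p - F (col_mx p b)| <= K3 * `|Q (col_mx p b)|.
  exists (K2 * `|C|); first by rewrite mulr_ge0.
  pose r3 := Num.min (Num.min rho del) (Num.min r1 (r2 / (K1 + 1))).
  have K11 : 0 < K1 + 1 by rewrite ltr_wpDl.
  have r30 : 0 < r3 by rewrite !lt_min rho0 del0 r10 divr_gt0.
  exists (Num.min r3 r2); first by rewrite lt_min r30.
  split=> [|p b]; first by rewrite /r3 !ge_min lexx.
  rewrite !lt_min => /andP[/andP[/andP[p1 p2] /andP[p3 p4]] p5].
  move=> /andP[/andP[/andP[b1 b2] /andP[b3 b4]] b5].
  have btp : `|bt p - beta a0| < r2.
    have := H1 (ext a0 0) p; rewrite subrr normr0 bt0 => /(_ r10 p3) btl.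
    apply: le_lt_trans btl _; rewrite ltr_pdivlMr // in p4.
    by apply: le_lt_trans p4; rewrite mulrC ler_wpM2l // lerDl.
  have n1 : `|col_mx p b - x0| < r2 by rewrite /x0 col_mxB; exact: norm_col_mx.
  have n2 : `|col_mx p (bt p) - x0| < r2 by rewrite /x0 col_mxB; exact: norm_col_mx.
  apply: le_trans (H2 _ _ n1 n2) _; rewrite -mulrA ler_wpM2l //.
  rewrite col_mxB subrr norm_col_mx0; apply: le_trans (btC p b p1 b2) _.
  by rewrite ler_wpM2r // ler_norm.
have K31 : 0 < K3 + 1 by rewrite ltr_wpDl.
have K32 : 0 < K3 + 2 by rewrite ltr_wpDl.
have czb : {for a0, continuous (fun a => zb a)}.
  by apply: (@continuous_col_mx _ _ _ _ id beta) => //; exact: cvg_id.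
have key eta : 0 < eta -> \forall a \near a0,
    (forall c, (c < k)%N -> iterD E (nseq c (pdir d)) (ext a 0) = 0) /\
    `|(k`!%:R)^-1 *: iterD E (nseq k (pdir d)) (ext a 0) - f a| <= eta * `|f a|.
  move=> eta0; pose N : R := (d + e)%:R + 1; have N0 : 0 < N by rewrite ltr_wpDl.
  have e1 : 0 < eta / (K3 + 1) / N by rewrite !divr_gt0.
  have nB : \forall a \near a0, B (zb a) by apply: czb; exact: open_nbhs_nbhs.
  have nY : \forall a \near a0, `|A0 *m Y (zb a) - 1%:M| <= eta / (K3 + 1) / N.
    have YP : PCr k B (fun (_ : R) z => A0 *m Y z) by apply: (PCr_mulmx oB) YB; exact: PCr_cst.
    have cY : {for a0, continuous (fun a => A0 *m Y (zb a))}.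
      apply: (@continuous_comp _ _ _ (fun a => (0 : R, zb a)) (fun q => A0 *m Y q.2)).
        by apply: (continuous_pair (f := fun=> 0 : R)) => //; exact: cst_continuous.
      exact: (PCr_cont YP).
    by have := continuous_dist_le cY e1; rewrite [A0 *m _]mulVmx.
  have nb : \forall a \near a0, `|beta a - beta a0| < r3 / 2.
    by have := continuous_dist_le cbeta (divr_gt0 r30 (ltr0Sn R 3)); apply: filterS => a; lra.
  have na : \forall a \near a0, `|a - a0| < r3.
    by apply/near_ballP; exists r3.
  apply: filterS3 (filterI hz (filterI ucoef dcoef)) (filterI nB nY) (filterI nb na).
  move=> a [hza [ua da]] [Ba Ya] [ba aa].
  have L := curve_expansion Ba hza ua da k_gt0.
  pose b (t : R) := beta a + \sum_(1 <= j < k.+1) (t ^+ j / j`!%:R) *: gam a j.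
  have cE t : zb a + \sum_(1 <= j < k.+1) (t ^+ j / j`!%:R) *: col_mx 0 (gam a j) = col_mx a (b t).
    have -> : \sum_(1 <= j < k.+1) (t ^+ j / j`!%:R) *: col_mx 0 (gam a j) =
        col_mx (0 : 'cV[R]_d) (\sum_(1 <= j < k.+1) (t ^+ j / j`!%:R) *: gam a j).
      rewrite -[LHS]vsubmxK !linear_sum /=; congr col_mx.
        by rewrite big1 // => j _; rewrite linearZ /= col_mxKu scaler0.
      by apply: eq_bigr => j _; rewrite linearZ /= col_mxKd.
    by rewrite add_col_mx addr0.
  have cb : b @ (0 : R) --> beta a by exact: cvg_curve.
  pose ps := col_mx (f a) (0 : 'cV[R]_e).
  have nps : `|ps| <= `|f a|.
    by apply: le_trans (norm_le_sub _) _; rewrite col_mxKu col_mxKd normr0 addr0.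
  pose K := (K3 + 1) * (eta / (K3 + 1) * `|f a|).
  have K0 : 0 <= K by rewrite !mulr_ge0 ?invr_ge0 // ltW.
  have psi_le : `|A0 *m (Y (zb a) *m ps) - ps| <= eta / (K3 + 1) * `|f a|.
    rewrite mulmxA -{2}[ps]mul1mx -mulmxBl; apply: le_trans (mulmx_norm_le _ _) _.
    apply: ler_pM => //; apply: (@le_trans _ _ (N * (eta / (K3 + 1) / N))).
      by apply: ler_pM => //; rewrite lerDl.
    by rewrite mulrC divfK // gt_eqF.
  have LH th : 0 < th -> \forall t \near (0 : R),
      `|H (col_mx (ext a t) (b t)) - t ^+ k *: ps| <= (eta / (K3 + 1) * `|f a| + th) * `|t| ^+ k.
    move=> th0; pose X := (d + e)%:R * `|A0| + 1; have X0 : 0 < X by rewrite ltr_wpDl // mulr_ge0.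
    apply: filterS (L _ (divr_gt0 th0 X0)) => t; rewrite cE -shufE.
    set ht := h _ => hh.
    have -> : H (col_mx (ext a t) (b t)) - t ^+ k *: ps =
       A0 *m (ht - t ^+ k *: (Y (zb a) *m ps)) + t ^+ k *: (A0 *m (Y (zb a) *m ps) - ps).
      by rewrite /H -/ht mulmxBr -scalemxAr scalerBr addrA subrK.
    apply: le_trans (ler_normD _ _) _; rewrite mulrDl addrC; apply: lerD.
      by rewrite normrZ normrX mulrC ler_wpM2r // exprn_ge0.
    apply: le_trans (mulmx_norm_le _ _) _.
    apply: (@le_trans _ _ (X * (th / X * `|t| ^+ k))); first by apply: ler_pM; rewrite ?mulr_ge0 // lerDl.
    by rewrite mulrA [X * _]mulrC divfK // gt_eqF.
  have Ba0p : Bp (ext a 0).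
    by apply: norm_ext_lt; [exact: lt_le_trans r3r|rewrite normr0].
  have LE : lo (nbhs (0 : R)) id k (fun t : R => E (ext a 0 + t *: pdir d) -
      \sum_(c < k.+1) (t ^+ c / c`!%:R) *: iterD E (nseq c (pdir d)) (ext a 0)).
    have cpd : continuous (fun _ : R => pdir (R := R) d) by move=> x; exact: cst_continuous.
    by apply: (lo_taylor (p := fun=> 0 : R) (y := fun=> ext a 0) oBp (PCrS EP) cpd Ba0p);
      [exact: cvg_cst|exact: cvg_cst|exact: cvg_id].
  have nbt : \forall t \near (0 : R), `|b t - beta a| <= r3 / 2.
    move/cvgrPdist_le: cb => /(_ (r3 / 2)); rewrite divr_gt0 // => /(_ isT).
    by apply: filterS => t; rewrite distrC.
  have nt : \forall t \near (0 : R), `|t| < r3.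
    by apply/nbhs_ballP; exists r3 => // t; rewrite /ball /= sub0r normrN.
  have [th th0|lowa leada] := lead_coef_bound (k := k)
      (a := fun c => (c`!%:R)^-1 *: iterD E (nseq c (pdir d)) (ext a 0)) (f := f a) K0.
    have th1 : 0 < th / (K3 + 2) by rewrite divr_gt0.
    have FF : Filter (nbhs (0 : R)) by exact: nbhs_filter.
    have := @filterI _ _ FF _ _ (@filterI _ _ FF _ _ nbt nt) (@filterI _ _ FF _ _ (LH _ th1) (LE _ th1)).
    move=> /nbhs_ballP[rr rr0 Hr]; exists rr => // t /andP[t0 tr].
    have := Hr t; rewrite /ball /= sub0r normrN gtr0_norm // => /(_ tr)[[bt1 t1] [h1 h2]].
    rewrite -extE in h2.
    have hp : `|ext a t - ext a0 0| < r3 by apply: norm_ext_lt => //; rewrite gtr0_norm.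
    have hb : `|b t - beta a0| < r3.
      have -> : b t - beta a0 = (b t - beta a) + (beta a - beta a0) by rewrite addrA subrK.
      by apply: le_lt_trans (ler_normD _ _) _; lra.
    have h3 := H3 _ _ hp hb.
    set x := col_mx (ext a t) (b t) in h1 h3.
    have hQ : `|Q x| <= `|H x - t ^+ k *: ps|.
      have -> : Q x = dsubmx (H x - t ^+ k *: ps) by rewrite linearB linearZ /= col_mxKd scaler0 subr0.
      exact: norm_dsubmx.
    have hF : `|F x - t ^+ k *: f a| <= `|H x - t ^+ k *: ps|.
      have -> : F x - t ^+ k *: f a = usubmx (H x - t ^+ k *: ps) 
        by rewrite [RHS]linearB [X in _ = _ - X]linearZ /= [usubmx ps]col_mxKu.
      exact: norm_usubmx.
    set S := \sum_(c < k.+1) _ in h2.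
    have -> : \sum_(c < k.+1) t ^+ c *: (c`!%:R^-1 *: iterD E (nseq c (pdir d)) (ext a 0)) = S.
      by apply: eq_bigr => c _; rewrite scalerA.
    have -> : S - t ^+ k *: f a = - (E (ext a t) - S) + (E (ext a t) - F x) + (F x - t ^+ k *: f a).
      by rewrite opprB !addrA !subrK.
    apply: le_trans (ler_normD _ _) _; apply: le_trans (lerD (ler_normD _ _) (lexx _)) _; rewrite normrN.
    apply: le_trans (lerD (lerD h2 h3) hF) _.
    apply: (@le_trans _ _ (th / (K3 + 2) * t ^+ k + (K3 + 1) * `|H x - t ^+ k *: ps|)).
      by rewrite -addrA lerD2l mulrDl mul1r lerD2r ler_wpM2l.
    apply: le_trans (lerD (lexx _) (ler_wpM2l (ltW K31) h1)) _.
    rewrite le_eqVlt; apply/orP; left; apply/eqP; rewrite /K.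
    by field; rewrite !gt_eqF.
  split=> [c ck|].
    have := lowa c ck => /eqP; rewrite scaler_eq0 gt_eqF ?invr_gt0 ?ltr0n ?fact_gt0 //=.
    by move/eqP.
  by apply: le_trans leada _; rewrite /K mulrA [(K3 + 1) * _]mulrC divfK // gt_eqF.
have low : \forall a \near a0, forall c, (c < k)%N -> iterD E (nseq c (pdir d)) (ext a 0) = 0.
  by apply: filterS (key _ ltr01) => a [].
have lead eta : 0 < eta -> \forall a \near a0,
    `|(k`!%:R)^-1 *: iterD E (nseq k (pdir d)) (ext a 0) - f a| <= eta * `|f a|.
  by move=> eta0; apply: filterS (key _ eta0) => a [].
have [e1 e10 [C1 C10 Hz]] := zero_branch oBp EP Bp0 low lead fa0 df detM.
pose D := Num.max C1 1; have D1 : 1 <= D by rewrite le_max lexx orbT.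
have D0 : 0 < D by exact: lt_le_trans D1.
pose C2 := D * (1 + K1).
have C20 : 0 <= C2 by rewrite mulr_ge0 ?addr_ge0 // ltW.
exists (Num.min e1 (r1 / (D + 1))); first by rewrite lt_min e10 divr_gt0 // addr_gt0.
exists C2 => // t /andP[t0]; rewrite lt_min => /andP[te1 tr1].
have [|a [aa Ba Ea]] := Hz t; first by rewrite t0.
have pa : `|ext a t - ext a0 0| <= D * `|t|.
  apply: norm_ext_le; last by rewrite ler_peMl.
  by apply: le_trans aa _; rewrite ler_wpM2r // le_max lexx.
have [bta Bbt Qbt] := btP _ Ba.
exists (col_mx a (bt (ext a t))); split.
- rewrite col_mxB; apply: le_trans (norm_le_sub _) _; rewrite col_mxKu col_mxKd.
  have h1 : `|a - a0| <= D * `|t| by apply: le_trans aa _; rewrite ler_wpM2r // le_max lexx.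
  have h2 : `|bt (ext a t) - beta a0| <= K1 * (D * `|t|).
    have := H1 (ext a0 0) (ext a t); rewrite subrr normr0 bt0 => /(_ r10).
    move=> btl; apply: le_trans (btl _) _; last by rewrite ler_wpM2l.
    apply: le_lt_trans pa _; move: tr1; rewrite ltr_pdivlMr ?addr_gt0 //.
    by apply: le_lt_trans; rewrite mulrC ler_wpM2l // lerDl.
  by apply: le_trans (lerD h1 h2) _; rewrite /C2 le_eqVlt; apply/orP; left; apply/eqP; ring.
- by rewrite -shufE.
- have H0 : H (col_mx (ext a t) (bt (ext a t))) = 0.
    by rewrite -[LHS]vsubmxK -/(Q _) Qbt [usubmx _]Ea col_mx0.
  by move/(congr1 (mulmx (Y z0))): H0; rewrite /H mulmxA mulmxV // mul1mx mulmx0 shufE.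
Qed.

End branch.
End LyapunovSchmidt.

(** * Averaged functions *)

Section AveragedFunctions.
Context {R : realType} (n : nat) (T : R) (ts : nat -> R).
Hypothesis ts0 : ts 0%N = 0.
Hypothesis tsn : ts n = T.
Hypothesis tsS : forall j, (j < n)%N -> ts j < ts j.+1.
Hypothesis n_gt0 : (0 < n)%N.
Local Notation T0 := (T_ge0 ts0 tsn tsS).
Local Notation psol := (psol n T ts).

Lemma psol_clamp N (Om : set 'cV[R]_N) f phi : psol Om f phi -> psol Om f (phi \o clampR 0 T).
Proof.
move=> [cphi Ophi dphi]; split=> [t|t tT|j t jn jt].
- by apply: continuous_comp; [exact: continuous_clampR T0 t|exact: cphi].
- by apply: Ophi; exact: clampR_itv T0.
have tT := piece_itv ts0 tsn tsS jn jt; rewrite /= clampR_id //.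
have := dphi j t jn jt; apply: near_eq_is_derive.
have : \forall s \near t, s \in `]ts j, ts j.+1[ by apply: near_in_itvoo; rewrite in_itv.
apply: filterS => s; rewrite in_itv /= => js.
by rewrite clampR_id //; exact: (piece_itv ts0 tsn tsS jn js).
Qed.

(** Each little-o estimate near (t, 0) holds on a whole neighbourhood of t, so compactness of [0, T]
    makes the estimates uniform. *)
Lemma lo_uniform (W : normedModType R) k (g : R * R -> W) :
  (forall t, 0 <= t <= T -> lo (nbhs (t, 0 : R)) snd k g) ->
  forall eta, 0 < eta -> exists2 rho, 0 < rho & forall t e : R, 0 <= t <= T -> `|e| < rho ->
    `|g (t, e)| <= eta * `|e| ^+ k.
Proof.
move=> gl eta eta0.
pose Q rho t := forall e : R, `|e| < rho -> `|g (t, e)| <= eta * `|e| ^+ k.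
have /compact_near_coveringP H := @segment_compact _ (0 : R) T.
have : \forall rho \near (0 : R)^'+, `[0, T]%classic `<=` Q rho.
  apply: H => t0; rewrite /= in_itv/= => t0T.
  have [[B1 B2] /= [nB1 nB2] BB] := gl t0 t0T _ eta0.
  have [r r0 hr] := (nbhs_ballP _ _).1 nB2.
  exists (B1, [set rho | rho < r]) => /=.
    by split=> //; apply: nbhs_right_lt.
  move=> [t rho] /= [B1t rr] e erho; apply: (BB (t, e)); split=> //; apply: hr.
  by rewrite /ball /= sub0r normrN; exact: lt_trans rr.
move=> HQ; near (0 : R)^'+ => rho; exists rho => // t e tT.
by have := near HQ rho; apply => //=; rewrite in_itv.
Unshelve. all: by end_near. Qed.

Section avg.
Context (N k : nat) (D : set 'cV[R]_N) (F : nat -> nat -> R -> 'cV[R]_N -> 'cV[R]_N).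
Hypothesis oD : open D.
Hypothesis FD : forall i j, (i <= k)%N -> (j < n)%N -> PCr k.+1 D (F i j).

(** The integrand of y_i in Faa di Bruno form: i! times the coefficient of order i of the sum of e^j
    F_j along the expansion of the orbit. *)
Definition avrhs (x0 : R -> 'cV[R]_N) (y : nat -> R -> 'cV[R]_N) i j t :=
  i`!%:R *: \sum_(l < i.+1) Bn l l (F (i - l) j t) (y^~ t) (x0 t).

(* The part of the right-hand side that does not involve [y i.+1]; the rest is linear in it. *)
Definition avlow (x0 : R -> 'cV[R]_N) (y : nat -> R -> 'cV[R]_N) i j t :=
  (i.+1)`!%:R *: (\sum_(l < i.+1) Bn l l (F (i.+1 - l) j t) (y^~ t) (x0 t) +
                  Bn i i.+1 (F 0 j t) (y^~ t) (x0 t)).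

Lemma avrhsS x0 y i j t : (j < n)%N -> D (x0 t) -> avrhs x0 y i.+1 j t =
  \sum_q y i.+1 t q 0 *: 'D_(ei q) (F 0 j t) (x0 t) + avlow x0 y i j t.
Proof.
move=> jn Dx; rewrite /avrhs /avlow.
pose B l := Bn l l (F (i.+1 - l) j t) (y^~ t) (x0 t).
have -> : \sum_(l < i.+2) Bn l l (F (i.+1 - l) j t) (y^~ t) (x0 t) = \sum_(l < i.+1) B l + B i.+1.
  by rewrite -(big_mkord xpredT B) big_nat_recr // big_mkord.
have -> : B i.+1 = Bn i i.+1 (F 0 j t) (y^~ t) (x0 t) +
    ((i.+1)`!%:R)^-1 *: 'D_(y i.+1 t) (F 0 j t) (x0 t) by rewrite /B subnn Bn_diag.
rewrite addrA scalerDr [RHS]addrC.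
congr (_ + _); rewrite scalerA mulfV ?scale1r ?pnatr_eq0 -?lt0n ?fact_gt0 //.
exact: (PCr_derive_sum t (y i.+1 t) oD (FD (leq0n k) jn) Dx).
Qed.

Lemma avlow_eq x0 y y' i j t : (forall q, (1 <= q <= i)%N -> y q t = y' q t) ->
  avlow x0 y i j t = avlow x0 y' i j t.
Proof.
move=> yy; rewrite /avlow; congr (_ *: (_ + _)); last by apply: Bn_eq => q qi; exact: yy.
apply: eq_bigr => l _; apply: Bn_eq => q /andP[q1 ql]; apply: yy; rewrite q1 /=.
by apply: leq_trans ql _; rewrite -ltnS.
Qed.

Lemma avrhs_eq x0 y y' i j t : (forall q, (1 <= q <= i)%N -> y q t = y' q t) ->
  avrhs x0 y i j t = avrhs x0 y' i j t.
Proof.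
move=> yy; rewrite /avrhs; congr (_ *: _); apply: eq_bigr => l _.
apply: Bn_eq => q /andP[q1 ql]; apply: yy; rewrite q1 /=.
by apply: leq_trans ql _; rewrite -ltnS.
Qed.

Section base.
Context (x0 : R -> 'cV[R]_N).
Hypothesis cx : continuous x0.
Hypothesis Dx : forall t, D (x0 t).

Lemma continuous_scale_sum (c : R) m (g : 'I_m -> R -> 'cV[R]_N) :
  (forall i, continuous (g i)) -> continuous (fun t => c *: \sum_(i < m) g i t).
Proof.
by move=> cg t; apply: cvgZ; [exact: cvg_cst|apply: cvg_sumr => i _; exact: cg].
Qed.

Lemma continuous_avrhs y i j : (i <= k)%N -> (j < n)%N -> (forall q, continuous (y q)) ->
  continuous (avrhs x0 y i j).
Proof.
move=> ik jn cy; apply: continuous_scale_sum => -[l li] /=.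
apply: (continuous_Bn oD cy (M := k.+1) _ _ cx Dx); last first.
  by apply: FD => //; apply: leq_trans (leq_subr _ _) ik.
by rewrite ltnS in li; apply: leqW; exact: leq_trans li ik.
Qed.

Lemma continuous_avlow y i j : (i < k)%N -> (j < n)%N -> (forall q, continuous (y q)) ->
  continuous (avlow x0 y i j).
Proof.
move=> ik jn cy t; apply: cvgZ; first exact: cvg_cst.
apply: cvgD; last first.
  have H : continuous (fun t => Bn i i.+1 (F 0 j t) (y^~ t) (x0 t)); last exact: H.
  by apply: (continuous_Bn oD cy (M := k.+1) _ _ cx Dx); [exact: leqW|exact: FD].
apply: cvg_sumr => -[l li] _.
have H : continuous (fun t => Bn l l (F (i.+1 - l) j t) (y^~ t) (x0 t)); last exact: H.
apply: (continuous_Bn oD cy (M := k.+1) _ _ cx Dx); last first.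
  by apply: FD => //; apply: leq_trans (leq_subr _ _) ik.
by rewrite ltnS in li; apply: leqW; apply: leq_trans li _; exact: ltnW.
Qed.

(** By [avrhsS] the equation for y_i is linear in y_i with coefficients built from the earlier ones,
    so the y_i are obtained one after another from [linear_ode]. *)
Lemma averaged_ex : exists y : nat -> R -> 'cV[R]_N, (forall q, continuous (y q)) /\
  forall i, (1 <= i <= k)%N -> y i 0 = 0 /\
  forall j t, (j < n)%N -> ts j < t < ts j.+1 -> is_derive t 1 (y i) (avrhs x0 y i j t).
Proof.
suff H m : (m <= k)%N -> exists y : nat -> R -> 'cV[R]_N, (forall q, continuous (y q)) /\
    forall i, (1 <= i <= m)%N -> y i 0 = 0 /\
    forall j t, (j < n)%N -> ts j < t < ts j.+1 -> is_derive t 1 (y i) (avrhs x0 y i j t).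
  exact: H.
elim: m => [|m IH] mk.
  exists (fun _ _ => 0); split=> [q t|i /andP[i1 i0]]; first exact: cst_continuous.
  by move: (leq_trans i1 i0).
have [y [cy dy]] := IH (ltnW mk).
have ca j q : (j < n)%N -> continuous (fun t => 'D_(ei q) (F 0 j t) (x0 t)).
  move=> jn t.
  apply: (@continuous_comp _ _ _ (fun t => (t, x0 t)) (fun p => 'D_(ei q) (F 0 j p.1) p.2)).
    by apply: continuous_pair; [exact: cvg_id|exact: cx].
  exact: (PCr_cont (PCr_derive (ei q) (FD (leq0n k) jn)) (Dx t)).
have [w [cw w0 dw]] := linear_ode ts0 tsn tsS 0 ca
  (fun j jn => continuous_avlow mk jn cy).
pose y' q := if q == m.+1 then w else y q.
have y'E q t : (q <= m)%N -> y' q t = y q t by rewrite /y' => qm; rewrite ltn_eqF.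
exists y'; split=> [q|i /andP[i1 im]]; first by rewrite /y'; case: ifP.
move: im; rewrite leq_eqVlt ltnS => /orP[/eqP->|im].
  rewrite {1 3}/y' eqxx; split=> // j t jn jt; rewrite avrhsS // /y' eqxx -/y'.
  rewrite (@avlow_eq _ y' y); first exact: dw.
  by move=> q /andP[_ qm]; exact: y'E.
have [yi0 dyi] := dy i (introT andP (conj i1 im)).
rewrite /y' ltn_eqF //; split=> // j t jn jt; rewrite (@avrhs_eq _ _ y); first exact: dyi.
by move=> q /andP[_ qi]; rewrite -/(y' q t) y'E //; apply: leq_trans im.
Qed.

(** The averaged functions are picked by a choice operator and can be identified only through
    uniqueness. Two solutions with the same earlier terms differ by a solution of the homogeneous
    linear equation. *)
Lemma averaged_unique y y' i : (i < k)%N -> continuous (y i.+1) -> continuous (y' i.+1) ->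
  (forall q t, (1 <= q <= i)%N -> 0 <= t <= T -> y q t = y' q t) ->
  y i.+1 0 = 0 -> y' i.+1 0 = 0 ->
  (forall j t, (j < n)%N -> ts j < t < ts j.+1 ->
    is_derive t 1 (y i.+1) (avrhs x0 y i.+1 j t)) ->
  (forall j t, (j < n)%N -> ts j < t < ts j.+1 ->
    is_derive t 1 (y' i.+1) (avrhs x0 y' i.+1 j t)) ->
  forall t, 0 <= t <= T -> y i.+1 t = y' i.+1 t.
Proof.
move=> ik cy cy' yy y0 y'0 dy dy' t tT.
have F0 j : (j < n)%N -> PCr 1 D (F 0 j) by move=> jn; exact: PCr_le (FD (leq0n k) jn).
have [L L0 HL] := lin_field_bound ts0 tsn tsS F0 cx (fun t _ => Dx t).
pose e s := y i.+1 s - y' i.+1 s.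
have ce : continuous e by move=> s; apply: cvgB; [exact: cy|exact: cy'].
have de j s (jn : (j < n)%N) (js : ts j < s < ts j.+1) := is_deriveB (dy j s jn js) (dy' j s jn js).
have := gronwall ts0 tsn tsS L0 (lexx 0) ce de.
have H j s : (j < n)%N -> ts j < s < ts j.+1 ->
    `|avrhs x0 y i.+1 j s - avrhs x0 y' i.+1 j s| <= L * `|e s| + 0.
  move=> jn js; have sT := piece_itv ts0 tsn tsS jn js.
  rewrite !avrhsS // (@avlow_eq _ y y') => [|q qi]; last exact: yy.
  rewrite opprD addrACA subrr !addr0 -sumrB; apply: le_trans (HL j s (e s) jn sT).
  by rewrite le_eqVlt; apply/orP; left; apply/eqP; congr (`|_|); apply: eq_bigr => q _;
    rewrite -scalerBl !mxE.
move=> /(_ H t tT); rewrite /e y0 y'0 subrr normr0 mulr0 addr0 mul0r normr_le0 subr_eq0.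
by move/eqP.
Qed.

End base.
End avg.
End AveragedFunctions.

(** * Expansion of the flow in powers of the parameter *)

Section Expansion.
Context {R : realType} (n : nat) (T : R) (ts : nat -> R).
Hypothesis ts0 : ts 0%N = 0.
Hypothesis tsn : ts n = T.
Hypothesis tsS : forall j, (j < n)%N -> ts j < ts j.+1.
Hypothesis n_gt0 : (0 < n)%N.
Local Notation T0 := (T_ge0 ts0 tsn tsS).
Local Notation psol := (psol n T ts).

Definition par N (s : 'cV[R]_(N + 1)) : R := s (rshift N 0) 0.

Lemma par_ext N (z : 'cV[R]_N) t : par (ext z t) = t.
Proof. by rewrite /par /ext col_mxEd mxE. Qed.

Lemma usub_ext N (z : 'cV[R]_N) t : usubmx (ext z t) = z.
Proof. exact: col_mxKu. Qed.

Lemma ext_par N (s : 'cV[R]_(N + 1)) : ext (usubmx s) (par s) = s.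
Proof.
rewrite -[RHS]vsubmxK; congr col_mx; apply/matrixP => i j.
by rewrite !mxE !ord1.
Qed.

Lemma PCr_exp (P : topologicalType) (U : normedModType R) r (A : set U) (f : P -> U -> R) i :
  open A -> PCr r A f -> PCr r A (fun p x => f p x ^+ i).
Proof.
move=> oA fA; elim: i => [|i IH]; first exact: PCr_cst.
by apply: (PCr_ext oA _ (PCrM oA fA IH)) => p x _; rewrite exprS.
Qed.

Lemma is_derive_sumr (V W : normedModType R) (I : Type) (s : seq I) (f : I -> V -> W)
    (df : I -> W) x v : (forall i, is_derive x v (f i) (df i)) ->
  is_derive x v (fun y => \sum_(i <- s) f i y) (\sum_(i <- s) df i).
Proof.
move=> fd; elim: s => [|i s IH].
  rewrite big_nil (_ : (fun y => _) = cst 0); first exact: is_derive_cst.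
  by apply/funext => y; rewrite big_nil.
rewrite big_cons (_ : (fun y => _) = f i + (fun y => \sum_(j <- s) f j y)).
  exact: is_deriveD.
by apply/funext => y; rewrite big_cons.
Qed.

Context (N k : nat) (eps0 : R) (D : set 'cV[R]_N).
Context (F : nat -> nat -> R -> 'cV[R]_N -> 'cV[R]_N) (G : nat -> R -> 'cV[R]_(N + 1) -> 'cV[R]_N).
Definition edom : set 'cV[R]_(N + 1) := [set s | D (usubmx s) /\ `|par s| < eps0].
Local Notation Om := edom.
Hypothesis oD : open D.
Hypothesis eps0_gt0 : 0 < eps0.
Hypothesis FD : forall i j, (i <= k)%N -> (j < n)%N -> PCr k.+1 D (F i j).
Hypothesis GD : forall j, (j < n)%N -> PCr k.+1 Om (G j).

Definition efld j t (s : 'cV[R]_(N + 1)) : 'cV[R]_(N + 1) :=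
  col_mx (\sum_(i < k.+1) par s ^+ i *: F i j t (usubmx s) + par s ^+ k.+1 *: G j t s) 0.

Lemma open_edom : open Om.
Proof.
apply: openI; first exact: open_lin_preimage (lin_like_usubmx _ _) oD.
apply: (open_lin_preimage (B := [set x : R | `|x| < eps0]) (lin_like_coord _ _)).
have := ball_open (0 : R) eps0; congr open; apply/seteqP; split=> x /=;
  by rewrite /ball /= sub0r normrN.
Qed.

Lemma efld_PCr j : (j < n)%N -> PCr k.+1 Om (efld j).
Proof.
move=> jn; have oO := open_edom.
have Pp : PCr k.+1 Om (fun (_ : R) s => par s) by apply: PCr_lin; exact: lin_like_coord.
apply: (PCr_col_mx oO _ (PCr_cst _ _ _ _)); apply: (PCrD oO).
  have H (i : 'I_k.+1) : PCr k.+1 Om (fun (t : R) s => par s ^+ i *: F i j t (usubmx s)).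
    apply: (PCrZ (s := fun (_ : R) s => par s ^+ i) oO); first exact: PCr_exp.
    have ik : (i <= k)%N by rewrite -ltnS.
    apply: (PCr_comp oO oD _ (FD ik jn) (PCr_lin _ _ _ (lin_like_usubmx _ _))).
    by move=> p s [].
  exact: (PCr_sum _ oO (fun i _ => H i)).
by apply: (PCrZ oO); [exact: PCr_exp|exact: GD].
Qed.

Let efld1 j : (j < n)%N -> PCr 1 Om (efld j).
Proof. by move=> jn; exact: PCr_le (efld_PCr jn). Qed.

Lemma psol_par psi : psol Om efld psi -> forall t, 0 <= t <= T ->
  psi t = ext (usubmx (psi t)) (par (psi 0)).
Proof.
move=> [cpsi _ dpsi] t tT; rewrite -[LHS]ext_par; congr ext.
pose e t := dsubmx (psi t).
have ce : continuous e.
  move=> s; apply: (@continuous_comp _ _ _ psi dsubmx); first exact: cpsi.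
  exact: (lin_like_dsubmx _ _).1.
have : `|e t - e 0| <= (0 : R) - 0.
  apply: (piecewise_dist_le ts0 tsn tsS (de := fun _ _ => 0) (b := fun=> 0) (db := fun=> 0) ce) => // [s|j s jn js].
    exact: cst_continuous.
  split; [|exact: is_derive_cst|by rewrite normr0].
  have := is_derive_lin_comp (lin_like_dsubmx N 1) (dpsi j s jn js).
  by rewrite /efld col_mxKd.
rewrite subrr normr_le0 subr_eq0 => /eqP/(congr1 (fun m : 'cV[R]_1 => m 0 0)).
by rewrite !mxE.
Qed.

Section family.
Context (A : set 'cV[R]_(N + 1)) (Phi : 'cV[R]_(N + 1) -> R -> 'cV[R]_(N + 1)).
Hypothesis oA : open A.
Hypothesis PhiA : flow_family n T ts Om efld A Phi.
Hypothesis PhiO : forall s t, A s -> Om (Phi s t).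
Context (z : 'cV[R]_N).
Hypothesis Az : A (ext z 0).
Local Notation psi := (Phi (ext z 0)).
Local Notation x0 := (fun t => usubmx (psi t)).
Context (y : nat -> R -> 'cV[R]_N).
Hypothesis cy : forall q, continuous (y q).
Hypothesis y0 : forall i, (1 <= i <= k)%N -> y i 0 = 0.
Hypothesis dy : forall i j t, (1 <= i <= k)%N -> (j < n)%N -> ts j < t < ts j.+1 ->
  is_derive t 1 (y i) (avrhs F x0 y i j t).

(** [p] is the expansion of the orbit truncated at order k; [q] is its time derivative, as [dp]
    shows. *)
Let p t e := x0 t + \sum_(1 <= i < k.+1) (e ^+ i / i`!%:R) *: y i t.
Let q j t e := \sum_(a < k.+1) e ^+ a *:
  \sum_(l < a.+1) Bn l l (F (a - l) j t) (y^~ t) (x0 t).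

Let psolz : psol Om efld psi.
Proof. by have [] := PhiA Az. Qed.

Let psi_ext t : 0 <= t <= T -> psi t = ext (x0 t) 0.
Proof.
by move=> tT; have := psol_par psolz tT; have [_ ->] := PhiA Az; rewrite par_ext.
Qed.

Let cx0 : continuous x0.
Proof.
have [cpsi _ _] := psolz => t.
apply: (@continuous_comp _ _ _ psi usubmx); first exact: cpsi.
exact: (lin_like_usubmx _ _).1.
Qed.

Let Dx0 t : D (x0 t).
Proof. by have [] := PhiO t Az. Qed.

Let dp j t e : (j < n)%N -> ts j < t < ts j.+1 -> is_derive t 1 (fun t => p t e) (q j t e).
Proof.
move=> jn jt; have tT := piece_itv ts0 tsn tsS jn jt.
have [_ _ dpsi] := psolz.
have d0 := is_derive_lin_comp (lin_like_usubmx N 1) (dpsi j t jn jt).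
rewrite /efld col_mxKu [psi t]psi_ext // par_ext usub_ext in d0.
rewrite expr0n scale0r addr0 big_ord_recl /= expr0 scale1r big1 ?addr0 in d0; last first.
  by move=> i _; rewrite expr0n scale0r.
have ps u : p u e = x0 u + \sum_(i < k) (e ^+ i.+1 / i.+1`!%:R) *: y i.+1 u.
  by rewrite /p big_add1 big_mkord.
rewrite (_ : (fun u => p u e) = x0 + (fun u => \sum_(i < k) (e ^+ i.+1 / i.+1`!%:R) *: y i.+1 u)); last first.
  by apply/funext => u; rewrite ps.
have d1 := is_derive_sumr (index_enum 'I_k) (fun i : 'I_k =>
  is_deriveZ (e ^+ i.+1 / i.+1`!%:R) (dy (introT andP (conj (ltn0Sn i) (ltn_ord i))) jn jt)).
apply: is_derive_eq (is_deriveD d0 d1) _.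
rewrite /q big_ord_recl /= expr0 scale1r big_ord1 /=; congr (_ + _).
by apply: eq_bigr => i _; rewrite /avrhs scalerA divfK.
Qed.

Let p_near r : 0 < r -> exists2 rho, 0 < rho & forall t e : R, 0 <= t <= T -> `|e| < rho ->
  `|ext (p t e) e - psi t| < r.
Proof.
move=> r0.
have [M M0 HM] : exists2 M, 0 <= M & forall t, 0 <= t <= T ->
    \sum_(1 <= i < k.+1) `|y i t| <= M.
  elim: k => [|m [M M0 IH]].
    by exists 0 => // t tT; rewrite big_geq.
  have [M' M'0 HM] := path_bounded ts0 tsn tsS (@cy m.+1).
  exists (M + M') => [|t tT]; first exact: addr_ge0.
  by rewrite big_nat_recr //= lerD ?IH ?HM.
exists (Num.min 1 (r / (M + 1))) => [|t e tT].
  by rewrite lt_min ltr01 divr_gt0 // ltr_wpDl.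
rewrite lt_min ltr_pdivlMr ?ltr_wpDl // => /andP[e1 er].
rewrite psi_ext //; apply: norm_ext_lt; last first.
  by apply: le_lt_trans er; rewrite ler_peMr // lerDr.
rewrite /p addrAC subrr add0r; apply: le_lt_trans (ler_norm_sum _ _ _) _.
apply: (@le_lt_trans _ _ (`|e| * M)); last first.
  by apply: le_lt_trans er; rewrite ler_wpM2l // lerDl.
apply: le_trans (ler_wpM2l (normr_ge0 _) (HM t tT)); rewrite mulr_sumr !big_nat.
apply: ler_sum => -[|i] // _; rewrite normrZ ler_wpM2r //.
apply: le_trans (normr_divn_le _ (fact_gt0 _)) _.
by rewrite normrX exprS ler_piMr // exprn_ile1 // ltW.
Qed.

(** [p] solves the perturbed equation up to o(e^k), uniformly in time: Faa di Bruno's formula treats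
    the F_i, while the remainder field is bounded near the orbit and carries the factor e^(k+1). *)
Let consistency eta : 0 < eta -> exists2 rho, 0 < rho & forall j, (j < n)%N -> forall t e : R,
  0 <= t <= T -> `|e| < rho -> `|usubmx (efld j t (ext (p t e) e)) - q j t e| <= eta * `|e| ^+ k.
Proof.
move=> eta0.
apply: (uniform_small (Q := fun j rho => forall t e : R,
  0 <= t <= T -> `|e| < rho -> `|usubmx (efld j t (ext (p t e) e)) - q j t e| <= eta * `|e| ^+ k)).
  by move=> j rho rho' _ rr H t e tT er; apply: H => //; exact: lt_le_trans rr.
move=> j jn; have e2 : 0 < eta / 2 by rewrite divr_gt0.
have Fj i : (i <= k)%N -> PCr (k - i) D (F i j).
  by move=> ik; apply: PCr_le (FD ik jn); apply: leqW; exact: leq_subr.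
have LU t : 0 <= t <= T -> lo (nbhs (t, 0 : R)) snd k (fun r : R * R =>
    \sum_(i < k.+1) r.2 ^+ i *: F i j r.1 (p r.1 r.2) - q j r.1 r.2).
  by move=> _; exact: (lo_faadibruno_sum oD Fj cx0 cy (Dx0 t)).
have [r1 r10 H1] := lo_uniform LU e2.
have [cpsi Opsi _] := psolz.
have G0 : PCr 0 Om (G j) by exact: PCr_le (GD jn).
have [r2 r20 H2] := tube open_edom G0 cpsi Opsi ltr01.
have [M M0 HM] := path_coef_bounded ts0 tsn tsS G0 cpsi Opsi.
have [r3 r30 H3] := p_near r20.
have M1 : 0 < M + 1 by rewrite ltr_wpDl.
exists (Num.min r1 (Num.min r3 (eta / 2 / (M + 1)))); first by rewrite !lt_min r10 r30 !divr_gt0.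
move=> t e tT; rewrite !lt_min => /and3P[er1 er3]; rewrite ltr_pdivlMr // => er4.
have [_ GB] := H2 t _ tT (H3 t e tT er3).
have GM : `|G j t (ext (p t e) e)| <= M + 1.
  rewrite -[G j t (ext _ _)](subrK (G j t (psi t))) addrC; apply: le_trans (ler_normD _ _) _.
  by apply: lerD => //; exact: HM.
have := H1 t e tT er1; rewrite /= => h1.
rewrite /efld col_mxKu usub_ext par_ext addrAC; apply: le_trans (ler_normD _ _) _.
rewrite [eta]splitr mulrDl; apply: lerD; first exact: h1.
rewrite normrZ normrX exprSr -mulrA mulrC ler_wpM2r ?exprn_ge0 //.
by apply: le_trans (ltW er4); rewrite ler_wpM2l.
Qed.

(** The true orbit and [p] start at the same point, and their difference satisfies a linear
    differential inequality with an inhomogeneous term o(e^k), so Gronwall bounds it by o(e^k). *)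
Lemma flow_expansion : lo (nbhs (0 : R)) id k (fun e => usubmx (Phi (ext z e) T) - p T e).
Proof.
move=> eta eta0; have oO := open_edom.
have [cpsi Opsi _] := psolz.
have [r1 r10 [L L0 H1]] := tube_lipschitz ts0 tsn tsS oO efld1 cpsi Opsi.
have [r2 r20 [C C0 H2]] := flow_family_lip ts0 tsn tsS n_gt0 oO oA efld1 PhiA Az.
have [r3 r30 H3] := p_near r10.
pose K := expR (N%:R * (L + 1) * T); have K0 : 0 < K by exact: expR_gt0.
have eK : 0 < eta / K by rewrite divr_gt0.
have [r4 r40 H4] := consistency eK.
have C1 : 0 < C + 1 by rewrite ltr_wpDl.
pose r := Num.min (Num.min r2 (r1 / (C + 1))) (Num.min r3 r4).
have r0 : 0 < r by rewrite !lt_min r20 r30 r40 divr_gt0.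
apply/nbhs_ballP; exists r => // e; rewrite /ball /= sub0r normrN.
rewrite !lt_min ltr_pdivlMr // => /andP[/andP[er2 er1] /andP[er3 er4]].
have nze : `|ext z e - ext z 0| <= `|e|.
  by apply: norm_ext_le; rewrite ?subrr ?normr0.
have [Aze PhiL] := H2 _ (le_lt_trans nze er2).
have [psole Phi0] := PhiA Aze; have [cph _ dph] := psole.
have ph_ext t : 0 <= t <= T -> Phi (ext z e) t = ext (usubmx (Phi (ext z e) t)) e.
  by move=> tT; rewrite {1}(psol_par psole tT) Phi0 par_ext.
pose E t := usubmx (Phi (ext z e) t) - p t e.
pose dE j t := usubmx (efld j t (Phi (ext z e) t)) - q j t e.
have cE : continuous E.
  move=> t; apply: cvgB.
    apply: (@continuous_comp _ _ _ (Phi (ext z e)) usubmx); first exact: cph.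
    exact: (lin_like_usubmx _ _).1.
  apply: cvgD; first exact: cx0.
  apply: cvg_sumr => i _; apply: cvgZ; first exact: cvg_cst.
  exact: cy.
have dEP j t : (j < n)%N -> ts j < t < ts j.+1 -> is_derive t 1 E (dE j t).
  move=> jn jt; apply: is_deriveB; last exact: dp.
  exact: (is_derive_lin_comp (lin_like_usubmx N 1) (dph j t jn jt)).
pose c := eta / K * `|e| ^+ k; have c0 : 0 <= c by rewrite mulr_ge0 ?exprn_ge0 // ltW.
have dEle j t : (j < n)%N -> ts j < t < ts j.+1 -> `|dE j t| <= L * `|E t| + c.
  move=> jn jt; have tT := piece_itv ts0 tsn tsS jn jt.
  have n1 : `|Phi (ext z e) t - psi t| < r1.
    apply: le_lt_trans (PhiL t tT) _; apply: le_lt_trans er1.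
    by rewrite mulrC; apply: ler_pM => //; rewrite lerDl.
  have [_ lip] := H1 j t _ _ jn tT (H3 t e tT er3) n1.
  rewrite /dE -[usubmx _](subrK (usubmx (efld j t (ext (p t e) e)))) -addrA.
  apply: le_trans (ler_normD _ _) _; apply: lerD; last exact: H4.
  rewrite -linearB; apply: le_trans (norm_usubmx _) _; apply: le_trans lip _.
  by rewrite {1}(ph_ext t tT) extB norm_ext0.
have TT : 0 <= T <= T by rewrite T0 lexx.
have E0 : E 0 = 0.
  rewrite /E /p Phi0 usub_ext; have [_ ->] := PhiA Az; rewrite usub_ext big_nat big1 ?addr0 ?subrr //.
  by move=> i ik; rewrite y0 // scaler0.
have := gronwall ts0 tsn tsS L0 c0 cE dEP dEle TT; rewrite E0 normr0 mulr0 add0r.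
by rewrite -/K /c mulrAC divfK // gt_eqF.
Qed.

End family.
End Expansion.

(** * The periodic piecewise smooth system *)

Section Remainder.
Context {R : realType} (T : R).
Hypothesis T_gt0 : 0 < T.

Lemma tmod_shift u (m : int) : 0 <= u < T -> tmod T (u + m%:~R * T) = u.
Proof.
move=> /andP[u0 uT]; have E : (u + m%:~R * T) / T = u / T + m%:~R.
  by rewrite mulrDl mulfK // gt_eqF.
rewrite /tmod E (_ : Num.floor _ = m) ?addrK //; apply: floor_def.
by rewrite lerDr divr_ge0 ?(ltW T_gt0) //= intrD addrC ltrD2l ltr_pdivrMr // mul1r.
Qed.

Lemma tmod_itv t : 0 <= tmod T t < T.
Proof.
have /andP[h1 h2] := floor_itv (t / T); rewrite /tmod.
rewrite ler_pdivlMr // in h1; rewrite ltr_pdivrMr // intrD mulrDl mul1r in h2.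
by rewrite subr_ge0 h1 ltrBlDl.
Qed.

Lemma tmodE t : t = tmod T t + (Num.floor (t / T))%:~R * T.
Proof. by rewrite /tmod subrK. Qed.

Lemma tmod_id t : 0 <= t < T -> tmod T t = t.
Proof. by move=> tT; have := tmod_shift 0 tT; rewrite mul0r addr0. Qed.

Lemma tmodDr t : tmod T (t + T) = tmod T t.
Proof.
rewrite {1}(tmodE t) -addrA -[X in _ + (_ + X)]mul1r -mulrDl -(intrD _ _ 1).
exact: tmod_shift (tmod_itv t).
Qed.

Lemma periodic_int (W : Type) (f : R -> W) : (forall t, f (t + T) = f t) ->
  forall t (m : int), f (t + m%:~R * T) = f t.
Proof.
move=> fT; have H t m : f (t + m%:R * T) = f t.
  by elim: m => [|m IH]; rewrite ?mul0r ?addr0 // -natr1 mulrDl mul1r addrA fT.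
move=> t [m|m]; first exact: H.
by rewrite NegzE -(H _ m.+1) mulrNz mulNr subrK.
Qed.

Lemma continuous_clamp (X : topologicalType) (phi : R -> X) :
  {within `[0, T], continuous phi} -> continuous (phi \o clampR 0 T).
Proof.
move=> cphi t; have T0 := ltW T_gt0.
have tI := clampR_itv t T0.
have /(_ (clampR 0 T t)) := (subspace_continuousP _ _).1 cphi.
rewrite /= in_itv /= => /(_ tI) H; apply: cvg_comp H.
move=> P wP; have H' : nbhs t (fun s => `[0, T]%classic (clampR 0 T s) -> P (clampR 0 T s)).
  exact: (continuous_clampR T0 wP).
apply: (@filterS _ (nbhs t) _ _ (fun s => P (clampR 0 T s))) H' => s /=.
by move=> Ps; apply: Ps; rewrite in_itv /=; exact: clampR_itv.
Qed.

(* Both clamped arguments are needed to glue the two sides of a multiple of [T]. *)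
Lemma continuous_periodic m l (phi : R -> 'M[R]_(m, l)) :
  {within `[0, T], continuous phi} -> phi T = phi 0 -> continuous (phi \o tmod T).
Proof.
move=> /continuous_clamp cphi phiT t; have T0 := ltW T_gt0.
pose b := (Num.floor (t / T))%:~R * T; pose chi := phi \o clampR 0 T.
have cchi : {for t, continuous (fun s => chi (s - b) + chi (s - b + T) - phi 0)}.
  apply: cvgB; last exact: cvg_cst.
  have cB : {for t, continuous (fun s : R => s - b)} by apply: cvgB; [exact: cvg_id|exact: cvg_cst].
  apply: cvgD; first by apply: (continuous_comp cB); exact: cphi.
  apply: (@continuous_comp _ _ _ (fun s : R => s - b + T) chi); last exact: cphi.
  by apply: cvgD; [exact: cB|exact: cvg_cst].
apply: continuous_near_eq cchi.
have /andP[t0 tT] := tmod_itv t.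
have tb : tmod T t = t - b by [].
apply/nbhs_ballP; exists (T - tmod T t); first by rewrite /= subr_gt0.
move=> s; rewrite /ball /= tb => ts.
have s1 : s - b < T by move: ts; rewrite ltr_norml => /andP[]; lra.
have [s0|s0] := lerP 0 (s - b).
  have -> : tmod T s = s - b.
    by rewrite -{1}(subrK b s); apply: tmod_shift; rewrite s0.
  rewrite /chi /= [clampR 0 T (s - b + T)]clampR_ge ?lerDr // phiT addrK.
  by rewrite clampR_id // s0 ltW.
have s2 : 0 <= s - b + T < T by move: ts t0; rewrite tb ltr_norml => /andP[]; lra.
have -> : tmod T s = s - b + T.
  rewrite -[RHS](tmod_shift (Num.floor (t / T) - 1) s2); congr tmod.
  by rewrite intrD mulrDl -/b mulN1r addrACA subrr addr0 subrK.
have /andP[s3 s4] := s2.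
rewrite /chi /= [clampR 0 T (s - b)]clampR_le ?(ltW s0) // clampR_id ?s3 ?ltW //.
by rewrite addrAC subrr add0r.
Qed.

Lemma is_derive_shiftr (W : normedModType R) (g : R -> W) (t b : R) dg :
  is_derive (t - b) 1 g dg -> is_derive t 1 (fun s => g (s - b)) dg.
Proof.
move=> [dg1 dg2].
have E : (fun h : R => h^-1 *: (((fun s => g (s - b)) \o shift t) (h *: 1) - g (t - b))) =
    (fun h : R => h^-1 *: ((g \o shift (t - b)) (h *: 1) - g (t - b))).
  by apply/funext => h /=; rewrite addrA.
by apply: DeriveDef; rewrite /derivable /derive E.
Qed.

End Remainder.

Section ProductRule.
Context {R : realType}.

Lemma is_derive_mulmx (V : normedModType R) m n p (f : V -> 'M[R]_(m, n)) (g : V -> 'M[R]_(n, p))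
    x v df dg : is_derive x v f df -> is_derive x v g dg ->
  is_derive x v (fun y => f y *m g y) (f x *m dg + df *m g x).
Proof.
move=> fd gd; apply: is_derive_mx => i j.
have fc q := is_derive_coord i q fd; have gc q := is_derive_coord q j gd.
have := is_derive_sumr (index_enum 'I_n) (fun q => is_deriveM (fc q) (gc q)).
rewrite (_ : (fun y => \sum_q _) = fun y => (f y *m g y) i j); last first.
  by apply/funext => y; rewrite mxE.
move=> H; apply: is_derive_eq H _; rewrite !mxE -big_split /=; apply: eq_bigr => q _.
by rewrite [g x q j *: _]mulrC.
Qed.

End ProductRule.

Section Breakpoints.
Context {R : realType} (n : nat) (T : R) (ts : nat -> R).
Hypothesis ts0 : ts 0%N = 0.
Hypothesis tsn : ts n = T.
Hypothesis tsS : forall j, (j < n)%N -> ts j < ts j.+1.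

Lemma find_piece u : 0 <= u < T -> exists2 j, (j < n)%N & ts j <= u < ts j.+1.
Proof.
move=> /andP[u0 uT]; have ex : exists m, u < ts m by exists n; rewrite tsn.
case: (ex_minnP ex) => -[|m] um min_m; first by move: um; rewrite ts0 ltNge u0.
exists m; last by rewrite um andbT leNgt; apply/negP => /min_m; rewrite ltnn.
by apply: min_m; rewrite tsn.
Qed.

Lemma sum_inpiece (W : nmodType) (g : nat -> W) j t : (j < n)%N ->
  ts j <= tmod T t < ts j.+1 ->
  \sum_(1 <= i < n.+1) (if inpiece T ts i t then g i else 0) = g j.+1.
Proof.
move=> jn jt; rewrite (bigD1_seq j.+1) ?iota_uniq //=; last by rewrite mem_index_iota ltnS.
rewrite {1}/inpiece /= jt big_nat_cond big1 ?addr0 // => i /andP[/andP[i1 ik] ij].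
rewrite ltnS in ik; case/andP: jt => j1 j2; rewrite /inpiece ifF //; apply/negP => /andP[h1 h2].
case: (ltngtP i j.+1) ij => // [ij|ji] _.
  by have := lt_le_trans h2 (ts_le tsS (_ : i <= j)%N (ltnW jn)) => /(_ ij); rewrite ltNge j1.
have ji' : (j.+1 <= i.-1)%N by case: i ji {h1 h2 i1 ik}.
have := le_trans (ts_le tsS ji' (leq_trans (leq_pred _) ik)) h1.
by rewrite leNgt j2.
Qed.

End Breakpoints.

Section System.
Context {R : realType} (k d e n : nat) (T eps0 : R) (ts : nat -> R) (D : set 'cV[R]_(d + e))
  (Fi : nat -> nat -> R -> 'cV[R]_(d + e) -> 'cV[R]_(d + e))
  (Rj : nat -> R -> 'cV[R]_(d + e) -> R -> 'cV[R]_(d + e)).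
Hypothesis n_gt0 : (0 < n)%N.
Hypothesis T_gt0 : 0 < T.
Hypothesis ts0 : ts 0%N = 0.
Hypothesis tsn : ts n = T.
Hypothesis tsS : forall j, (j < n)%N -> ts j < ts j.+1.
Hypothesis oD : open D.
Hypothesis eps0_gt0 : 0 < eps0.
Hypothesis FiC : forall i j, (i <= k)%N -> (1 <= j <= n)%N ->
  Cr k.+1 [set p : R * 'cV[R]_(d + e) | D p.2] (fun p => Fi i j p.1 p.2).
Hypothesis RjC : forall j, (1 <= j <= n)%N ->
  Cr k.+1 [set p : R * 'cV[R]_(d + e) * R | D p.1.2 /\ - eps0 < p.2 < eps0]
    (fun p => Rj j p.1.1 p.1.2 p.2).

Local Notation psol := (psol n T ts).
Local Notation F := (fun i j => Fi i j.+1).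
Local Notation G := (fun j t s => Rj j.+1 t (usubmx s) (par s)).
Local Notation fld := (efld k F G).
Local Notation Om := (edom eps0 D).
Local Notation Ff := (Ffull n k T ts Fi Rj).
Local Notation Fl := (flow n k T ts Fi Rj D 0).

Lemma Fi_PCr i j : (i <= k)%N -> (j < n)%N -> PCr k.+1 D (F i j).
Proof.
move=> ik jn; have jn' : (1 <= j.+1 <= n)%N by [].
apply: (@Cr_PCr R R _ _ _ k.+1 [set p : R * 'cV[R]_(d + e) | D p.2] D
  (fun p => Fi i j.+1 p.1 p.2) (fun t x => (t, x)) (fun v => (0, v))) => //.
- by move=> q; apply: (continuous_pair (f := fst) (g := snd)); [exact: cvg_fst|exact: cvg_snd].
- by move=> t h v x; congr pair; rewrite /= scaler0 add0r.
- exact: FiC.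
Qed.

Lemma Rj_PCr j : (j < n)%N -> PCr k.+1 Om (G j).
Proof.
move=> jn; have jn' : (1 <= j.+1 <= n)%N by [].
apply: (@Cr_PCr R R _ _ _ k.+1 [set p : R * 'cV[R]_(d + e) * R | D p.1.2 /\ - eps0 < p.2 < eps0] Om
  (fun p => Rj j.+1 p.1.1 p.1.2 p.2) (fun t s => (t, usubmx s, par s))
  (fun v => (0, usubmx v, par v))).
- move=> q; apply: (continuous_pair (f := fun q => (q.1, usubmx q.2)) (g := fun q => par q.2)).
    apply: (continuous_pair (f := fst) (g := fun q => usubmx q.2)); first exact: cvg_fst.
    by apply: (@continuous_comp _ _ _ snd usubmx); [exact: cvg_snd|exact: (lin_like_usubmx _ _).1].
  apply: (@continuous_comp _ _ _ snd (@par R (d + e))); first exact: cvg_snd.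
  exact: (lin_like_coord _ _).1.
- move=> t h v s; congr (_, _, _) => /=; first by rewrite scaler0 add0r.
    exact: (lin_like_usubmx _ _).2.
  exact: (lin_like_coord _ _).2.
- by move=> t s [Ds]; rewrite ltr_norml.
- exact: RjC.
Qed.

Let oOm : open Om.
Proof. exact: open_edom oD. Qed.

Let fldP j : (j < n)%N -> PCr k.+1 Om (fld j).
Proof. exact: (efld_PCr oD Fi_PCr Rj_PCr). Qed.

Let fld1 j : (j < n)%N -> PCr 1 Om (fld j).
Proof. by move=> jn; exact: PCr_le (fldP jn). Qed.

Lemma Ffull_fld eps j t x : (j < n)%N -> ts j <= tmod T t < ts j.+1 ->
  Ff eps t x = usubmx (fld j t (ext x eps)).
Proof.
move=> jn jt; rewrite /efld col_mxKu usub_ext par_ext /Ffull; congr (_ + _ *: _).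
  by apply: eq_bigr => i _; congr (_ *: _); exact: (sum_inpiece tsS (fun j => Fi i j t x) jn jt).
exact: (sum_inpiece tsS (fun j => Rj j t x eps) jn jt).
Qed.

Let tmod_piece j t : (j < n)%N -> ts j < t < ts j.+1 -> ts j <= tmod T t < ts j.+1.
Proof.
move=> jn jt; have /andP[t0 tT] := piece_itv ts0 tsn tsS jn jt.
case/andP: jt => j1 j2; rewrite tmod_id // ?(ltW j1) //.
rewrite t0 /=; apply: lt_le_trans j2 _; rewrite -tsn.
exact: (ts_le tsS jn (leqnn n)).
Qed.

Lemma sol_psol eps z phi : `|eps| < eps0 -> sol_on n T ts D (Ff eps) z phi ->
  psol Om fld (fun t => ext (phi (clampR 0 T t)) eps).
Proof.
move=> epsl [phi0 [Dphi [cphi dphi]]]; have T0 := ltW T_gt0.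
split=> [t|t tT|j t jn jt].
- apply: (@continuous_col_mx _ _ _ _ (phi \o clampR 0 T) (fun=> const_mx eps)); last exact: cst_continuous.
  exact: (continuous_clamp T_gt0 cphi).
- by split; rewrite ?usub_ext ?par_ext //; apply: Dphi; exact: clampR_itv.
have tT := piece_itv ts0 tsn tsS jn jt; rewrite clampR_id //.
have dphit : is_derive t 1 phi (Ff eps t (phi t)).
  have /andP[j1 j2] := jt; apply: dphi => [|i ilen].
    rewrite (le_lt_trans _ j1) ?(lt_le_trans j2) // -?ts0 -?tsn.
      exact: (ts_le tsS jn (leqnn n)).
    exact: (ts_le tsS (leq0n j) (ltnW jn)).
  apply/negP => /eqP ti; case: (leqP i j) => ij.
    by have := ts_le tsS ij (ltnW jn); rewrite -ti leNgt j1.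
  by have := ts_le tsS ij ilen; rewrite -ti leNgt j2.
rewrite (Ffull_fld eps (phi t) jn (tmod_piece jn jt)) in dphit.
have := is_derive_col_mx dphit (is_derive_cst (const_mx eps : 'cV[R]_1) t 1).
have -> : col_mx (usubmx (fld j t (ext (phi t) eps))) 0 = fld j t (ext (phi t) eps).
  by rewrite /efld col_mxKu.
apply: near_eq_is_derive.
have : \forall s \near t, s \in `]ts j, ts j.+1[ by apply: near_in_itvoo; rewrite in_itv.
apply: filterS => s; rewrite in_itv /= => js.
by rewrite clampR_id //; exact: (piece_itv ts0 tsn tsS jn js).
Qed.

Lemma psol_sol eps z psi : psol Om fld psi -> psi 0 = ext z eps ->
  sol_on n T ts D (Ff eps) z (fun t => usubmx (psi t)).
Proof.
move=> ps p0; have [cpsi Opsi dpsi] := ps; split; first by rewrite p0 usub_ext.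
split; first by move=> t tT; have [] := Opsi t tT.
split.
  apply: continuous_subspaceT => t.
  apply: (@continuous_comp _ _ _ psi usubmx); first exact: cpsi.
  exact: (lin_like_usubmx _ _).1.
move=> t /andP[t0 tT] tN.
have [|j jn /andP[j1 j2]] := find_piece ts0 tsn (u := t); first by rewrite (ltW t0).
have jt : ts j < t < ts j.+1 by rewrite lt_neqAle eq_sym tN ?(ltnW jn) // j1.
rewrite (Ffull_fld eps _ jn (tmod_piece jn jt)).
have := psol_par ts0 tsn tsS ps (t := t); rewrite p0 par_ext => <-; last by rewrite !ltW.
exact: (is_derive_lin_comp (lin_like_usubmx _ _) (dpsi j t jn jt)).
Qed.

(** [flow] is the value of a solution picked by choice; on [0, T] uniqueness identifies it with any
    orbit of the extended system that starts at (z, 0). *)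
Lemma flow_psol z psi : psol Om fld psi -> psi 0 = ext z 0 ->
  forall t, 0 <= t <= T -> Fl t z = usubmx (psi t).
Proof.
move=> ps p0 t tT; rewrite /flow.
have ex : exists phi, sol_on n T ts D (Ff 0) z phi by exists (fun t => usubmx (psi t)); exact: psol_sol.
have := getPex ex; set phi := get _ => sphi.
have n0 : `|0 : R| < eps0 by rewrite normr0.
have := psol_unique ts0 tsn tsS oOm fld1 (sol_psol n0 sphi) ps.
have T0 := ltW T_gt0; have [phi0 _] := sphi.
rewrite clampR_id ?lexx // phi0 p0 => /(_ erefl t tT); rewrite clampR_id // => <-.
by rewrite usub_ext.
Qed.

(** The orbits are clamped in time so that they stay in the domain at all real times, which makes
    the coefficients along them continuous on the whole line. *)
Lemma family_ex z phi : sol_on n T ts D (Ff 0) z phi -> exists A Phi,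
  [/\ open A, A (ext z 0), flow_family n T ts Om fld A Phi & forall s t, A s -> Om (Phi s t)].
Proof.
move=> sphi; have T0 := ltW T_gt0; have [phi0 _] := sphi.
have n0 : `|0 : R| < eps0 by rewrite normr0.
have ps := sol_psol n0 sphi.
have [rho rho0 [C _ H]] := flow_ex ts0 tsn tsS n_gt0 oOm fld1 ps.
rewrite clampR_id ?lexx // phi0 in H.
have ex s : exists psi, `|s - ext z 0| < rho -> psol Om fld psi /\ psi 0 = s.
  have [sr|sr] := boolP (`|s - ext z 0| < rho); last by exists (fun=> 0).
  by have [psi [p1 p2 _]] := H s sr; exists psi.
have [Phi PhiP] := choice ex.
exists [set s | `|s - ext z 0| < rho], (fun s => Phi s \o clampR 0 T); split.
- exact: open_normB.
- by rewrite /= subrr normr0.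
- move=> s /PhiP[p1 p2]; split; first exact: psol_clamp.
  by rewrite /= clampR_id ?lexx.
- by move=> s t /PhiP[[_ Os _] _]; apply: Os; exact: clampR_itv.
Qed.

Section family.
Context (A : set 'cV[R]_(d + e + 1)) (Phi : 'cV[R]_(d + e + 1) -> R -> 'cV[R]_(d + e + 1)).
Hypothesis oA : open A.
Hypothesis PhiA : flow_family n T ts Om fld A Phi.
Hypothesis PhiO : forall s t, A s -> Om (Phi s t).
Local Notation B := [set z | A (ext z 0)].
Local Notation x0 z t := (usubmx (Phi (ext z 0) t)).
Local Notation J := (Jac n k T ts Fi Rj D).

Lemma flowE z t : B z -> 0 <= t <= T -> Fl t z = x0 z t.
Proof. by move=> Bz tT; have [ps p0] := PhiA Bz; exact: flow_psol ps p0 t tT. Qed.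

Let oB : open B.
Proof. exact: open_lin_preimage (lin_like_ext _) oA. Qed.

Lemma x0_PCr t : 0 <= t <= T -> PCr k.+1 B (fun (_ : R) z => x0 z t).
Proof.
move=> tT.
have P1 := flow_PCr ts0 tsn tsS n_gt0 oOm oA fldP PhiA tT.
have P2 := PCr_comp oB oA (fun _ z Bz => Bz) P1 (PCr_lin R k.+1 B (lin_like_ext _)).
by apply: (PCr_comp (B := setT) oB openT _ (PCr_lin R k.+1 setT (lin_like_usubmx _ _)) P2).
Qed.

Lemma flow_PCrB t : 0 <= t <= T -> PCr k.+1 B (fun (_ : R) z => Fl t z).
Proof. by move=> tT; apply: (PCr_ext oB _ (x0_PCr tT)) => _ z Bz; rewrite flowE. Qed.

Lemma JacE z t v : B z -> 0 <= t <= T -> J t z *m v = 'D_v (fun w => Fl t w) z.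
Proof.
move=> Bz tT; rewrite (PCr_derive_sum (0 : R) v oB (flow_PCrB tT) Bz).
apply/matrixP => i j; rewrite mxE summxE ord1; apply: eq_bigr => q _.
by rewrite !mxE mulrC.
Qed.

(** A kernel vector gives a variational solution of the extended system that vanishes at time t, its
    parameter block being zero; by backward uniqueness the initial vector is zero. *)
Lemma Jac_unit z t : B z -> 0 <= t <= T -> J t z \in unitmx.
Proof.
move=> Bz tT; rewrite unitmxE unitfE -det_tr; apply/negP => /det0P[v v0 vJ].
have Jv : J t z *m v^T = 0 by apply: trmx_inj; rewrite trmx_mul trmxK trmx0.
rewrite JacE // in Jv.
have [W [WP Wd]] := flow_variation ts0 tsn tsS n_gt0 oOm oA fld1 PhiA.
have dW := Wd (ext z 0) (ext v^T 0) t Bz tT.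
have uW : usubmx (W (ext z 0) (ext v^T 0) t) = 0.
  rewrite -Jv; apply/esym.
  have P1 := flow_PCr ts0 tsn tsS n_gt0 oOm oA fld1 PhiA tT.
  have d1 := PCr_chain (0 : R) (g := fun w => ext w 0) oA P1 Bz (is_derive_lin z v^T (lin_like_ext _)).
  have [_ dWE] := dW; rewrite dWE in d1.
  have [_ <-] := is_derive_lin_comp (lin_like_usubmx _ _) d1.
  apply: near_eq_derive; apply: filterS (open_nbhs_nbhs (conj oB Bz)) => w Bw.
  exact: flowE.
have dW0 : dsubmx (W (ext z 0) (ext v^T 0) t) = 0.
  have [_ <-] := is_derive_lin_comp (lin_like_dsubmx _ _) dW.
  have [_ E] := is_derive_lin (ext z 0) (ext v^T 0) (lin_like_dsubmx (R := R) (d + e) 1).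
  have -> : 0 = dsubmx (ext v^T 0) by rewrite /ext col_mxKd; apply/matrixP => i j; rewrite !mxE.
  rewrite -E; apply: near_eq_derive; apply: filterS (open_nbhs_nbhs (conj oA Bz)) => s As.
  have [ps p0] := PhiA As; rewrite (psol_par ts0 tsn tsS ps tT) p0 /ext col_mxKd.
  by rewrite -[s in RHS]ext_par /ext col_mxKd.
have W0 : W (ext z 0) (ext v^T 0) t = 0 by rewrite -[LHS]vsubmxK uW dW0 col_mx0.
have := var_sol_eq0 ts0 tsn tsS fld1 (PhiA Bz).1 (WP _ (ext v^T 0) Bz) tT W0.
move/(congr1 usubmx); rewrite usub_ext linear0 => /(congr1 trmx); rewrite trmxK trmx0 => vz.
by rewrite vz eqxx in v0.
Qed.

Lemma YT_Jac z : B z -> YT n k T ts Fi Rj D z = J T z.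
Proof.
move=> Bz; rewrite /YT.
have H j t : (j < n)%N -> Yr n k T ts Fi Rj D j.+1 t z = J t z.
  elim: j t => [//|j IH] t jn; rewrite [LHS](_ : _ = J t z *m invmx (J (ts j.+1) z) *m
    Yr n k T ts Fi Rj D j.+1 (ts j.+1) z) // IH; last exact: ltnW.
  rewrite -mulmxA mulVmx ?mulmx1 //; apply: Jac_unit => //.
  exact: (ts_itv ts0 tsn tsS (ltnW jn)).
by have := H n.-1 T; rewrite prednK //; apply.
Qed.

Section point.
Context (z : 'cV[R]_(d + e)).
Hypothesis Bz : B z.
Local Notation xz := (fun t => x0 z t).

Let cxz : continuous xz.
Proof.
have [[cpsi _ _] _] := PhiA Bz => t.
apply: (@continuous_comp _ _ _ (Phi (ext z 0)) usubmx); first exact: cpsi.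
exact: (lin_like_usubmx _ _).1.
Qed.

Let Dxz t : D (xz t).
Proof. by have [] := PhiO t Bz. Qed.

Lemma integrand_piece yy i j t : (j < n)%N -> ts j < t < ts j.+1 ->
  integrand n k T ts Fi Rj D i z yy t = avrhs F xz yy i j t.
Proof.
move=> jn jt; have tT := piece_itv ts0 tsn tsS jn jt; have jt' := tmod_piece jn jt.
rewrite /integrand /avrhs flowE // big_ord_recl subn0 scalerDr; congr (_ + _).
  by congr (_ *: _); exact: (sum_inpiece tsS (fun j => Fi i j t (xz t)) jn jt').
rewrite big_add1 big_mkord scaler_sumr; apply: eq_bigr => l _.
rewrite -sum_Sset scaler_sumr; apply: eq_bigr => b _; rewrite scalerA; congr (_ *: _).
exact: (sum_inpiece tsS (fun j => iterD (Fi (i - l.+1) j t) (dirs b (yy^~ t)) (xz t)) jn jt').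
Qed.

Lemma vint_piece (g H : R -> 'cV[R]_(d + e)) (gj : nat -> R -> 'cV[R]_(d + e)) :
  continuous H -> H 0 = 0 -> (forall j, (j < n)%N -> continuous (gj j)) ->
  (forall j t, (j < n)%N -> ts j < t < ts j.+1 -> is_derive t 1 H (gj j t)) ->
  (forall j t, (j < n)%N -> ts j < t < ts j.+1 -> g t = gj j t) ->
  forall t, 0 <= t <= T -> vint g 0 t = H t.
Proof.
move=> cH H0 cg dH gE t tT; apply/matrixP => i c; rewrite mxE (ord1 c).
have cc (u : R -> 'cV[R]_(d + e)) : continuous u -> continuous (fun s => u s i 0).
  by move=> cu s; apply: (@continuous_comp _ _ _ u (fun x : 'cV[R]_(d + e) => x i 0));
    [exact: cu|exact: (lin_like_coord _ _).1].
apply: (piecewise_integral ts0 tsn tsS (G := fun s => H s i 0) (gj := fun j s => gj j s i 0)) => //.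
- exact: cc.
- by rewrite H0 mxE.
- by move=> j jn; apply: cc; exact: cg.
- by move=> j s jn js; apply: is_derive_coord; exact: dH.
- by move=> j s jn js; rewrite (gE j s).
Qed.

Context (y : nat -> R -> 'cV[R]_(d + e)).
Hypothesis cy : forall q, continuous (y q).
Hypothesis dy : forall i, (1 <= i <= k)%N -> y i 0 = 0 /\
  forall j t, (j < n)%N -> ts j < t < ts j.+1 -> is_derive t 1 (y i) (avrhs F xz y i j t).

(** The chosen function is known to be continuous within [0, T] and to solve the integral equation.
    The primitive [H] of the right-hand side along its clamped extension equals it on [0, T] and
    solves the differential equation on the pieces, so [averaged_unique] applies. *)
Lemma ys_avg i q t : (i <= k)%N -> (1 <= q <= i)%N -> 0 <= t <= T ->
  ys n k T ts Fi Rj D i q t z = y q t.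
Proof.
elim: i q t => [|i IH] q t ik /andP[q1 qi] tT; first by case: q q1 qi.
move: qi; rewrite leq_eqVlt ltnS => /orP[/eqP->|qi]; last first.
  by rewrite /= ltn_eqF //; apply: IH; rewrite ?q1 // ltnW.
rewrite /= eqxx; have i1 : (1 <= i.+1 <= k)%N by [].
have [y0 dyi] := dy i1.
pose fam psi q := if q == i.+1 then psi else fun s => ys n k T ts Fi Rj D i q s z.
have famE psi psi' s : 0 <= s <= T -> psi s = psi' s ->
    forall q, (1 <= q <= i.+1)%N -> fam psi q s = (if q == i.+1 then psi' else y q) s.
  move=> sT ps q' /andP[q1' qi']; rewrite /fam; case: eqP => // /eqP qN.
  have q'i : (1 <= q' <= i)%N by rewrite q1' -ltnS ltn_neqAle qN.
  exact: (IH q' s (ltnW ik) q'i sT).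
pose Pr psi := {within `[0, T], continuous psi} /\ forall t, 0 <= t <= T ->
  psi t = vint (integrand n k T ts Fi Rj D i.+1 z (fam psi)) 0 t.
change ([get psi | Pr psi] t = y i.+1 t).
(* The choice does not fall back on a default value: the solution [y i.+1] of the differential
   equation satisfies the integral equation. *)
have ex : exists psi, Pr psi.
  exists (y i.+1); split=> [|s sT]; first by apply: continuous_subspaceT; exact: cy.
  apply/esym; apply: (vint_piece (@cy i.+1) y0 _ dyi) => // [j jn|j u jn ju].
    exact: (continuous_avrhs oD Fi_PCr cxz Dxz ik jn cy).
  rewrite (integrand_piece _ _ jn ju); apply: avrhs_eq => q' q'i.
  rewrite (famE (y i.+1) (y i.+1)) ?(piece_itv ts0 tsn tsS jn ju) //.
  by case: eqP => [->|].
have [] := getPex ex; set psi := get _ => cpsi psiE.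
pose psi' := psi \o clampR 0 T; pose y' q := if q == i.+1 then psi' else y q.
have cpsi' : continuous psi' by exact: (continuous_clamp T_gt0 cpsi).
have cy' q' : continuous (y' q') by rewrite /y'; case: ifP.
have [H [cH H0 dH]] := piecewise_primitive ts0 tsn tsS
  (fun j jn => continuous_avrhs oD Fi_PCr cxz Dxz ik jn cy').
have psiH s : 0 <= s <= T -> psi s = H s.
  move=> sT; rewrite psiE //; apply: (vint_piece cH H0 _ dH) => // [j jn|j u jn ju].
    exact: (continuous_avrhs oD Fi_PCr cxz Dxz ik jn cy').
  rewrite (integrand_piece _ _ jn ju); apply: avrhs_eq => q' q'i.
  have uT := piece_itv ts0 tsn tsS jn ju.
  by rewrite (famE psi psi') // /psi' /= clampR_id.
pose y2 q := if q == i.+1 then H else y q.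
have y2E : y2 i.+1 = H by rewrite /y2 eqxx.
rewrite psiH // -y2E; apply: (averaged_unique ts0 tsn tsS oD Fi_PCr cxz Dxz (y := y2) ik) => //.
- by rewrite y2E.
- by move=> q' s /andP[_ q'i] _; rewrite /y2 ltn_eqF.
- by rewrite y2E.
move=> j u jn ju; rewrite {1}y2E; have uT := piece_itv ts0 tsn tsS jn ju.
rewrite (@avrhs_eq _ _ _ _ y2 y'); first exact: dH.
by move=> q' _; rewrite /y2 /y'; case: eqP => // _; rewrite /psi' /= clampR_id // psiH.
Qed.

End point.

Definition disp (s : 'cV[R]_(d + e + 1)) := usubmx (Phi s T) - usubmx s.

Let TT : 0 <= T <= T.
Proof. by rewrite lexx ltW. Qed.

Lemma disp_PCr : PCr k.+1 A (fun _ : R => disp).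
Proof.
apply: (PCrB oA); last by apply: PCr_lin; exact: lin_like_usubmx.
have P1 := flow_PCr ts0 tsn tsS n_gt0 oOm oA fldP PhiA TT.
by apply: (PCr_comp (B := setT) oA openT _ (PCr_lin R k.+1 setT (lin_like_usubmx _ _)) P1).
Qed.

(** The displacement has two expansions of order k, one with the y_i by Gronwall and one by Taylor.
    Their difference is o(t^k), so [lead_coef_bound] with K = 0 equates the coefficients. *)
Lemma yfun_disp i z : B z -> (1 <= i <= k)%N ->
  yfun n k T ts Fi Rj D i T z = iterD disp (nseq i (pdir (d + e))) (ext z 0).
Proof.
move=> Bz /andP[i1 ik].
have [ps p0] := PhiA Bz; have [cpsi _ _] := ps.
have cxz : continuous (fun t => x0 z t).
  move=> t; apply: (@continuous_comp _ _ _ (Phi (ext z 0)) usubmx); first exact: cpsi.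
  exact: (lin_like_usubmx _ _).1.
have Dxz t : D (x0 z t) by have [] := PhiO t Bz.
have [y [cy dy]] := averaged_ex ts0 tsn tsS oD Fi_PCr cxz Dxz.
rewrite /yfun (ys_avg Bz cy dy) ?i1 ?leqnn //.
have LX := flow_expansion ts0 tsn tsS n_gt0 oD Fi_PCr Rj_PCr oA PhiA PhiO Bz cy
  (fun i ik => (dy i ik).1) (fun i j t ik => (dy i ik).2 j t).
have LT : lo (nbhs (0 : R)) id k (fun t : R => disp (ext z 0 + t *: pdir (d + e)) -
    \sum_(c < k.+1) (t ^+ c / c`!%:R) *: iterD disp (nseq c (pdir (d + e))) (ext z 0)).
  have cpd : continuous (fun _ : R => pdir (R := R) (d + e)) by move=> x; exact: cst_continuous.
  by apply: (lo_taylor (p := fun=> 0 : R) (y := fun=> ext z 0) oA (PCrS disp_PCr) cpd Bz);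
    [exact: cvg_cst|exact: cvg_cst|exact: cvg_id].
(* [b c] is c! times the coefficient of order c in the Gronwall expansion; order 0 is the
   unperturbed displacement. *)
pose b c := if c == 0%N then x0 z T - z else y c T.
pose a c := (c`!%:R)^-1 *: (b c - iterD disp (nseq c (pdir (d + e))) (ext z 0)).
have [|alow ak] := @lead_coef_bound R _ k a 0 0 (lexx 0).
  move=> eta eta0; have e2 : 0 < eta / 2 by rewrite divr_gt0.
  have FF : Filter (nbhs (0 : R)) by exact: nbhs_filter.
  have := @filterI _ _ FF _ _ (LX _ e2) (LT _ e2).
  move=> /nbhs_ballP[rr rr0 Hr]; exists rr => // t /andP[t0 tr].
  have := Hr t; rewrite /ball /= sub0r normrN gtr0_norm // => /(_ tr)[h1 h2].
  rewrite -extE in h2; rewrite scaler0 subr0 add0r.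
  set X := _ - _ in h1; set Z := _ - _ in h2.
  have -> : \sum_(c < k.+1) t ^+ c *: a c = Z - X.
    have -> : \sum_(c < k.+1) t ^+ c *: a c = \sum_(c < k.+1) (t ^+ c / c`!%:R) *: b c -
        \sum_(c < k.+1) (t ^+ c / c`!%:R) *: iterD disp (nseq c (pdir (d + e))) (ext z 0).
      by rewrite -sumrB; apply: eq_bigr => c _; rewrite -scalerBr /a scalerA.
    have -> : \sum_(c < k.+1) (t ^+ c / c`!%:R) *: b c = disp (ext z t) - X.
      rewrite big_ord_recl /X /disp usub_ext big_add1 big_mkord /= expr0 fact0 divr1 scale1r.
      rewrite [X in b 0%N + X](_ : _ = \sum_(i0 < k) (t ^+ i0.+1 / i0.+1`!%:R) *: y i0.+1 T); last first.
        by apply: eq_bigr.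
      have -> : b 0%N = x0 z T - z by [].
      move: (\sum_(_ < k) _) => S; move: (x0 z T) (usubmx _) => u w.
      by rewrite opprB [RHS]addrC addrA subrK addrAC.
    by rewrite /Z addrAC.
  apply: le_trans (ler_normB _ _) _; rewrite (splitr eta) mulrDl addrC.
  exact: lerD.
have /eqP : a i = 0.
  move: ik; rewrite leq_eqVlt => /orP[/eqP->|/alow//].
  by apply/eqP; rewrite -normr_le0 -[a k]subr0.
rewrite scaler_eq0 invr_eq0 pnatr_eq0 gtn_eqF ?fact_gt0 //= subr_eq0 /b gtn_eqF //.
by move/eqP.
Qed.

Lemma YT_PCr : PCr k B (fun (_ : R) z => YT n k T ts Fi Rj D z).
Proof.
apply: (PCr_ext oB (f := fun _ z => J T z)) => [_ z Bz|]; first by rewrite YT_Jac.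
apply/PCr_mxP => // i j.
apply: (PCr_ext oB (f := fun _ z => ('D_(ei j) (fun w => Fl T w) z) i 0)) => [_ z Bz|].
  by rewrite mxE.
exact: PCr_coord oB (PCr_derive _ (flow_PCrB TT)).
Qed.

Lemma YT_det z : B z -> \det (YT n k T ts Fi Rj D z) != 0.
Proof. by move=> Bz; rewrite YT_Jac // -unitfE -unitmxE; exact: Jac_unit. Qed.

Lemma disp0 z : B z -> disp (ext z 0) = Fl T z - z.
Proof. by move=> Bz; rewrite /disp usub_ext flowE. Qed.

Lemma disp_derive z v : B z -> 'D_(ext v 0) disp (ext z 0) = (YT n k T ts Fi Rj D z - 1%:M) *m v.
Proof.
move=> Bz; rewrite YT_Jac // mulmxBl mul1mx JacE //.
have d1 := PCr_chain (0 : R) (g := fun w => ext w 0) oA disp_PCr Bz (is_derive_lin z v (lin_like_ext _)).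
have [_ <-] := d1.
have dF : is_derive z v (fun w => Fl T w) ('D_v (fun w => Fl T w) z).
  by apply: derivableP; exact: (PCr_derivable (p := (0 : R)) (flow_PCrB TT) Bz).
have [_ <-] := is_deriveB dF (is_derive_id z v).
apply: near_eq_derive; apply: filterS (open_nbhs_nbhs (conj oB Bz)) => w Bw.
exact: disp0.
Qed.

Lemma gfun_gco i z : B z -> (i <= k)%N ->
  gfun n k T ts Fi Rj D i z = gco disp (YT n k T ts Fi Rj D) i z.
Proof.
move=> Bz; case: i => [|i] ik; first by rewrite /gco /= fact0 invr1 scale1r disp0.
by rewrite /gfun /gco yfun_disp // scalemxAr.
Qed.

Section zero_derivative.
Context (z : 'cV[R]_(d + e)).
Hypothesis Bz : B z.
Hypothesis zT : disp (ext z 0) = 0.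
Hypothesis k_gt0 : (0 < k)%N.

(** At a zero of the displacement the derivative of Y^-1 is multiplied by 0, and Y^-1 (Y - 1) = 1 -
    Y^-1 remains. *)
Lemma gfun0_derive v :
  is_derive z v (gfun n k T ts Fi Rj D 0) ((1%:M - invmx (YT n k T ts Fi Rj D z)) *m v).
Proof.
have iY : PCr k B (fun (_ : R) w => invmx (YT n k T ts Fi Rj D w)).
  by apply: (PCr_invmx oB) YT_PCr => _ w Bw; exact: YT_det.
have iY1 : PCr 1 B (fun (_ : R) w => invmx (YT n k T ts Fi Rj D w)) by exact: PCr_le iY.
have d1 : is_derive z v (fun w => invmx (YT n k T ts Fi Rj D w))
    ('D_v (fun w => invmx (YT n k T ts Fi Rj D w)) z).
  by apply: derivableP; exact: (PCr_derivable (p := (0 : R)) iY1 Bz).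
have d2 := PCr_chain (0 : R) (g := fun w => ext w 0) oA disp_PCr Bz (is_derive_lin z v (lin_like_ext _)).
have := is_derive_mulmx d1 d2; rewrite /= zT mulmx0 addr0 disp_derive // mulmxA mulmxBr mulmx1.
rewrite mulVmx; last by rewrite unitmxE unitfE; exact: YT_det.
apply: near_eq_is_derive; apply: filterS (open_nbhs_nbhs (conj oB Bz)) => w Bw /=.
by rewrite disp0.
Qed.

End zero_derivative.

Section periodic.
Hypothesis FiT : forall i j t x, (i <= k)%N -> (1 <= j <= n)%N -> D x ->
  Fi i j (t + T) x = Fi i j t x.
Hypothesis RjT : forall j t x eps, (1 <= j <= n)%N -> D x -> - eps0 < eps < eps0 ->
  Rj j (t + T) x eps = Rj j t x eps.

Lemma fld_periodic j t s (m : int) : (j < n)%N -> Om s -> fld j (t + m%:~R * T) s = fld j t s.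
Proof.
move=> jn [Ds es]; have jn' : (1 <= j.+1 <= n)%N by [].
rewrite /efld; congr (col_mx (_ + _ *: _) _).
  apply: eq_bigr => -[i ik] _ /=; congr (_ *: _).
  by apply: (periodic_int (f := fun t => Fi i j.+1 t (usubmx s))) => u; exact: FiT.
apply: (periodic_int (f := fun t => Rj j.+1 t (usubmx s) (par s))) => u.
by apply: RjT => //; rewrite -ltr_norml.
Qed.

(** An orbit on [0, T] with zero displacement is repeated periodically. Continuity at the multiples
    of T is [continuous_periodic], and the equation carries over to all periods because the fields
    are T-periodic in time. *)
Lemma periodic_solution z eps : A (ext z eps) -> disp (ext z eps) = 0 ->
  exists phi : R -> 'cV[R]_(d + e),
    (forall t, D (phi t)) /\ continuous phi /\ (forall t, phi (t + T) = phi t) /\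
    (forall t, (forall j, (j <= n)%N -> tmod T t != ts j) ->
       is_derive t (1 : R) phi (Ff eps t (phi t))) /\ phi 0 = z.
Proof.
move=> Az dz; pose psi := Phi (ext z eps); pose chi u := usubmx (psi u).
have [ps p0] := PhiA Az; have [cpsi Opsi dpsi] := ps.
have chi0 : chi 0 = z by rewrite /chi /psi p0 usub_ext.
have chiT : chi T = chi 0.
  by rewrite chi0; apply/eqP; rewrite -subr_eq0 -dz /disp usub_ext.
have cchi : continuous chi.
  move=> t; apply: (@continuous_comp _ _ _ psi usubmx); first exact: cpsi.
  exact: (lin_like_usubmx _ _).1.
exists (chi \o tmod T); split; first by move=> t; have [] := PhiO (tmod T t) Az.
split; first by apply: (continuous_periodic T_gt0) chiT; exact: continuous_subspaceT.
split; first by move=> t; rewrite /= tmodDr.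
split; last by rewrite /= tmod_id ?chi0 // lexx.
move=> t tN; have uT := tmod_itv T_gt0 t.
have [j jn /andP[j1 j2]] := find_piece ts0 tsn uT.
have ju : ts j < tmod T t < ts j.+1 by rewrite lt_neqAle eq_sym tN ?(ltnW jn) // j1.
rewrite (Ffull_fld eps _ jn (_ : ts j <= tmod T t < ts j.+1)) ?j1 // {2}(tmodE T t).
have u1 : 0 <= tmod T t <= T by case/andP: uT => -> /ltW.
have -> : ext ((chi \o tmod T) t) eps = psi (tmod T t).
  by rewrite /= /chi /psi (psol_par ts0 tsn tsS ps u1) p0 par_ext usub_ext.
rewrite fld_periodic //; last exact: PhiO.
set b := (Num.floor (t / T))%:~R * T.
have tb : t - b = tmod T t by [].
have dch : is_derive (t - b) 1 chi (usubmx (fld j (tmod T t) (psi (tmod T t)))).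
  by rewrite tb; exact: (is_derive_lin_comp (lin_like_usubmx _ _) (dpsi j _ jn ju)).
have := is_derive_shiftr dch; apply: near_eq_is_derive.
have : \forall s \near t, s \in `]ts j + b, ts j.+1 + b[.
  apply: near_in_itvoo; rewrite in_itv /=; move: ju; rewrite -tb => /andP[h1 h2].
  by apply/andP; split; lra.
apply: filterS => s; rewrite in_itv /= => /andP[h1 h2].
have sb : ts j < s - b < ts j.+1 by apply/andP; split; lra.
congr chi; have -> : s = (s - b) + b by rewrite subrK.
rewrite addrK (tmod_shift T_gt0) //; have /andP[s0 _] := piece_itv ts0 tsn tsS jn sb.
rewrite s0 /=; have /andP[_ s2] := sb; apply: lt_le_trans s2 _; rewrite -tsn.
exact: (ts_le tsS jn (leqnn n)).
Qed.

End periodic.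

End family.
End System.

(** * The bifurcation functions and their recursions *)

Section BifurcationFunctions.
Context {R : realType}.

Lemma iterD_near N m n (A : set 'cV[R]_N) (G G' : 'cV[R]_N -> 'M[R]_(m, n)) vs :
  open A -> (forall x, A x -> G x = G' x) -> forall x, A x -> iterD G vs x = iterD G' vs x.
Proof.
move=> oA GG; elim: vs => [//|v vs IH] x Ax /=; apply: near_eq_derive.
by apply: filterS (open_nbhs_nbhs (conj oA Ax)) => y Ay; exact: IH.
Qed.

Lemma Bn_near N m n l s (A : set 'cV[R]_N) (G G' : 'cV[R]_N -> 'M[R]_(m, n)) w x :
  open A -> (forall x, A x -> G x = G' x) -> A x -> Bn l s G w x = Bn l s G' w x.
Proof.
move=> oA; elim: l s G G' => [|l IH] s G G' GG Ax /=; first by rewrite GG.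
apply: eq_bigr => c _; congr (_ *: _); apply: IH => // y Ay.
exact: (iterD_near _ oA).
Qed.

Lemma differentiable_approx d m (f : 'cV[R]_d -> 'cV[R]_m) a0 : differentiable f a0 ->
  forall eta, 0 < eta -> \forall a \near a0,
  `|f a - f a0 - (\matrix_(p, q) ('D_(delta_mx q 0 : 'cV[R]_d) f a0) p 0) *m (a - a0)|
    <= eta * `|a - a0|.
Proof.
move=> df eta eta0; set M := \matrix_(_, _) _.
have ME v : 'd f a0 v = M *m v.
  rewrite {1}(cV_sum v) linear_sum; apply/matrixP => i j; rewrite mxE summxE ord1.
  by apply: eq_bigr => q _; rewrite linearZ /= mxE mulrC /M mxE deriveE.
have [_ /eqaddoP/(_ _ eta0)] := (diff_locallyP _ _).1 df.
move=> /near_ballP[rho rho0 H]; apply/near_ballP; exists rho => // a ar.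
have := H (a - a0); rewrite subr0 => /(_ ar) /=.
rewrite /= ![in X in X -> _]fctE /= subrK ME opprD addrA.
exact.
Qed.

End BifurcationFunctions.

Section Coefficients.
Context {R : realType} (k d e n : nat) (T : R) (ts : nat -> R) (D : set 'cV[R]_(d + e))
  (Fi : nat -> nat -> R -> 'cV[R]_(d + e) -> 'cV[R]_(d + e))
  (Rj : nat -> R -> 'cV[R]_(d + e) -> R -> 'cV[R]_(d + e)) (beta : 'cV[R]_d -> 'cV[R]_e).
Local Notation g := (gfun n k T ts Fi Rj D).
Local Notation gm := (gam n k T ts Fi Rj D beta).
Local Notation z := (zof beta).
Local Notation w a := (fun j => col_mx 0 (gm a j)).

Lemma gams_stable a i j : (1 <= j <= i)%N -> gams n k T ts Fi Rj D beta a i j = gm a j.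
Proof.
elim: i j => [|i IH] j /andP[j1 ji]; first by case: j j1 ji.
move: ji; rewrite leq_eqVlt ltnS => /orP[/eqP-> //|ji].
by rewrite -IH ?j1 //= ltn_eqF.
Qed.

(** One formula for all orders: at order 1 the term from S' is zero and 1! = 1, so the separate
    definition of gamma_1 fits the general one. *)
Lemma gamE a m : gm a m.+1 = - (m.+1)`!%:R *: (invmx (Delta n k T ts Fi Rj D beta a) *m
  (Bn m m.+1 (fun y => dsubmx (g 0 y)) (w a) (z a) +
   \sum_(l < m.+1) Bn l l (fun y => dsubmx (g (m.+1 - l) y)) (w a) (z a))).
Proof.
have E l s N (G : 'cV[R]_(d + e) -> 'cV[R]_N) : (l <= m)%N ->
    Bn l s G (fun j => liftb d (gams n k T ts Fi Rj D beta a m j)) (z a) = Bn l s G (w a) (z a).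
  move=> lm; apply: Bn_eq => q /andP[q1 ql]; rewrite /liftb gams_stable // q1.
  exact: leq_trans ql lm.
case: m E => [|m] E.
  have -> : gm a 1 = - (invmx (Delta n k T ts Fi Rj D beta a) *m dsubmx (g 1 (z a))) by [].
  rewrite big_ord1 (_ : Bn 0 1 _ _ _ = 0) // add0r.
  by rewrite (_ : Bn _ _ _ _ _ = dsubmx (g 1 (z a))) // (_ : 1`!%:R = 1 :> R) // scaleN1r.
rewrite [LHS]/gam [LHS]/= eqxx.
rewrite -E // -sum_Sset; congr (_ *: (_ *m (_ + _))).
by apply: eq_bigr => -[l lm] _ /=; rewrite -E // -sum_Sset.
Qed.

Lemma fbE a m : (0 < m)%N -> fb n k T ts Fi Rj D beta m a =
  \sum_(l < m.+1) Bn l l (fun y => usubmx (g (m - l) y)) (w a) (z a).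
Proof.
move=> m0; rewrite /fb big_ord_recl subn0; congr (_ + _).
rewrite big_add1 big_mkord; apply: eq_bigr => l _; exact: sum_Sset.
Qed.

(** By [Bn_diag] the lower coefficient of order m depends on gamma_m through Delta gamma_m / m!, and
    gamma_m is the value that cancels the rest. *)
Lemma dcoef_eq0 a m :
  Delta n k T ts Fi Rj D beta a \in unitmx ->
  (forall b, 'D_(col_mx 0 b) (fun y => dsubmx (g 0 y)) (z a) = Delta n k T ts Fi Rj D beta a *m b) ->
  (0 < m)%N -> \sum_(l < m.+1) Bn l l (fun y => dsubmx (g (m - l) y)) (w a) (z a) = 0.
Proof.
case: m => // m uD DD _; pose G l := Bn l l (fun y => dsubmx (g (m.+1 - l) y)) (w a) (z a).
have -> : \sum_(l < m.+2) Bn l l (fun y => dsubmx (g (m.+1 - l) y)) (w a) (z a) =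
    \sum_(l < m.+1) G l + G m.+1.
  by rewrite -(big_mkord xpredT G) big_nat_recr // big_mkord.
have -> : G m.+1 = Bn m m.+1 (fun y => dsubmx (g 0 y)) (w a) (z a) +
    ((m.+1)`!%:R)^-1 *: 'D_(w a m.+1) (fun y => dsubmx (g 0 y)) (z a).
  by rewrite /G subnn Bn_diag.
rewrite DD gamE -scalemxAr mulmxA mulmxV // mul1mx scalerA mulrN mulVf ?scaleN1r; last first.
  by rewrite pnatr_eq0 -lt0n fact_gt0.
by rewrite addrA [X in X - _]addrC subrr.
Qed.

End Coefficients.

Unset Implicit Arguments.
Theorem mainTheorem1 (R : realType) (k d e n : nat) (T eps0 : R)
  (ts : nat -> R) (D : set 'cV[R]_(d + e))
  (Fi : nat -> nat -> R -> 'cV[R]_(d + e) -> 'cV[R]_(d + e))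
  (Rj : nat -> R -> 'cV[R]_(d + e) -> R -> 'cV[R]_(d + e))
  (V : set 'cV[R]_d) (beta : 'cV[R]_d -> 'cV[R]_e) (astar : 'cV[R]_d) :
  (1 <= k)%N -> (1 <= d)%N -> (1 <= e)%N -> (1 < n)%N ->
  0 < T -> ts 0%N = 0 -> ts n = T -> (forall j, (j < n)%N -> ts j < ts j.+1) ->
  open D -> 0 < eps0 ->
  (* F_i^j : R x D -> R^m is C^{k+1} and T-periodic in t *)
  (forall i j, (i <= k)%N -> (1 <= j <= n)%N ->
     Cr k.+1 [set p : R * 'cV[R]_(d + e) | D p.2] (fun p => Fi i j p.1 p.2) /\
     (forall t x, D x -> Fi i j (t + T) x = Fi i j t x)) ->
  (* R^j : R x D x (-eps0, eps0) -> R^m is C^{k+1} and T-periodic in t *)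
  (forall j, (1 <= j <= n)%N ->
     Cr k.+1 [set p : R * 'cV[R]_(d + e) * R | D p.1.2 /\ - eps0 < p.2 < eps0]
        (fun p => Rj j p.1.1 p.1.2 p.2) /\
     (forall t x eps, D x -> - eps0 < eps < eps0 -> Rj j (t + T) x eps = Rj j t x eps)) ->
  (* the manifold Z *)
  open V -> bounded_set V ->
  (exists U : set 'cV[R]_d, open U /\ closure V `<=` U /\ Cr k.+1 U beta) ->
  (forall a, closure V a -> D (zof beta a)) ->
  (* hypothesis (H_b) *)
  (forall a, closure V a ->
     (exists phi, sol_on n T ts D (Ffull n k T ts Fi Rj 0) (zof beta a) phi) /\
     (forall phi, sol_on n T ts D (Ffull n k T ts Fi Rj 0) (zof beta a) phi ->
        phi T = zof beta a)) ->
  (* hypothesis (i) *)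
  (forall a, closure V a -> \det (Delta n k T ts Fi Rj D beta a) != 0) ->
  (* hypothesis (ii) *)
  (forall i a, (1 <= i < k)%N -> closure V a -> fb n k T ts Fi Rj D beta i a = 0) ->
  (exists a, closure V a /\ fb n k T ts Fi Rj D beta k a != 0) ->
  (* the simple zero alpha* of f_k *)
  V astar -> fb n k T ts Fi Rj D beta k astar = 0 ->
  differentiable (fb n k T ts Fi Rj D beta k) astar ->
  \det (Dfb n k T ts Fi Rj D beta k astar) != 0 ->
  exists eps1 : R, 0 < eps1 /\ exists C : R,
    forall eps : R, 0 < `|eps| < eps1 ->
      exists phi : R -> 'cV[R]_(d + e),
        (forall t, D (phi t)) /\ continuous phi /\
        (forall t, phi (t + T) = phi t) /\
        (forall t, (forall j, (j <= n)%N -> tmod T t != ts j) ->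
           is_derive t (1 : R) phi (Ffull n k T ts Fi Rj eps t (phi t))) /\
        `|phi 0 - zof beta astar| <= C * `|eps|.
Proof.
move=> k1 d1 e1 n1 T_gt0 ts0 tsn tsS oD eps0_gt0 Fi_ Rj_ oV _ [U [oU [VU Ubeta]]] _ Hb detD low _ Va fa0 dfa detM.
have n_gt0 : (0 < n)%N by exact: ltnW.
have FiC i j ik jn := (Fi_ i j ik jn).1; have RjC j jn := (Rj_ j jn).1.
pose z0 := zof beta astar.
have clV : closure V astar by exact: subset_closure.
(* One orbit, that of z at alpha*, carries the family of orbits; the other values of alpha matter
   only near alpha*, where z_alpha is covered by the same family. *)
have [[phi0 sphi0] _] := Hb _ clV.
have [A [Phi [oA Az0 PhiA PhiO]]] :=
  family_ex n_gt0 T_gt0 ts0 tsn tsS oD eps0_gt0 FiC RjC sphi0.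
pose h := disp T Phi; pose Y := YT n k T ts Fi Rj D.
pose B := [set z : 'cV[R]_(d + e) | A (ext z 0)].
have oB : open B by exact: open_lin_preimage (lin_like_ext _) oA.
have hA : PCr k.+1 A (fun _ : R => h).
  exact: (disp_PCr n_gt0 T_gt0 ts0 tsn tsS oD FiC RjC oA PhiA).
have YB : PCr k B (fun _ : R => Y).
  exact: (YT_PCr n_gt0 T_gt0 ts0 tsn tsS oD eps0_gt0 FiC RjC oA PhiA).
have dY z : B z -> \det (Y z) != 0.
  exact: (YT_det n_gt0 T_gt0 ts0 tsn tsS oD eps0_gt0 FiC RjC oA PhiA).
have dh z v : B z -> 'D_(ext v 0) h (ext z 0) = (Y z - 1%:M) *m v.
  exact: (disp_derive n_gt0 T_gt0 ts0 tsn tsS oD eps0_gt0 FiC RjC oA PhiA).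
have cbeta : {for astar, continuous beta} by case: Ubeta => cb _; apply: cb; exact: VU.
have nV : \forall a \near astar, closure V a /\ B (zof beta a).
  apply: filterI.
    by apply: filterS (open_nbhs_nbhs (conj oV Va)) => a; exact: subset_closure.
  have cz : {for astar, continuous (zof beta)}.
    by apply: (@continuous_col_mx _ _ _ _ id beta) => //; exact: cvg_id.
  by apply: cz; exact: open_nbhs_nbhs.
(* [Hb] makes every unperturbed solution from z_a return to z_a at time T, in particular the member
   of the family that starts there. *)
have hz a : closure V a -> B (zof beta a) -> h (ext (zof beta a) 0) = 0.
  move=> Vaa Ba; have [_ per] := Hb a Vaa; have [ps p0] := PhiA _ Ba.
  have := per _ (psol_sol T_gt0 ts0 tsn tsS ps p0).
  by rewrite /h /disp usub_ext => ->; rewrite subrr.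
pose gm a j := gam n k T ts Fi Rj D beta a j.
pose f := fb n k T ts Fi Rj D beta.
pose gf i := gfun n k T ts Fi Rj D i.
have gfE i y : (i <= k)%N -> B y -> gf i y = gco h Y i y.
  by move=> ik By; exact: (gfun_gco n_gt0 T_gt0 ts0 tsn tsS oD eps0_gt0 FiC RjC oA PhiA PhiO By).
have hz' : \forall a \near astar, h (ext (col_mx a (beta a)) 0) = 0.
  by apply: filterS nV => a [Vaa Ba]; exact: hz.
have ucoef : \forall a \near astar, forall m, (1 <= m <= k)%N ->
    \sum_(l < m.+1) Bn l l (fun y => usubmx (gco h Y (m - l) y))
      (fun j => col_mx 0 (gm a j)) (col_mx a (beta a)) = if m == k then f k a else 0.
  apply: filterS nV => a [Vaa Ba] m /andP[m1 mk]; transitivity (f m a).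
    rewrite /f fbE //; apply: eq_bigr => l _; apply: (Bn_near _ _ _ oB) => // y By.
    by rewrite -gfE // (leq_trans (leq_subr _ _) mk).
  (* Orders below k vanish by hypothesis (ii), and order k is f_k. *)
  by case: eqP => [->//|/eqP mN]; apply: low; rewrite // m1 ltn_neqAle mN.
have dcoef : \forall a \near astar, forall m, (1 <= m <= k)%N ->
    \sum_(l < m.+1) Bn l l (fun y => dsubmx (gco h Y (m - l) y))
      (fun j => col_mx 0 (gm a j)) (col_mx a (beta a)) = 0.
  apply: filterS nV => a [Vaa Ba] m /andP[m1 mk].
  rewrite -[RHS](@dcoef_eq0 _ k d e n T ts D Fi Rj beta a m) //.
  - apply: eq_bigr => l _; apply: (Bn_near _ _ _ oB) => // y By.
    by rewrite -gfE // (leq_trans (leq_subr _ _) mk).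
  - by rewrite unitmxE unitfE; exact: detD.
  - move=> b; have := is_derive_lin_comp (lin_like_dsubmx d e)
      (gfun0_derive n_gt0 T_gt0 ts0 tsn tsS oD eps0_gt0 FiC RjC oA PhiA Ba (hz a Vaa Ba) k1 (col_mx 0 b)).
    move=> [_ ->]; rewrite -[1%:M - _ in LHS]submxK mul_block_col !mulmx0 !add0r col_mxKd.
    by [].
have df eta : 0 < eta -> \forall a \near astar,
    `|f k a - Dfb n k T ts Fi Rj D beta k astar *m (a - astar)| <= eta * `|a - astar|.
  by move=> eta_gt0; have := differentiable_approx dfa eta_gt0; rewrite fa0; apply: filterS => a; rewrite subr0.
have [eps1 eps1_gt0 [C C0 HC]] := bifurcation_branch oA hA YB dY k1 Az0 cbeta dh hz' ucoef dcoef
  (detD _ clV) fa0 df detM.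
exists eps1; split=> //; exists C => eps /HC[z [zC Az hz0]].
have FiT i j t x ik jn := (Fi_ i j ik jn).2 t x.
have RjT j t x eps' jn := (Rj_ j jn).2 t x eps'.
have [phi [Dphi [cphi [perphi [dphi phi0z]]]]] :=
  periodic_solution T_gt0 ts0 tsn tsS PhiA PhiO FiT RjT Az hz0.
by exists phi; rewrite phi0z.
Qed.
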